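(* Let $\mathcal X,\mathcal Y$ be separable (real) Hilbert spaces with complete orthonormal bases $\{\xi_j\}_{j\ge1}$ and $\{\psi_k\}_{k\ge1}$, respectively. Let $\rho=\bigotimes_{j=1}^\infty\rho_j$ be a product probability measure on $\mathcal X$ such that: (i) the coordinates $\hat f_j:=\langle\xi_j,f\rangle_{\mathcal X}$, $f\sim\rho$, are independent with laws $\rho_j$; (ii) each $\rho_j$ has finite moments of all orders, a distribution function with an infinite number of points of increase on $\mathbb R$, and is moment determinate. For each $j$, let $\{p_n^j\}_{n\ge0}$ be the orthonormal polynomials in $L^2_{\rho_j}(\mathbb R)$, and for $\boldsymbol\alpha\in\mathbb N_F^\infty$ let $$P_{\boldsymbol\alpha}(f)=\psi_{\alpha_0}\prod_{j\ge1}p^j_{\alpha_j}(\hat f_j).$$ Then $\{P_{\boldsymbol\alpha}\}_{\boldsymbol\alpha\in\mathbb N_F^\infty}$ is a complete orthonormal basis of $L^2_\rho(\mathcal X;\mathcal Y)$. In particular, for any $K\in L^2_\rho(\mathcal X;\mathcal Y)$ and any exhaustion $\{\Lambda_N\}_{N\ge1}$ of $\mathbb N_F^\infty$ by finite sets, $$\lim_{N\to\infty}\int_{\mathcal X}\Big\|K(f)-\sum_{\boldsymbol\alpha\in\Lambda_N}c_{\boldsymbol\alpha}P_{\boldsymbol\alpha}(f)\Big\|_{\mathcal Y}^2\,d\rho(f)=0,\qquad c_{\boldsymbol\alpha}=\langle K,P_{\boldsymbol\alpha}\rangle_{L^2_\rho(\mathcal X;\mathcal Y)} .$$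
   Context: $L^2_\rho(\mathcal X;\mathcal Y)$ is the Bochner space of (not necessarily linear) Borel measurable maps $A:\mathcal X\to\mathcal Y$ with $\|A\|_{L^2_\rho}^2=\int_{\mathcal X}\|A(f)\|_{\mathcal Y}^2\,d\rho(f)<\infty$ and inner product $\langle A,B\rangle_{L^2_\rho(\mathcal X;\mathcal Y)}=\int_{\mathcal X}\langle A(f),B(f)\rangle_{\mathcal Y}\,d\rho(f)$. The product notation identifies $\mathcal X$ with $\ell^2(\mathbb N)$ through $f\mapsto(\hat f_j)_{j\ge1}$: $\rho$ is a Borel probability measure on $\mathcal X$ for which the coordinate sequence $(\hat f_j)_{j\ge1}$ has law $\bigotimes_{j\ge1}\rho_j$, each $\rho_j$ being a Borel probability measure on $\mathbb R$. Multi-indices: $\mathbb N=\{1,2,\dots\}$, $\mathbb N_0=\mathbb N\cup\{0\}$, and $\mathbb N_F^\infty=\{\boldsymbol n=(n_0,n_1,n_2,\dots)\in\mathbb N_0^\infty: n_0\in\mathbb N,\ \sum_{j\ge1}n_j<\infty\}$. Orthonormal polynomials: $p_n^j$ is the univariate polynomial of degree $n$ with positive leading coefficient, with $\langle p_n^j,p_m^j\rangle_{L^2_{\rho_j}(\mathbb R)}=\delta_{n,m}$; in particular $p_0^j\equiv1$, so the product defining $P_{\boldsymbol\alpha}$ has only finitely many non-trivial factors. A Borel probability measure $\pi$ on $\mathbb R$ with moments $\pi_k=\int x^k\,d\pi(x)$, $k\in\mathbb N_0$, all finite, is moment determinate if no other Borel probability measure on $\mathbb R$ has the same moment sequence. An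 exhaustion by finite sets is an increasing sequence of finite sets $\Lambda_1\subset\Lambda_2\subset\cdots$ whose union is $\mathbb N_F^\infty$. *)

(* Defs.v *)
From HB Require Import structures.
From mathcomp Require Import all_boot all_order all_algebra.
From mathcomp Require Import finmap.
From mathcomp Require Import all_classical all_reals all_analysis.

Set Implicit Arguments.
Unset Strict Implicit.
Unset Printing Implicit Defensive.

Import Order.TTheory GRing.Theory Num.Theory.
Import numFieldTopology.Exports numFieldNormedType.Exports.

Local Open Scope classical_set_scope.
Local Open Scope ring_scope.

Notation borel T := (g_sigma_algebraType (@open T)).

Definition separable (T : topologicalType) : Prop :=
  exists2 A : set T, countable A & dense A.

(* Together with completeness of V, this says that V is a real Hilbert space
   with inner product ip. *)
Definition induces_norm (R : realType) (V : normedModType R)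
    (ip : {dot V for idfun}) : Prop :=
  forall x : V, `|x| ^+ 2 = ip x x.

(* The index 0 is unused for sequences (xi_j), (psi_k), (rho_j), (p^j_n)
   that are numbered from 1. *)
Definition posnat : set nat := [set j | (0 < j)%N].

(* Orthonormality together with density of the linear span. The ambient space
   is a subset S of a module V with a form ip that need only be an inner
   product on S up to null vectors: for Hilbert spaces S = setT, for L^2 the
   module V is the space of all maps and S the square-integrable ones. *)
Definition complete_orthonormal_basis (R : realType) (V : lmodType R)
    (S : set V) (ip : V -> V -> R) (I : choiceType) (D : set I)
    (e : I -> V) : Prop :=
  [/\ forall i, D i -> S (e i),
      forall i j, D i -> D j -> ip (e i) (e j) = (i == j)%:R
    & forall v, S v -> forall eps : R, 0 < eps ->
        exists (J : {fset I}) (c : I -> R), [set` J] `<=` D /\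
          let r := v - \sum_(i <- J) c i *: e i in ip r r < eps ^+ 2].

Section real_line.
Context {R : realType}.
Implicit Type mu : probability (measurableTypeR R) R.

Definition distribution_function mu (x : R) : \bar R := mu `]-oo, x]%classic.

Definition point_of_increase (F : R -> \bar R) (x : R) : Prop :=
  forall eps : R, 0 < eps -> (F (x - eps)%R < F (x + eps)%R)%E.

Definition finite_moments mu : Prop :=
  forall k : nat, mu.-integrable setT (fun x : R => (x ^+ k)%:E).

Definition moment mu (k : nat) : \bar R := \int[mu]_(x in setT) ((x : R) ^+ k)%:E.

Definition moment_determinate mu : Prop :=
  forall nu : probability (measurableTypeR R) R,
    finite_moments nu -> (forall k, moment nu k = moment mu k) ->
    forall A : set (measurableTypeR R), measurable A -> nu A = mu A.

Definition orthonormal_polynomials mu (p : nat -> {poly R}) : Prop :=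
  [/\ forall n, size (p n) = n.+1,
      forall n, 0 < lead_coef (p n)
    & forall n m, (\int[mu]_(x in setT) ((p n).[x] * (p m).[x])%:E =
                   ((n == m)%:R)%:E)%E].

End real_line.

Definition mutually_independent d (T : measurableType d) (R : realType)
    (P : probability T R) (I : choiceType) (D : set I) (Z : I -> T -> R) :
    Prop :=
  forall (J : {fset I}) (A : I -> set (measurableTypeR R)),
    [set` J] `<=` D -> (forall i, measurable (A i)) ->
    P (\bigcap_(i in [set` J]) (Z i @^-1` A i)) =
    (\prod_(i <- J) P (Z i @^-1` A i))%E.

Definition coordinate (R : realType) (X : normedModType R)
    (dotX : {dot X for idfun}) (xi : nat -> X) (j : nat) : X -> R :=
  fun f => dotX (xi j) f.

Definition product_measure_on (R : realType) (X : normedModType R)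
    (dotX : {dot X for idfun}) (xi : nat -> X)
    (rho : probability (borel X) R)
    (rho_ : nat -> probability (measurableTypeR R) R) : Prop :=
  mutually_independent rho posnat (coordinate dotX xi) /\
  forall j, posnat j -> forall A : set (measurableTypeR R), measurable A ->
    pushforward rho (coordinate dotX xi j) A = rho_ j A.

Section bochner_L2.
Context {R : realType} {X Y : normedModType R} (rho : probability (borel X) R).

Definition bochner_L2 : set (X -> Y) :=
  [set A | measurable_fun setT (A : borel X -> borel Y) /\
           (\int[rho]_(f in setT) (`|A f| ^+ 2)%:E < +oo)%E].

Definition bochner_L2_inner (dotY : {dot Y for idfun}) (A B : X -> Y) : R :=
  Rintegral rho setT (fun f => dotY (A f) (B f)).

End bochner_L2.

(* As the entries are natural numbers, finiteness of the sum means bounded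
   partial sums. *)
Definition multi_index : set (nat -> nat) :=
  [set a | (0 < a 0)%N /\
           exists M, forall N, (\sum_(1 <= j < N) a j <= M)%N].

(* The product is a finitely supported big operator, equal to 1 by convention
   if infinitely many factors differ from 1. This never happens for a
   multi-index and orthonormal polynomials, as then p j 0 = 1. *)
Definition product_polynomial (R : realType) (X Y : normedModType R)
    (dotX : {dot X for idfun}) (xi : nat -> X) (psi : nat -> Y)
    (p : nat -> nat -> {poly R}) (a : nat -> nat) : X -> Y :=
  fun f => (\big[*%R/1]_(j \in posnat)
              (p j (a j)).[coordinate dotX xi j f]) *: psi (a 0%N).

Definition exhaustion (L : nat -> {fset (nat -> nat)}) : Prop :=
  (forall N, L N `<=` L N.+1)%fset /\ \bigcup_N [set` L N] = multi_index.

(* Main.v *)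
From HB Require Import structures.
Require Import Defs.
From mathcomp Require Import all_boot all_order all_algebra.
From mathcomp Require Import finmap.
From mathcomp Require Import all_classical all_reals all_analysis measurable_realfun.
From mathcomp Require Import ring lra zify.

(** Orthonormality comes from independence: the expectation of a product of
    functions of distinct coordinates is the product of the expectations
    ([independent_products]), so the inner product of two product polynomials
    is a product of Kronecker deltas.

    Completeness is a density statement. A square-integrable map is the
    mean-square limit of its truncations to finitely many coordinates of Y
    ([truncation_approx]), so it suffices that the span H of the scalar
    products of polynomials is dense in L^2(rho) ([scalar_density]).

    The one-variable ingredient is due to M. Riesz: if mu is moment determinate
    and s(x) = 1 / (1 + x^2), then p s lies in the L^2(mu)-closure of the
    polynomials for every polynomial p ([poly_cauchy_kernel_closure]). The
    moment functional extends to a positive functional on the functions of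
    polynomial growth whose value at s is the supremum of the integrals of the
    polynomial minorants of s ([positive_extension]); this functional is given
    by a measure ([representing_measure]), which is mu by determinacy. Hence
    there is a polynomial q <= s with integral of s - q less than e. Now
    1 - (1 + x^2) q is nonnegative, thus a sum of squares of polynomials u
    ([nonneg_poly_sum_of_squares]), and the sum of the integrals of u^2 s is
    less than e. Reduction modulo 1 + x^2 yields remainders a x + b with
    sum (b^2 - a^2) = 1, so for one of the u the integral of u^2 s is less than
    e (a^2 + b^2) ([minorant_witness]); dividing that u by 1 + x^2 exhibits
    polynomials close to s and to x s.

    The passage to infinitely many variables uses multipliers, the bounded
    functions that multiply H into its closure. By Riesz's theorem and
    independence (x_j - c) s(x_j) is a multiplier. Multipliers form an algebra
    stable under bounded pointwise limits, so the indicator of x_j > c is a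
    multiplier too ([multiplier_indic_gt0]), and the sets whose indicator is a
    multiplier form a sigma-algebra ([multiplier_sigma_algebra]). The Borel sets
    of a separable Hilbert space are generated by these half-spaces
    ([borel_coordinate_measurable]), hence every bounded Borel function is a
    multiplier, and as 1 belongs to H the closure of H is all of L^2(rho)
    ([l2_closure_full]).

    Finally, partial sums of a Fourier expansion are best approximations, so
    density of the span makes them converge along every exhaustion
    ([exhaustion_approx]). *)

Set Implicit Arguments.
Unset Strict Implicit.
Unset Printing Implicit Defensive.

Import Order.TTheory GRing.Theory Num.Theory.
Import numFieldTopology.Exports numFieldNormedType.Exports.

Local Open Scope classical_set_scope.
Local Open Scope ring_scope.

(** * The Hahn-Banach theorem for sublinear functionals *)

Section hahn_banach.
Context {R : realType} {V : lmodType R}.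
Variables (E : set V) (p : V -> R).
Hypothesis E_lin : forall a u v, E u -> E v -> E (a *: u + v).
Hypothesis p_add : forall u v, E u -> E v -> p (u + v) <= p u + p v.
Hypothesis p_hom : forall a u, 0 < a -> E u -> p (a *: u) = a * p u.

Let E0 u : E u -> E 0.
Proof. by move=> Eu; have := E_lin (-1) Eu Eu; rewrite scaleN1r addNr. Qed.

Let EZ a u : E u -> E (a *: u).
Proof. by move=> Eu; rewrite -[_ *: _]addr0; apply: E_lin => //; exact: E0 Eu. Qed.

Let ED u v : E u -> E v -> E (u + v).
Proof. by move=> Eu Ev; rewrite -[u]scale1r; exact: E_lin. Qed.

Let p0 u : E u -> p 0 = 0.
Proof.
move=> /E0 e0; have := @p_hom 2 0 (ltr0n _ 2) e0; rewrite scaler0.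
by move=> h; lra.
Qed.

(** Partial functionals are encoded by their graphs: for a linear subspace of
    V x R lying below p, single-valuedness comes for free. The last clause is
    conditional so that the empty graph, the union of the empty chain in Zorn's
    lemma, qualifies. *)
Definition dominated_graph (v0 : V) : set (set (V * R)) := [set G |
  [/\ forall v r, G (v, r) -> E v /\ r <= p v,
      forall a v r w s, G (v, r) -> G (w, s) -> G (a *: v + w, a * r + s)
    & G !=set0 -> G (v0, - p (- v0))]].

Lemma dominated_graph_bigcup v0 (F : set (set (V * R))) :
  F `<=` dominated_graph v0 -> total_on F subset ->
  dominated_graph v0 (\bigcup_(G in F) G).
Proof.
move=> FG Ftot; split.
- by move=> v r [G FGG Gvr]; have [h _ _] := FG _ FGG; exact: h.
- move=> a v r w s [G FG1 Gvr] [G' FG2 Gws].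
  have [GG'|G'G] := Ftot _ _ FG1 FG2.
    by exists G' => //; have [_ h _] := FG _ FG2; apply: h => //; exact: GG'.
  by exists G => //; have [_ h _] := FG _ FG1; apply: h => //; exact: G'G.
- move=> [[v r] [G FG1 Gvr]]; exists G => //.
  by have [_ _ h] := FG _ FG1; apply: h; exists (v, r).
Qed.

Lemma dominated_graph_line v0 : E v0 ->
  dominated_graph v0 [set z | exists t, z = (t *: v0, t * - p (- v0))].
Proof.
move=> Ev0; split => [v r [t [-> ->]]|a v r w s [t [-> ->]] [t' [-> ->]]|_].
- split; first exact: EZ.
  have EN : E (- v0) by rewrite -scaleN1r; exact: EZ.
  have [t0|t0|<-] := ltgtP 0 t.
  + rewrite p_hom//; have := p_add Ev0 EN; rewrite subrr (p0 Ev0) => h.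
    by rewrite ler_pM2l//; lra.
  + rewrite (_ : t *: v0 = (- t) *: (- v0)); last by rewrite scaleNr scalerN opprK.
    by rewrite p_hom ?oppr_gt0// mulrN mulNr.
  + by rewrite scale0r mul0r (p0 Ev0).
- by exists (a * t + t'); rewrite scalerDl scalerA mulrDl mulrA.
- by exists 1; rewrite scale1r mul1r.
Qed.

(** The value at w is the infimum of the numbers p (v + w) - r over the graph;
    sublinearity makes every r - p (v - w) a lower bound of them. *)
Lemma dominated_graph_extend v0 G w : dominated_graph v0 G -> G !=set0 ->
  E w -> exists c, dominated_graph v0
    [set z | exists t v r, G (v, r) /\ z = (v + t *: w, r + t * c)].
Proof.
move=> [Gp Glin Gv0] [[v1 r1] G1] Ew.
have EN : E (- w) by rewrite -scaleN1r; exact: EZ.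
pose S := [set p (z.1 + w) - z.2 | z in G].
have lbS v r : G (v, r) -> lbound S (r - p (v - w)).
  move=> Gvr _ [[v' r'] Gvr' <-] /=.
  have [Ev _] := Gp _ _ Gvr; have [Ev' _] := Gp _ _ Gvr'.
  have := Glin 1 _ _ _ _ Gvr Gvr'; rewrite scale1r mul1r => /Gp[_].
  rewrite (_ : v + v' = (v' + w) + (v - w)); last by rewrite addrACA subrr addr0 addrC.
  by have := p_add (ED Ev' Ew) (ED Ev EN); lra.
have S0 : S !=set0 by exists (p (v1 + w) - r1), (v1, r1).
have Slb : has_lbound S by exists (r1 - p (v1 - w)); exact: lbS.
have G00 : G (0, 0).
  by have := Glin (-1) _ _ _ _ G1 G1; rewrite scaleN1r mulN1r !addNr.
exists (inf S); split.
- move=> _ _ [t [v [r [Gvr [-> ->]]]]].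
  have [Ev rv] := Gp _ _ Gvr; split; first by apply: ED => //; exact: EZ.
  have Gt a : G (a *: v, a * r).
    by have := Glin a _ _ _ _ Gvr G00; rewrite !addr0.
  have [t0|t0|<-] := ltgtP 0 t; last by rewrite scale0r mul0r !addr0.
  + have : inf S <= p (t^-1 *: v + w) - t^-1 * r.
      by apply: ge_inf => //; exists (t^-1 *: v, t^-1 * r).
    rewrite -(ler_pM2l t0) mulrBr -p_hom//; last by apply: ED => //; exact: EZ.
    rewrite scalerDr scalerA mulrA divff ?gt_eqF// scale1r mul1r.
    by lra.
  + pose s := - t; have s0 : 0 < s by rewrite oppr_gt0.
    have : s^-1 * r - p (s^-1 *: v - w) <= inf S.
      by apply: lb_le_inf => //; exact: lbS.
    rewrite -(ler_pM2l s0) mulrBr -p_hom//; last by apply: ED => //; exact: EZ.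
    rewrite scalerDr scalerA mulrA divff ?gt_eqF// scale1r mul1r scalerN -scaleNr.
    by rewrite /s opprK mulNr; lra.
- move=> a _ _ _ _ [t [v [r [Gvr [-> ->]]]]] [t' [v' [r' [Gvr' [-> ->]]]]].
  exists (a * t + t'), (a *: v + v'), (a * r + r'); split; first exact: Glin.
  congr pair; last by ring.
  by rewrite scalerDr scalerDl scalerA addrACA.
- move=> _; exists 0, v0, (- p (- v0)); split; last by rewrite scale0r mul0r !addr0.
  by apply: Gv0; exists (v1, r1).
Qed.

(** The Hahn-Banach theorem for a sublinear functional. Taking the value at v0
    as small as p allows is possible since t v0 |-> - t p(- v0) lies below p on
    the line through v0. *)
Theorem hahn_banach v0 : E v0 -> exists L : V -> R,
  [/\ forall a u v, E u -> E v -> L (a *: u + v) = a * L u + L v,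
      forall u, E u -> L u <= p u
    & L v0 = - p (- v0)].
Proof.
move=> Ev0.
have [G [Gdom Gmax]] := Zorn_bigcup (@dominated_graph_bigcup v0).
have G0 : G !=set0.
  apply/set0P/eqP => G0; apply: (Gmax _ _ (dominated_graph_line Ev0)).
  rewrite G0; split; first exact: sub0set.
  by move=> /(_ (1 *: v0, 1 * - p (- v0))); apply; exists 1.
have [Gp Glin /(_ G0) Gv0] := Gdom.
have Gfun v r s : G (v, r) -> G (v, s) -> r = s.
  have le r' s' : G (v, r') -> G (v, s') -> r' <= s'.
    move=> Gr Gs; have := Glin (-1) _ _ _ _ Gs Gr.
    rewrite scaleN1r addNr => /Gp[_]; rewrite (p0 Ev0); lra.
  by move=> Gr Gs; apply/eqP; rewrite eq_le !le.
have Gtot v : E v -> exists r, G (v, r).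
  move=> Ev; apply: contrapT => /forallNP Gv.
  have [c Gc] := dominated_graph_extend Gdom G0 Ev.
  apply: (Gmax _ _ Gc); split.
    by move=> [u r] Gur; exists 0, u, r; rewrite scale0r mul0r !addr0.
  move=> /(_ (v, c)) Gvc; apply: (Gv c); apply: Gvc.
  have [[u r] Gur] := G0; exists 1, 0, 0.
  have := Glin (-1) _ _ _ _ Gur Gur; rewrite scaleN1r mulN1r !addNr => G00.
  by rewrite scale1r mul1r !add0r.
pose L v := xget 0 [set r | G (v, r)].
have LP v : E v -> G (v, L v).
  by move=> /Gtot[r Gr]; rewrite /L; case: xgetP => [s _ //|/(_ r)]; exact.
exists L; split.
- move=> a u v Eu Ev; apply: (Gfun (a *: u + v)); last by apply: Glin; exact: LP.
  exact/LP/E_lin.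
- by move=> u Eu; have [] := Gp _ _ (LP _ Eu).
- exact: Gfun (LP _ Ev0) Gv0.
Qed.

End hahn_banach.

(** * Nonnegative polynomials are sums of squares *)

Section sum_of_squares.
Context {R : realType}.
Implicit Types p q : {poly R}.

(** If q is eventually bounded below by d > 0, then q x outgrows any constant
    term, which is the inductive step from q to q X + c. *)
Lemma lead_coef_gt0_bounded_below p : 0 < lead_coef p ->
  exists d n : R, 0 < d /\ forall x, n <= x -> d <= p.[x].
Proof.
elim/poly_ind: p => [|p c IH]; first by rewrite lead_coef0 ltxx.
have [->|p0] := eqVneq p 0.
  rewrite mul0r add0r lead_coefC => c0; exists c, 0; split => // x _.
  by rewrite hornerC.
rewrite lead_coefDl ?lead_coefMX => [/IH[d [n [d0 dn]]]|]; last first.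
  by rewrite size_polyC size_mulX// (leq_ltn_trans (leq_b1 _))// ltnS size_poly_gt0.
exists 1, (Num.max n ((1 + `|c|) / d)); split => // x; rewrite ge_max => /andP[nx cx].
rewrite hornerMXaddC; have := dn _ nx.
move: cx; rewrite ler_pdivrMr// => cx dpx.
have x0 : 0 <= x by rewrite -(pmulr_lge0 _ d0) (le_trans _ cx)// addr_ge0.
have := ler_wpM2r x0 dpx; have := ler_norm (- c); rewrite normrN; lra.
Qed.

Lemma nonneg_poly_lead_coef p : p != 0 -> (forall x, 0 <= p.[x]) -> 0 < lead_coef p.
Proof.
move=> p0 pge0; rewrite lt_def lead_coef_eq0 p0 leNgt; apply/negP => lp0.
have [|d [n [d0 /(_ n (lexx _))]]] := @lead_coef_gt0_bounded_below (- p).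
  by rewrite lead_coefN oppr_gt0.
by rewrite hornerN; have := pge0 n; lra.
Qed.

(** Coercivity at both ends, the left one by substituting - X, confines the
    minimum to a segment. *)
Lemma nonneg_poly_has_min p : (forall x, 0 <= p.[x]) ->
  exists a, forall x, p.[a] <= p.[x].
Proof.
move=> p_ge0; have [/size1_polyC ->|sp] := leqP (size p) 1.
  by exists 0 => x; rewrite !hornerC.
have right q : (forall x, 0 <= q.[x]) -> (1 < size q)%N ->
    exists n, forall x, n <= x -> q.[0] <= q.[x].
  move=> q_ge0 sq; have lq : (size (- q.[0]%:P)%R < size q)%N.
    by rewrite size_polyN size_polyC (leq_ltn_trans (leq_b1 _)).
  have [|d [n [d0 dn]]] := @lead_coef_gt0_bounded_below (q - q.[0]%:P).
    rewrite lead_coefDl//; apply: nonneg_poly_lead_coef => //.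
    by rewrite -size_poly_gt0 (ltn_trans _ sq).
  exists n => x /dn; rewrite !hornerE; lra.
have [n pn] := right _ p_ge0 sp.
have [||m pm] := right (p \Po (- 'X)).
- by move=> x; rewrite horner_comp.
- by rewrite size_comp_poly2// size_polyN size_polyX.
pose b := 1 + `|n| + `|m|.
have bn : n <= b by rewrite /b; have := ler_norm n; have := normr_ge0 m; lra.
have bm : m <= b by rewrite /b; have := ler_norm m; have := normr_ge0 n; lra.
have b0 : 0 <= b by rewrite /b; have := normr_ge0 m; have := normr_ge0 n; lra.
have cp : {within `[- b, b], continuous (horner p)}.
  by apply/continuous_subspaceT => x; exact: continuous_horner.
have [|a ab amin] := EVT_min _ cp; first lra.
exists a => x; have a0 : p.[a] <= p.[0] by apply: amin; rewrite in_itv/=; lra.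
have [bx|xb] := leP b x; first by apply: (le_trans a0); apply: pn; lra.
have [xb'|bx] := leP x (- b); last by apply: amin; rewrite in_itv/= !ltW.
apply: (le_trans a0); have := pm (- x); rewrite !horner_comp !hornerE opprK oppr0.
by apply; lra.
Qed.

(** If p = q (X - a) is nonnegative, then q changes sign at a, so q(a) = 0 by
    continuity. *)
Lemma nonneg_poly_double_root p a : (forall x, 0 <= p.[x]) -> root p a ->
  exists q, p = q * ('X - a%:P) ^+ 2 /\ forall x, 0 <= q.[x].
Proof.
move=> p0 /factor_theorem[q pE].
have qxa x : 0 <= q.[x] * (x - a) by have := p0 x; rewrite pE !hornerE.
have qa : q.[a] = 0.
  have cq : q.[x] @[x --> a] --> q.[a] by exact: continuous_horner.
  apply/eqP; rewrite eq_le; apply/andP; split.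
  - apply: (@closed_cvg _ R^o (a^'-) _ (fun x => q.[x]) (fun y => y <= 0)) => //.
    + by near=> x; rewrite -(@nmulr_lge0 _ (x - a)) ?qxa// subr_lt0.
    + exact: cvg_at_left_filter.
  - apply: (@closed_cvg _ R^o (a^'+) _ (fun x => q.[x]) (fun y => 0 <= y)) => //.
    + by near=> x; rewrite -(@pmulr_lge0 _ (x - a)) ?qxa// subr_gt0.
    + exact: cvg_at_right_filter.
have /factor_theorem[r qE] : root q a by exact/rootP.
have rxa x : x != a -> 0 <= r.[x].
  move=> xa; have := qxa x; rewrite qE !hornerE -mulrA -expr2 pmulr_lge0//.
  by rewrite exprn_even_gt0//= subr_eq0.
exists r; split => [|x]; first by rewrite pE qE -mulrA expr2.
have [->|/rxa//] := eqVneq x a.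
have cr : r.[x] @[x --> a] --> r.[a] by exact: continuous_horner.
apply: (@closed_cvg _ R^o (a^'+) _ (fun x => r.[x]) (fun y => 0 <= y)) => //.
- by near=> y; apply: rxa; rewrite gt_eqF.
- exact: cvg_at_right_filter.
Unshelve. all: by end_near. Qed.

(** Subtracting the minimum, a square since it is nonnegative, leaves a
    nonnegative polynomial with a double root, and the quotient by the square of
    the linear factor has lower degree. *)
Theorem nonneg_poly_sum_of_squares p : (forall x, 0 <= p.[x]) ->
  exists s : seq {poly R}, p = \sum_(u <- s) u ^+ 2.
Proof.
have [n] := ubnP (size p); elim: n p => // n IH p; rewrite ltnS => sp p0.
have [a amin] := nonneg_poly_has_min p0.
have [| |q [pE q0]] := @nonneg_poly_double_root (p - p.[a]%:P) a.
- by move=> x; rewrite !hornerE subr_ge0.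
- by apply/rootP; rewrite !hornerE subrr.
have [s qE] : exists s : seq {poly R}, q = \sum_(u <- s) u ^+ 2.
  have [->|qn0] := eqVneq q 0; first by exists [::]; rewrite big_nil.
  apply: IH => //; have : (size (p - p.[a]%:P)%R <= maxn (size p) 1)%N.
    by rewrite (leq_trans (size_polyD _ _))// size_polyN geq_max leq_maxl leq_max
      size_polyC leq_b1 orbT.
  rewrite pE size_Mmonic ?monic_exp ?monicXsubC// size_exp_XsubC addn3/=.
  by rewrite leq_max => /orP[/ltnW/leq_trans/(_ sp)|].
exists ((Num.sqrt p.[a])%:P :: [seq u * ('X - a%:P) | u <- s]).
rewrite big_cons big_map -[LHS](subrK p.[a]%:P) pE addrC; congr (_ + _).
  by rewrite -rmorphXn/= sqr_sqrtr.
by rewrite qE big_distrl/=; apply: eq_bigr => u _; rewrite exprMn.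
Qed.

End sum_of_squares.

(** * The moment functional and its positive extensions *)

Section moment_functional.
Context {R : realType} (mu : probability (measurableTypeR R) R).
Hypothesis mu_moments : finite_moments mu.
Implicit Types (p q : {poly R}) (u v : R -> R^o).

Lemma integrable_poly q : mu.-integrable setT (EFin \o horner q).
Proof.
have -> : EFin \o horner q = (fun x => \sum_(i < size q) (q`_i)%:E * (x ^+ i)%:E)%E.
  apply/funext => x /=; rewrite horner_coef -sumEFin.
  by apply: eq_bigr => i _; rewrite EFinM.
apply: integrable_sum => // i _; apply: integrableZl => //.
Qed.

Definition poly_integral q : R := Rintegral mu setT (horner q).

Lemma poly_integral_lin a p q :
  poly_integral (a *: p + q) = a * poly_integral p + poly_integral q.
Proof.
have ip : mu.-integrable setT (EFin \o (fun x => a * p.[x])).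
  by apply: (integrableZl _ a (integrable_poly p)).
rewrite /poly_integral -RintegralZl//; last exact: integrable_poly.
rewrite -RintegralD//; last exact: integrable_poly.
by congr Rintegral; apply/funext => x; rewrite !hornerE.
Qed.

Lemma poly_integral_le p q : (forall x, p.[x] <= q.[x]) ->
  poly_integral p <= poly_integral q.
Proof. 
move=> pq; rewrite /poly_integral.
by apply: (le_Rintegral measurableT (integrable_poly p) (integrable_poly q)).
Qed.

Lemma poly_integral1 : poly_integral 1 = 1.
Proof.
rewrite /poly_integral (_ : horner 1 = cst 1); last first.
  by apply/funext => x; rewrite hornerE.
by rewrite Rintegral_cst// mul1r -[RHS]/(fine 1%E); congr fine; exact: probability_setT.
Qed.

Lemma poly_integral0 : poly_integral 0 = 0.
Proof.
by have := poly_integral_lin (-1) 1 1; rewrite scaleN1r addNr mulN1r addNr.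
Qed.

Lemma poly_integralN p : poly_integral (- p) = - poly_integral p.
Proof.
by have := poly_integral_lin (-1) p 0; rewrite scaleN1r addr0 poly_integral0 addr0 mulN1r.
Qed.

Lemma poly_integralD p q : poly_integral (p + q) = poly_integral p + poly_integral q.
Proof. by have := poly_integral_lin 1 p q; rewrite scale1r mul1r. Qed.

Lemma poly_integralZ a p : poly_integral (a *: p) = a * poly_integral p.
Proof. by have := poly_integral_lin a p 0; rewrite addr0 poly_integral0 addr0. Qed.

(** Discontinuous functions are included on purpose: the distribution function
    of a functional is read off from its values at indicators. *)
Definition poly_bounded : set (R -> R^o) :=
  [set u | exists q : {poly R}, forall x, `|u x| <= q.[x]].

Lemma poly_bounded_lin a u v : poly_bounded u -> poly_bounded v ->
  poly_bounded (a *: u + v).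
Proof.
move=> [p pu] [q qv]; exists (`|a| *: p + q) => x.
rewrite !hornerE (le_trans (ler_normD _ _))// lerD//.
by rewrite normrM ler_wpM2l.
Qed.

Lemma poly_bounded_poly q : poly_bounded (horner q).
Proof.
exists (1 + q ^+ 2) => x; rewrite !hornerE -[_ ^+ 2]real_normK ?num_real//.
by have := sqr_ge0 (`|q.[x]| - 1 / 2); rewrite sqrrB; lra.
Qed.

Lemma poly_bounded_le u v : poly_bounded v -> (forall x, `|u x| <= `|v x|) ->
  poly_bounded u.
Proof. by move=> [q qv] uv; exists q => x; exact: le_trans (uv x) _. Qed.

Let majorants u : set R := [set poly_integral q | q in [set q | forall x, u x <= q.[x]]].

(** The sublinear gauge of the extension problem: linear functionals below it
    are positive and agree with the integral on polynomials. *)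
Definition upper_integral u : R := inf (majorants u).

Let majorants_inf u : poly_bounded u -> has_inf (majorants u).
Proof.
move=> [q qu]; split.
  exists (poly_integral q), q => //= x; exact: le_trans (ler_norm _) _.
exists (poly_integral (- q)) => _ [p /= up <-]; apply: poly_integral_le => x.
by rewrite hornerE (le_trans _ (up x))// lerNl (le_trans _ (qu x))// -normrN ler_norm.
Qed.

Lemma upper_integral_le u q : poly_bounded u -> (forall x, u x <= q.[x]) ->
  upper_integral u <= poly_integral q.
Proof. by move=> /majorants_inf[_ ub] uq; apply: ge_inf => //; exists q. Qed.

Lemma upper_integral_approx u e : poly_bounded u -> 0 < e ->
  exists2 q, forall x, u x <= q.[x] & poly_integral q < upper_integral u + e.
Proof.
by move=> /majorants_inf ub e0; have [_ [q uq <-] qe] := inf_adherent e0 ub; exists q.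
Qed.

Lemma upper_integral_add u v : poly_bounded u -> poly_bounded v ->
  upper_integral (u + v) <= upper_integral u + upper_integral v.
Proof.
move=> bu bv; apply/ler_addgt0Pr => e e0.
have e20 : 0 < e / 2 by rewrite divr_gt0.
have [p up pe] := upper_integral_approx bu e20.
have [q vq qe] := upper_integral_approx bv e20.
have buv : poly_bounded (u + v).
  by rewrite -[u]scale1r; exact: poly_bounded_lin.
have : upper_integral (u + v) <= poly_integral (p + q).
  by apply: upper_integral_le => // x; rewrite hornerE lerD.
by rewrite poly_integralD; lra.
Qed.

Lemma upper_integral_hom a u : 0 < a -> poly_bounded u ->
  upper_integral (a *: u) = a * upper_integral u.
Proof.
move=> a0 bu.
have half b v : 0 < b -> poly_bounded v ->
    upper_integral (b *: v) <= b * upper_integral v.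
  move=> b0 bv; apply/ler_addgt0Pr => e e0.
  have [q vq qe] := upper_integral_approx bv (divr_gt0 e0 b0).
  have : upper_integral (b *: v) <= poly_integral (b *: q).
    apply: upper_integral_le => [|x]; last by rewrite hornerE ler_wpM2l// ltW.
    rewrite -[b *: v]addr0; apply: poly_bounded_lin => //.
    by exists 0 => x; rewrite hornerE normr0.
  move=> /le_trans; apply; rewrite poly_integralZ.
  have := ltW qe; rewrite -(ler_pM2l b0) mulrDr mulrC.
  by rewrite [b * (e / b)]mulrC divfK ?gt_eqF// mulrC.
apply/eqP; rewrite eq_le half//=.
have bau : poly_bounded (a *: u).
  rewrite -[a *: u]addr0; apply: poly_bounded_lin => //.
  by exists 0 => x; rewrite hornerE normr0.
have aV : 0 < a^-1 by rewrite invr_gt0.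
have := half _ _ aV bau; rewrite scalerA mulVf ?gt_eqF// scale1r.
by rewrite -(ler_pM2l a0) mulrA divff ?gt_eqF// mul1r.
Qed.

(** M. Riesz's positive extension is the Hahn-Banach theorem for the upper
    integral. Positivity is automatic, as a nonpositive function has the
    polynomial majorant 0. The value at u0 is the smallest possible one, the
    supremum of the integrals of the polynomial minorants of u0. *)
Lemma positive_extension u0 : poly_bounded u0 -> exists L : (R -> R^o) -> R,
  [/\ forall a u v, poly_bounded u -> poly_bounded v -> L (a *: u + v) = a * L u + L v,
      forall u v, poly_bounded u -> poly_bounded v -> (forall x, u x <= v x) -> L u <= L v,
      forall q, L (horner q) = poly_integral q
    & L u0 = - upper_integral (- u0)].
Proof.
move=> bu0.
have [L [Llin Lle L0]] :=
  hahn_banach poly_bounded_lin upper_integral_add upper_integral_hom bu0.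
exists L; split => //.
- move=> u v bu bv uv.
  have := Llin (-1) _ _ bv bu; have bvu := poly_bounded_lin (-1) bv bu.
  have := Lle _ bvu; have : upper_integral (-1 *: v + u) <= poly_integral 0.
    apply: upper_integral_le => // x; rewrite hornerE.
    by change (-1 * v x + u x <= 0); have := uv x; lra.
  by rewrite poly_integral0; lra.
- have le q : L (horner q) <= poly_integral q.
    have bq := poly_bounded_poly q.
    by rewrite (le_trans (Lle _ bq))// upper_integral_le.
  move=> q; apply/eqP; rewrite eq_le le/=.
  have := le (- q); rewrite poly_integralN.
  have := Llin (-1) _ _ (poly_bounded_poly q) (poly_bounded_poly (- q)).
  have -> : -1 *: horner q + horner (- q) = -2 *: horner q + horner 0.
    apply/funext => x.
    change (-1 * q.[x] + (- q).[x] = -2 * q.[x] + (0 : {poly R}).[x]).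
    by rewrite !hornerE; ring.
  rewrite Llin; try exact: poly_bounded_poly.
  have := Llin (-1) _ _ (poly_bounded_poly 0) (poly_bounded_poly 0).
  have -> : -1 *: horner 0 + horner 0 = horner 0 :> (R -> R^o).
    apply/funext => x.
    change (-1 * (0 : {poly R}).[x] + (0 : {poly R}).[x] = (0 : {poly R}).[x]).
    by rewrite !hornerE; ring.
  by lra.
Qed.

End moment_functional.

(** * Step functions and uniform continuity *)

Section step_functions.
Context {R : realType}.
Implicit Types u v phi : R -> R^o.

(** The value of a positive functional at this indicator is its distribution
    function at x. *)
Definition below (x : R) : R -> R^o := fun z => (z <= x)%R%:R.

Lemma below_ge0 x z : 0 <= below x z.
Proof. by rewrite /below ler0n. Qed.

Lemma below_le1 x z : below x z <= 1.
Proof. by rewrite /below lern1 leq_b1. Qed.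

Lemma below_le x y z : x <= y -> below x z <= below y z.
Proof. by move=> xy; rewrite /below ler_nat; case: leP => // /le_trans ->. Qed.

Section positive_functional.
Variables (C : set (R -> R^o)) (L : (R -> R^o) -> R).
Hypothesis C_lin : forall a u v, C u -> C v -> C (a *: u + v).
Hypothesis L_lin : forall a u v, C u -> C v -> L (a *: u + v) = a * L u + L v.
Hypothesis L_mono : forall u v, C u -> C v -> (forall x, u x <= v x) -> L u <= L v.
Hypothesis C1 : C (cst 1).
Hypothesis L1 : L (cst 1) = 1.
Hypothesis C_below : forall x, C (below x).

Let C0 : C 0.
Proof. by have := C_lin (-1) C1 C1; rewrite scaleN1r addNr. Qed.

Let L0 : L 0 = 0.
Proof.
by have := L_lin (-1) C1 C1; rewrite scaleN1r addNr mulN1r addNr.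
Qed.

(** The indicators of the cells form a partition of unity on their union, and
    outside it both phi and the step function vanish; so phi differs from the
    step function by at most d everywhere. *)
Lemma positive_functional_step phi (y c : nat -> R) n d :
  C phi -> 0 <= d -> (forall i, y i <= y i.+1) ->
  (forall z, z <= y 0 \/ y n < z -> phi z = 0) ->
  (forall i z, (i < n)%N -> y i < z <= y i.+1 -> `|phi z - c i| <= d) ->
  `|L phi - \sum_(i < n) c i * (L (below (y i.+1)) - L (below (y i)))| <= d.
Proof.
move=> Cphi d0 ymono phi0 phic.
pose psi m : R -> R^o := \sum_(i < m) c i *: (-1 *: below (y i) + below (y i.+1)).
have Cc m : C (-1 *: below (y m) + below (y m.+1)) by exact: C_lin.
have Cpsi m : C (psi m).
  elim: m => [|m IH]; first by rewrite /psi big_ord0.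
  by rewrite /psi big_ord_recr/= addrC; exact: C_lin.
have Lpsi m : L (psi m) = \sum_(i < m) c i * (L (below (y i.+1)) - L (below (y i))).
  elim: m => [|m IH]; first by rewrite /psi !big_ord0.
  rewrite /psi !big_ord_recr/= addrC L_lin//; last exact: Cpsi.
  by rewrite -/(psi m) IH L_lin//; ring.
have psiE m z : psi m z = \sum_(i < m) c i * (below (y i.+1) z - below (y i) z).
  rewrite /psi fct_sumE; apply: eq_bigr => i _.
  change (c i * (-1 * below (y i) z + below (y i.+1) z) =
          c i * (below (y i.+1) z - below (y i) z)).
  by ring.
have close z : `|phi z - psi n z| <= d.
  rewrite psiE.
  have -> : phi z = \sum_(i < n) phi z * (below (y i.+1) z - below (y i) z).
    rewrite -mulr_sumr.
    rewrite -(big_mkord xpredT (fun i => below (y i.+1) z - below (y i) z)).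
    rewrite telescope_sumr// /below; have [zn|nz] := leP z (y n); last first.
      by rewrite (phi0 z) ?mul0r//; right.
    have [z0|_] := leP z (y 0); last by rewrite subr0 mulr1.
    by rewrite (phi0 z) ?mul0r//; left.
  rewrite -sumrB (le_trans (ler_norm_sum _ _ _))//.
  apply: (@le_trans _ _ (\sum_(i < n) d * (below (y i.+1) z - below (y i) z))).
    apply: ler_sum => i _; rewrite -mulrBl normrM.
    have b0 := below_le z (ymono i).
    rewrite (@ger0_norm _ (below (y i.+1) z - _)) ?subr_ge0//.
    have [zi|iz] := leP z (y i).
      have -> : below (y i.+1) z - below (y i) z = 0.
        by rewrite /below zi (le_trans zi)// subrr.
      by rewrite !mulr0.
    have [zi|] := leP z (y i.+1).
      by rewrite ler_wpM2r ?subr_ge0//; apply: phic => //; rewrite iz zi.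
    move=> iz'; have -> : below (y i.+1) z - below (y i) z = 0.
      by rewrite /below !leNgt iz iz' subrr.
    by rewrite !mulr0.
  rewrite -mulr_sumr -(big_mkord xpredT (fun i => below (y i.+1) z - below (y i) z)).
  rewrite telescope_sumr// ler_piMr//.
  by have := below_le1 (y n) z; have := below_ge0 (y 0) z; lra.
rewrite -Lpsi; have Cd : C (d *: cst 1 + 0) by exact: C_lin.
have Ld : L (d *: cst 1 + 0) = d by rewrite L_lin// L1 mulr1 L0 addr0.
have cst1 z : (d *: cst 1 + 0 : R -> R^o) z = d.
  by change (d * 1 + 0 = d); rewrite mulr1 addr0.
have P1 : L (-1 *: psi n + phi) <= d.
  rewrite -Ld; apply: L_mono => //; first exact: C_lin.
  move=> z; rewrite cst1; change (-1 * psi n z + phi z <= d).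
  by have := close z; rewrite ler_norml; lra.
have P2 : L (-1 *: phi + psi n) <= d.
  rewrite -Ld; apply: L_mono => //; first exact: C_lin.
  move=> z; rewrite cst1; change (-1 * phi z + psi n z <= d).
  by have := close z; rewrite ler_norml; lra.
by move: P1 P2; rewrite !L_lin// ler_norml; lra.
Qed.

End positive_functional.

(** Near a point of the segment from - M to M, half of a continuity radius
    serves all neighbours; compactness picks a common radius. *)
Lemma compact_support_unif_continuous phi (M e : R) : 0 < e -> continuous phi ->
  (forall z, M <= `|z| -> phi z = 0) ->
  exists2 d, 0 < d & forall x y, `|x - y| < d -> `|phi x - phi y| <= e.
Proof.
move=> e0 cphi phi0.
have /compact_near_coveringP/(_ R (0^'+)
  (fun d x => forall y, `|x - y| < d -> `|phi x - phi y| <= e)) :=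
  @segment_compact R (- M) M.
case=> [x _|d /= d0 dP].
  have e20 : 0 < e / 2 by rewrite divr_gt0.
  have /cvgrPdist_lt/(_ _ e20)[r /= r0 rP] := cphi x.
  exists (ball x (r / 2), [set d | 0 < d < r / 2]) => /=.
    split; first by apply: nbhsx_ballx; rewrite divr_gt0.
    near=> d; apply/andP; split => //.
    by near: d; apply: nbhs_right_lt; rewrite divr_gt0.
  move=> [x' d] /= [xx' /andP[d0 dr]] y x'y.
  have := rP x'; have := rP y; rewrite /ball/= in xx' *.
  have -> : `|x - y| < r.
    rewrite (_ : x - y = (x - x') + (x' - y)); last by rewrite addrA subrK.
    by rewrite (le_lt_trans (ler_normD _ _))//; lra.
  move=> /(_ isT) h1 /(_ _); rewrite (lt_trans xx') ?ltr_pdivrMr ?ltr_pMr ?ltr1n//.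
  move=> /(_ isT) h2.
  rewrite (_ : phi x' - phi y = (phi x - phi y) - (phi x - phi x')).
    by rewrite (le_trans (ler_normB _ _))//; lra.
  by rewrite opprB [RHS]addrC addrA subrK.
have d2 : 0 < d / 2 by rewrite divr_gt0.
exists (d / 2) => // x y xy.
have hd : `[- M, M] `<=` (fun x => forall y, `|x - y| < d / 2 -> `|phi x - phi y| <= e).
  apply: dP => //=; rewrite sub0r normrN gtr0_norm//.
  by rewrite ltr_pdivrMr// ltr_pMr// ltr1n.
have [xM|Mx] := leP `|x| M.
  by apply: hd => //=; rewrite in_itv/= -ler_norml.
have [yM|My] := leP `|y| M.
  by rewrite distrC; apply: hd; rewrite /= ?in_itv/= -?ler_norml// distrC.
by rewrite !phi0 ?subrr ?normr0 ?ltW.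
Unshelve. all: by end_near. Qed.

End step_functions.

(** * Positive functionals are integrals *)

Lemma probability_of_distribution_function (R : realType) (G : R -> R) :
  {homo G : x y / x <= y} -> (forall x, G y @[y --> x^'+] --> G x) ->
  G x @[x --> -oo] --> (0 : R) -> G x @[x --> +oo] --> (1 : R) ->
  exists nu : probability (measurableTypeR R) R,
    forall x, nu `]-oo, x]%classic = (G x)%:E.
Proof.
move=> Gnd Grc GN Gp.
pose Gc : cumulativeBounded (0:R) (1:R) := HB.pack G
  (isCumulative.Build R _ R G Gnd Grc) (isCumulativeBounded.Build R 0 1 G GN Gp).
exists (lebesgue_stieltjes_measure Gc) => x.
exact: (cdf_lebesgue_stieltjes_id Gc x).
Qed.

Section representing_measure.
Context {R : realType} (L : (R -> R^o) -> R).
Hypothesis L_lin : forall a u v, poly_bounded u -> poly_bounded v ->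
  L (a *: u + v) = a * L u + L v.
Hypothesis L_mono : forall u v, poly_bounded u -> poly_bounded v ->
  (forall x, u x <= v x) -> L u <= L v.
Hypothesis L1 : L (cst 1) = 1.
Implicit Types u v phi : R -> R^o.

Let pb1 : @poly_bounded R (cst 1).
Proof. by exists 1 => x; rewrite hornerE normr1. Qed.

Let pb0 : @poly_bounded R 0.
Proof. by exists 0 => x; rewrite hornerE normr0. Qed.

Let L0 : L 0 = 0.
Proof. by have := L_lin (-1) pb1 pb1; rewrite scaleN1r addNr mulN1r addNr. Qed.

Let pb_below (x : R) : poly_bounded (below x).
Proof.
exists 1 => z; rewrite hornerE ger0_norm ?below_ge0//.
exact: below_le1.
Qed.

Let F x := L (below x).

Let F_mono x y : x <= y -> F x <= F y.
Proof. by move=> xy; apply: L_mono => // z; exact: below_le. Qed.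

Let F_ge0 x : 0 <= F x.
Proof. by rewrite -L0; apply: L_mono => // z; exact: below_ge0. Qed.

Let F_le1 x : F x <= 1.
Proof. by rewrite -L1; apply: L_mono => // z; exact: below_le1. Qed.

Let m2 := L (horner 'X^2).

Let LZ a u : poly_bounded u -> L (a *: u) = a * L u.
Proof. by move=> bu; have := L_lin a bu pb0; rewrite !addr0 L0 addr0. Qed.

(** Chebyshev's inequality makes the functional tight, so that no mass is lost
    at infinity. *)
Let F_left x : x < 0 -> F x <= m2 / x ^+ 2.
Proof.
move=> x0; rewrite mulrC -LZ; last exact: poly_bounded_poly.
apply: L_mono => //; first by rewrite -[_ *: _]addr0; apply: poly_bounded_lin => //;
  exact: poly_bounded_poly.
move=> z; change (below x z <= (x ^+ 2)^-1 * ('X^2).[z]); rewrite hornerXn.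
rewrite /below; case: (leP z x) => zx /=; rewrite ?mulr1n ?mulr0n; last first.
  by rewrite mulr_ge0// ?invr_ge0 sqr_ge0.
rewrite mulrC ler_pdivlMr ?mul1r; last by rewrite exprn_even_gt0//= lt_eqF.
nra.
Qed.

Let F_right x : 0 < x -> 1 - F x <= m2 / x ^+ 2.
Proof.
move=> x0; rewrite mulrC -LZ; last exact: poly_bounded_poly.
rewrite (_ : 1 - F x = L (-1 *: below x + cst 1)); last first.
  by rewrite L_lin// L1 mulN1r addrC.
apply: L_mono.
- exact: poly_bounded_lin.
- by rewrite -[_ *: _]addr0; apply: poly_bounded_lin => //; exact: poly_bounded_poly.
- move=> z; change (-1 * below x z + 1 <= (x ^+ 2)^-1 * ('X^2).[z]); rewrite hornerXn.
  rewrite /below; case: (leP z x) => zx /=; rewrite ?mulr1n ?mulr0n.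
    by rewrite mulr1 addNr mulr_ge0// ?invr_ge0 sqr_ge0.
  rewrite mulr0 add0r mulrC ler_pdivlMr ?mul1r; last by rewrite exprn_even_gt0//= gt_eqF.
  nra.
Qed.

(** As the functional need not be sigma-additive, F may fail to be
    right-continuous; G is its right-continuous version. *)
Let G x := inf [set F y | y in `]x, +oo[%classic].

Let G_inf x : has_inf [set F y | y in `]x, +oo[%classic].
Proof.
split; first by exists (F (x + 1)), (x + 1) => //=; rewrite in_itv/= andbT ltrDl.
by exists 0 => _ [y _ <-].
Qed.

Let G_le x y : x < y -> G x <= F y.
Proof.
move=> xy; have [_ lb] := G_inf x; apply: ge_inf => //.
by exists y => //=; rewrite in_itv/= andbT.
Qed.

Let G_ge x a : (forall y, x < y -> a <= F y) -> a <= G x.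
Proof.
move=> h; have [ne _] := G_inf x; apply: lb_le_inf => // _ [y /= xy <-].
by apply: h; move: xy; rewrite in_itv/= andbT.
Qed.

Let F_leG x : F x <= G x.
Proof. by apply: G_ge => y /ltW; exact: F_mono. Qed.

Let G_adherent x e : 0 < e -> exists2 y, x < y & F y < G x + e.
Proof.
move=> e0; have [_ [y /= xy <-] ye] := inf_adherent e0 (G_inf x).
by exists y => //; move: xy; rewrite in_itv/= andbT.
Qed.

Let G_mono : {homo G : x y / x <= y}.
Proof. by move=> x y xy; apply: G_ge => z yz; apply: G_le; exact: le_lt_trans yz. Qed.

Let F_shift x : F (x + t) @[t --> 0^'+] --> G x.
Proof.
apply/cvgrPdist_lt => e e0; have [y xy ye] := G_adherent x e0.
near=> t; have t0 : 0 < t by [].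
have ty : t < y - x by near: t; apply: nbhs_right_lt; rewrite subr_gt0.
have h1 : G x <= F (x + t) by apply: G_le; lra.
have h2 : F (x + t) <= F y by apply: F_mono; lra.
by rewrite ler0_norm; lra.
Unshelve. all: by end_near. Qed.

Let G_right_continuous x : G y @[y --> x^'+] --> G x.
Proof.
apply/cvgrPdist_lt => e e0; have [y xy ye] := G_adherent x e0.
near=> t; have xt : x < t by [].
have ty : t < y by near: t; apply: nbhs_right_lt.
have h1 : G x <= G t by apply: G_mono; exact: ltW.
have h2 : G t <= F y by exact: G_le.
by rewrite ler0_norm; lra.
Unshelve. all: by end_near. Qed.

Let m2_ge0 : 0 <= m2.
Proof.
rewrite -L0; apply: L_mono => //; first exact: poly_bounded_poly.
by move=> z; rewrite hornerXn; exact: sqr_ge0.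
Qed.

Let tail_small e : 0 < e -> exists2 r : R, 1 < r & m2 / r ^+ 2 < e.
Proof.
move=> e0; exists (2 + m2 / e).
  by have := divr_ge0 m2_ge0 (ltW e0); lra.
have q0 := divr_ge0 m2_ge0 (ltW e0).
rewrite ltr_pdivrMr; last by rewrite exprn_gt0//; lra.
rewrite -ltr_pdivrMl// mulrC; nra.
Qed.

Let G_Ny : G x @[x --> -oo] --> (0 : R).
Proof.
apply/cvgrPdist_lt => e e0; have [r r1 re] := tail_small e0.
near=> x; have xr : x < - r by near: x; apply: nbhs_ninfty_lt; rewrite num_real.
have h1 : G x <= F (- r) by exact: G_le.
have h2 : F (- r) <= m2 / (- r) ^+ 2 by apply: F_left; lra.
have h3 : 0 <= G x by exact: le_trans (F_ge0 _) (F_leG _).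
by rewrite sqrrN in h2; rewrite sub0r normrN ger0_norm//; lra.
Unshelve. all: by end_near. Qed.

Let G_y : G x @[x --> +oo] --> (1 : R).
Proof.
apply/cvgrPdist_lt => e e0; have [r r1 re] := tail_small e0.
near=> x; have xr : r < x by near: x; apply: nbhs_pinfty_gt; rewrite num_real.
have h1 : F x <= G x by exact: F_leG.
have h2 : 1 - F r <= m2 / r ^+ 2 by apply: F_right; lra.
have h3 : G x <= 1 by apply: le_trans (F_le1 (x + 1)); apply: G_le; rewrite ltrDl.
have h4 : F r <= F x by apply: F_mono; exact: ltW.
by rewrite ger0_norm; lra.
Unshelve. all: by end_near. Qed.

Lemma distribution_function_of_functional : exists nu : probability (measurableTypeR R) R,
  forall x, nu `]-oo, x]%classic = (G x)%:E.
Proof. exact: probability_of_distribution_function. Qed.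

Section integral.
Variable nu : probability (measurableTypeR R) R.
Hypothesis nuG : forall x, nu `]-oo, x]%classic = (G x)%:E.

Let C : set (R -> R^o) := [set u | nu.-integrable setT (EFin \o (u : measurableTypeR R -> R))].

Let I u : R := Rintegral nu setT (u : measurableTypeR R -> R).

Let C_lin a u v : C u -> C v -> C (a *: u + v).
Proof.
move=> Cu Cv; rewrite /C/=.
have : nu.-integrable setT ((fun x => a%:E * (u x)%:E) \+ (EFin \o v))%E.
  by apply: integrableD => //; apply: integrableZl.
exact.
Qed.

Let I_lin a u v : C u -> C v -> I (a *: u + v) = a * I u + I v.
Proof.
move=> Cu Cv; rewrite /I -RintegralZl// -RintegralD//.
by apply: (integrableZl measurableT a Cu).
Qed.

Let I_mono u v : C u -> C v -> (forall x, u x <= v x) -> I u <= I v.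
Proof. by move=> Cu Cv uv; apply: (le_Rintegral measurableT Cu Cv). Qed.

Let C1 : C (cst 1).
Proof. by apply: finite_measure_integrable_cst. Qed.

Let I1 : I (cst 1) = 1.
Proof.
by rewrite /I Rintegral_cst// mul1r -[RHS]/(fine 1%E); congr fine; exact: probability_setT.
Qed.

Let belowE x : below x = \1_(`]-oo, x]%classic : set R).
Proof.
by apply/funext => z; rewrite indicE /below mem_setE in_itv/=.
Qed.

Let C_below x : C (below x).
Proof.
rewrite /C/= belowE; apply: integrable_indic => //.
Qed.

Let I_below x : I (below x) = G x.
Proof.
transitivity (fine (nu `]-oo, x]%classic)); last by rewrite nuG.
by rewrite /I /Rintegral belowE; congr fine; rewrite integral_indic// setIT.
Qed.

(** Functional and integral are close to the same Riemann-Stieltjes sum. For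
    the functional the partition is shifted by t > 0, and F at the shifted
    points tends to G as t goes to 0, which spares a choice of partition points
    at which F is continuous. *)
Lemma representation_compact_support phi (M : R) : continuous phi ->
  (forall z, M <= `|z| -> phi z = 0) -> poly_bounded phi -> C phi -> L phi = I phi.
Proof.
move=> cphi phi0 pphi Cphi.
suff close e : 0 < e -> `|L phi - I phi| <= e + e.
  apply/eqP; rewrite -subr_eq0 -normr_le0; apply/ler_addgt0Pr => e e0.
  by rewrite add0r [leRHS]splitr; apply: close; rewrite divr_gt0.
move=> e0; have [d d0 dphi] := compact_support_unif_continuous e0 cphi phi0.
pose h := d / 2; have h0 : 0 < h by rewrite divr_gt0.
pose K := `|M| + 1.
pose n := Num.bound ((K + K + 1) / h).
have nK : K + K + 1 < n%:R * h.
  rewrite -ltr_pdivrMr// archi_boundP// divr_ge0 ?(ltW h0)// /K.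
  by have := normr_ge0 M; lra.
pose y t i : R := - K + i%:R * h + t.
have ymono t i : y t i <= y t i.+1.
  by rewrite /y -natr1 mulrDl mul1r; lra.
have yn t i : y t i.+1 = y t i + h by rewrite /y -natr1 mulrDl mul1r; lra.
have MM := ler_norm M.
have out t z : 0 <= t <= 1 -> z <= y t 0 \/ y t n < z -> phi z = 0.
  rewrite /y mul0r addr0 => t01 [zK|Kz]; apply: phi0.
    by rewrite ler_normr; apply/orP; right; rewrite /K in zK; lra.
  by rewrite ler_normr; apply/orP; left; rewrite /K in nK Kz; lra.
have cell t i z : 0 <= t < h -> y t i < z <= y t i.+1 -> `|phi z - phi (y 0 i)| <= e.
  move=> t01 zy; apply: dphi.
  have -> : y 0 i = y t i - t by rewrite /y; lra.
  by move: zy; rewrite yn ltr_norml /h in t01 *; lra.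
pose S (H : R -> R) := \sum_(i < n) phi (y 0 i) * (H (y 0 i.+1) - H (y 0 i)).
have LS : `|L phi - S G| <= e.
  have LSt : \forall t \near 0^'+,
      `|L phi - \sum_(i < n) phi (y 0 i) * (F (y 0 i.+1 + t) - F (y 0 i + t))| <= e.
    near=> t; have t0 : 0 < t by [].
    have t1 : t < 1 by near: t; apply: nbhs_right_lt.
    have th : t < h by near: t; apply: nbhs_right_lt.
    have yt i : y 0 i + t = y t i by rewrite /y addr0.
    under eq_bigr do rewrite !yt.
    have := @positive_functional_step _ _ _ (@poly_bounded_lin R) L_lin L_mono pb1 L1
      pb_below phi (y t) (fun i => phi (y 0 i)) n e pphi (ltW e0) (ymono t).
    apply; first by move=> z; apply: out; lra.
    by move=> i z _; apply: cell; lra.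
  apply: (@closed_cvg _ R^o (0^'+) _ _ (fun z => z <= e) _ LSt).
    exact: closed_le.
  apply: cvg_norm; apply: cvgB; first exact: cvg_cst.
  rewrite /S; apply: cvg_big => [|i _]; first exact: add_continuous.
  by apply: cvgMr; apply: cvgB; exact: F_shift.
have IS : `|I phi - S G| <= e.
  have := @positive_functional_step _ _ _ C_lin I_lin I_mono C1 I1
    C_below phi (y 0) (fun i => phi (y 0 i)) n e Cphi (ltW e0) (ymono 0).
  under eq_bigr do rewrite !I_below.
  apply; first by move=> z; apply: out; lra.
  by move=> i z _; apply: cell; lra.
rewrite (_ : L phi - I phi = (L phi - S G) - (I phi - S G)); last by ring.
by rewrite (le_trans (ler_normB _ _))// lerD.
Unshelve. all: by end_near. Qed.

(** The clamp of s to the unit interval. *)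
Let ramp (s : R) : R := (1 + `|s| - `|s - 1|) / 2.

Let ramp0 s : s <= 0 -> ramp s = 0.
Proof. by move=> s0; rewrite /ramp !ler0_norm; lra. Qed.

Let ramp1 s : 1 <= s -> ramp s = 1.
Proof. by move=> s1; rewrite /ramp !ger0_norm; lra. Qed.

Let ramp_mono s t : s <= t -> ramp s <= ramp t.
Proof.
move=> st; rewrite /ramp.
case: (ger0P s); case: (ger0P (s - 1)); case: (ger0P t); case: (ger0P (t - 1));
  by move=> *; lra.
Qed.

Let ramp_ge0 s : 0 <= ramp s.
Proof.
by have [/ramp0 ->//|/ltW s0] := leP s 0; rewrite -(ramp0 (lexx 0)); exact: ramp_mono.
Qed.

Let ramp_le1 s : ramp s <= 1.
Proof.
by have [/ramp1 ->//|/ltW s1] := leP 1 s; rewrite -(ramp1 (lexx 1)); exact: ramp_mono.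
Qed.

Let cutoff phi n : R -> R^o := fun z => phi z * ramp (n%:R + 2 - `|z|).

Let cutoff_continuous phi n : continuous phi -> continuous (cutoff phi n).
Proof.
move=> cphi z; apply: (@cvgM R R); first exact: cphi.
have cs : (n%:R + 2 - `|x| : R) @[x --> z] --> (n%:R + 2 - `|z| : R).
  by apply: cvgB; [exact: cvg_cst|exact: (@norm_continuous R R^o)].
apply: cvgMl; apply: cvgB.
  by apply: cvgD; [exact: cvg_cst|exact: cvg_norm].
by apply: cvg_norm; apply: cvgB => //; exact: cvg_cst.
Qed.

Let cutoff_support phi n z : n%:R + 2 <= `|z| -> cutoff phi n z = 0.
Proof. by move=> nz; rewrite /cutoff ramp0 ?mulr0//; lra. Qed.

Let cutoff_le phi n z : `|cutoff phi n z| <= `|phi z|.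
Proof.
by rewrite /cutoff normrM ler_piMr// ger0_norm ?ramp_ge0// ramp_le1.
Qed.

Let cutoff_id phi n z : `|z| <= n%:R + 1 -> cutoff phi n z = phi z.
Proof. by move=> nz; rewrite /cutoff ramp1 ?mulr1//; lra. Qed.

Let cutoff_C phi n : continuous phi -> C (cutoff phi n).
Proof.
move=> cphi; have cc := @cutoff_continuous phi n cphi.
pose b : R := n%:R + 2; have b0 : 0 <= b by rewrite addr_ge0.
have cN : {within `[- b, b], continuous (fun z => `|cutoff phi n z| : R)}.
  by apply: continuous_subspaceT => z; apply: cvg_norm; exact: cc.
have [|c _ cmax] := EVT_max _ cN; first lra.
apply: (@le_integrable _ _ _ nu setT measurableT _ (cst (`|cutoff phi n c|)%:E)).
- by apply/measurable_EFinP; exact: continuous_measurable_fun.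
- move=> z _ /=; rewrite lee_fin normr_id.
  have [zb|bz] := leP `|z| b; first by apply: cmax; rewrite in_itv/= -ler_norml.
  by rewrite cutoff_support ?normr0// ltW.
- exact: finite_measure_integrable_cst.
Qed.

(** Where the cutoff is below 1 one has z^2 >= n + 1, so the truncation error is
    at most q z^2 / (n + 1). *)
Let cutoff_error phi q n : (forall z, `|phi z| <= q.[z]) -> poly_bounded phi ->
  (forall z, 0 <= phi z) ->
  0 <= L phi - L (cutoff phi n) <= n.+1%:R^-1 * L (horner (q * 'X^2)).
Proof.
move=> phiq pphi phi0.
have pc : poly_bounded (cutoff phi n) by apply: poly_bounded_le pphi _ => z.
have -> : L phi - L (cutoff phi n) = L (-1 *: cutoff phi n + phi).
  by rewrite L_lin// mulN1r addrC.
have pd : poly_bounded (-1 *: cutoff phi n + phi) by exact: poly_bounded_lin.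
have dE z : (-1 *: cutoff phi n + phi) z = phi z * (1 - ramp (n%:R + 2 - `|z|)).
  change (-1 * cutoff phi n z + phi z = phi z * (1 - ramp (n%:R + 2 - `|z|))).
  by rewrite /cutoff; ring.
apply/andP; split.
  by rewrite -L0; apply: L_mono => // z; rewrite dE mulr_ge0// subr_ge0.
rewrite -LZ; last exact: poly_bounded_poly.
apply: L_mono => //.
  by rewrite -[_ *: _]addr0; apply: poly_bounded_lin => //; exact: poly_bounded_poly.
move=> z; rewrite dE; change (phi z * (1 - ramp (n%:R + 2 - `|z|)) <=
  n.+1%:R^-1 * (q * 'X^2).[z]).
rewrite hornerM hornerXn.
have q0 : 0 <= q.[z] by exact: le_trans (phiq z).
have [zn|nz] := leP `|z| (n%:R + 1).
  rewrite ramp1 ?subrr ?mulr0; last by lra.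
  by rewrite mulr_ge0// mulr_ge0// sqr_ge0.
rewrite mulrCA; apply: ler_pM => //; first by rewrite subr_ge0.
  by rewrite (le_trans _ (phiq z))// ler_norm.
apply: (@le_trans _ _ 1); first by have := ramp_ge0 (n%:R + 2 - `|z|); lra.
rewrite mulrC ler_pdivlMr// mul1r -natr1 -real_normK ?num_real//.
by rewrite (le_trans (ltW nz))// expr2 ler_peMr//; have := ler0n R n; lra.
Qed.

Let cutoff_cvg phi : poly_bounded phi -> (forall z, 0 <= phi z) ->
  L (cutoff phi n) @[n --> \oo] --> L phi.
Proof.
move=> pphi phi0; have [q phiq] := pphi.
have : (L phi - n.+1%:R^-1 * L (horner (q * 'X^2))) @[n --> \oo] --> L phi.
  rewrite -[X in _ --> X]subr0; apply: cvgB; first exact: cvg_cst.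
  rewrite -[X in _ --> X](mul0r (L (horner (q * 'X^2)))).
  by apply: cvgMl; exact: cvg_harmonic.
move=> lo; apply: (squeeze_cvgr _ lo (cvg_cst (L phi))).
near=> n; have /andP[h1 h2] := @cutoff_error phi q n phiq pphi phi0.
rewrite lerBlDl -lerBlDr h2/= -subr_ge0; exact: h1.
Unshelve. all: by end_near. Qed.

Let representation_ge0 phi : continuous phi -> poly_bounded phi ->
  (forall z, 0 <= phi z) -> C phi /\ L phi = I phi.
Proof.
move=> cphi pphi phi0.
suff intE : (\int[nu]_(z in setT) (phi z)%:E = (L phi)%:E)%E.
  split; last by rewrite /I /Rintegral intE.
  apply/integrableP; split.
    by apply/measurable_EFinP; exact: continuous_measurable_fun.
  under eq_integral do rewrite gee0_abs ?lee_fin//=.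
  by rewrite intE ltry.
have c0 n z : 0 <= cutoff phi n z by rewrite /cutoff mulr_ge0.
have cI n : (\int[nu]_(z in setT) (cutoff phi n z)%:E = (L (cutoff phi n))%:E)%E.
  have CC := @cutoff_C phi n cphi.
  rewrite (@representation_compact_support _ (n%:R + 2) (@cutoff_continuous phi n cphi))//.
  - rewrite /I /Rintegral fineK//; exact: integrable_fin_num CC.
  - by move=> z; exact: cutoff_support.
  - by apply: poly_bounded_le pphi _ => z; exact: cutoff_le.
have limE : (fun z => limn (fun n => (cutoff phi n z)%:E)) = EFin \o phi.
  apply/funext => z /=; apply: lim_near_cst => //.
  near=> n; congr EFin; apply: cutoff_id.
  have : `|z| <= n%:R by near: n; exact: nbhs_infty_ger.
  by lra.
have cL : (\int[nu]_(z in setT) (cutoff phi n z)%:E)%E @[n --> \oo] --> (L phi)%:E.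
  under eq_fun do rewrite cI.
  by apply: cvg_EFin; [near=> n|exact: cutoff_cvg].
apply/esym; apply: (cvg_unique _ cL) => //.
have := @cvg_monotone_convergence _ _ _ nu setT measurableT
  (fun n z => (cutoff phi n z)%:E).
rewrite limE; apply => [n|n z _|z _ n m nm].
- apply/measurable_EFinP; apply: continuous_measurable_fun.
  exact: cutoff_continuous.
- by rewrite lee_fin.
- rewrite lee_fin /cutoff ler_wpM2l//; apply: ramp_mono.
  by rewrite !lerD// ler_nat.
Unshelve. all: by end_near. Qed.

(** Cutoffs and monotone convergence settle nonnegative functions; in general
    phi is the difference of phi + |phi| and |phi|. *)
Lemma representation_continuous phi : continuous phi -> poly_bounded phi ->
  C phi /\ L phi = I phi.
Proof.
move=> cphi pphi; pose a : R -> R^o := fun z => `|phi z|.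
have ca : continuous a by move=> z; apply: cvg_norm; exact: cphi.
have pa : poly_bounded a by apply: poly_bounded_le pphi _ => z; rewrite /a normr_id.
have [Ca La] := representation_ge0 ca pa (fun z => normr_ge0 _).
pose s : R -> R^o := fun z => phi z + a z.
have ps : poly_bounded s.
  suff -> : s = 1 *: phi + a by exact: poly_bounded_lin.
  by apply/funext => z; change (phi z + a z = 1 * phi z + a z); rewrite mul1r.
have [||Cs Ls] := representation_ge0 _ ps.
- by move=> z; apply: cvgD; [exact: cphi|exact: ca].
- by move=> z; rewrite /s /a; have := ler_norm (- phi z); rewrite normrN; lra.
have phiE : phi = -1 *: a + s.
  apply/funext => z; change (phi z = -1 * a z + (phi z + a z)); by ring.
have Cphi : C phi by rewrite phiE; exact: C_lin.
by split => //; rewrite phiE L_lin// I_lin// La Ls.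
Qed.

End integral.

Lemma representing_measure : exists nu : probability (measurableTypeR R) R,
  forall phi, continuous phi -> poly_bounded phi ->
  nu.-integrable setT (EFin \o (phi : measurableTypeR R -> R)) /\
  (\int[nu]_(x in setT) (phi x)%:E = (L phi)%:E)%E.
Proof.
have [nu nuG] := distribution_function_of_functional.
exists nu => phi cphi pphi.
have [Cphi ->] := representation_continuous nuG cphi pphi.
by split => //; rewrite /Rintegral fineK//; exact: integrable_fin_num Cphi.
Qed.

End representing_measure.

(** * Mean-square closure *)

Definition sqnorm d (T : measurableType d) (R : realType) (mu : probability T R)
  (u : T -> R) : \bar R := \int[mu]_(x in setT) (u x ^+ 2)%:E.
Arguments sqnorm {d T R} mu u.

Section l2_closure.
Context d {T : measurableType d} {R : realType} (mu : probability T R).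
Implicit Types (u v h : T -> R) (H : set (T -> R)).

(** Functions are used instead of classes modulo null sets, so the closure is
    defined by approximation rather than as a topological closure. *)
Definition l2_closure H : set (T -> R) := [set u : T -> R | measurable_fun setT u /\
  forall e : R, 0 < e -> exists2 h, H h & (sqnorm mu (fun x => u x - h x)%R < e%:E)%E].

Lemma measurable_sq u : measurable_fun setT u ->
  measurable_fun setT (fun x => (u x ^+ 2)%:E).
Proof. by move=> mfu; apply/measurable_EFinP; exact: measurable_funX. Qed.

Lemma sqnorm_ge0 u : (0 <= sqnorm mu u)%E.
Proof. by apply: integral_ge0 => x _; rewrite lee_fin sqr_ge0. Qed.

Lemma le_sqnorm u v : measurable_fun setT u -> measurable_fun setT v ->
  (forall x, `|u x| <= `|v x|) -> (sqnorm mu u <= sqnorm mu v)%E.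
Proof.
move=> mfu mv uv; apply: ge0_le_integral => //.
- by move=> x _; rewrite lee_fin sqr_ge0.
- exact: measurable_sq.
- exact: measurable_sq.
- move=> x _; rewrite lee_fin -[u x ^+ 2]real_normK ?num_real//.
  by rewrite -[v x ^+ 2]real_normK ?num_real// ler_pXn2r ?nnegrE.
Qed.

Lemma sqnormZ a u : measurable_fun setT u ->
  sqnorm mu (fun x => a * u x)%R = ((a ^+ 2)%:E * sqnorm mu u)%E.
Proof.
move=> mfu; rewrite /sqnorm -ge0_integralZl_EFin ?sqr_ge0//.
- by apply: eq_integral => x _; rewrite exprMn EFinM.
- by move=> x _; rewrite lee_fin sqr_ge0.
- exact: measurable_sq.
Qed.

Lemma sqnormD u v : measurable_fun setT u -> measurable_fun setT v ->
  (sqnorm mu (fun x => u x + v x)%R <= 2%:E * sqnorm mu u + 2%:E * sqnorm mu v)%E.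
Proof.
move=> mfu mv.
have mu2 := measurable_sq mfu; have mv2 := measurable_sq mv.
have p0 w (x : T) : setT x -> (0 <= (w x ^+ 2)%:E :> \bar R)%E.
  by move=> _; rewrite lee_fin sqr_ge0.
rewrite /sqnorm -!ge0_integralZl_EFin//; try exact: p0.
rewrite -ge0_integralD//; first last.
- by apply: emeasurable_funM => //; exact: measurable_cst.
- by move=> x _; rewrite mule_ge0// p0.
- by apply: emeasurable_funM => //; exact: measurable_cst.
- by move=> x _; rewrite mule_ge0// p0.
apply: ge0_le_integral => //.
- by move=> x _; rewrite lee_fin sqr_ge0.
- by apply: measurable_sq; exact: measurable_funD.
- by apply: emeasurable_funD; apply: emeasurable_funM => //; exact: measurable_cst.
- move=> x _; rewrite -!EFinM -EFinD lee_fin.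
  by have := sqr_ge0 (u x - v x); nra.
Qed.

Section linear_subspace.
Variable H : set (T -> R).
Hypothesis H_measurable : forall h, H h -> measurable_fun setT h.

Lemma sub_l2_closure : H `<=` l2_closure H.
Proof.
move=> h Hh; split; first exact: H_measurable.
move=> e e0; exists h => //; rewrite /sqnorm integral0_eq// => x _.
by rewrite subrr expr0n.
Qed.

Lemma l2_closure_approx u : measurable_fun setT u ->
  (forall e : R, 0 < e -> exists2 v, l2_closure H v &
     (sqnorm mu (fun x => u x - v x)%R < e%:E)%E) -> l2_closure H u.
Proof.
move=> mfu uv; split => // e e0; have e4 : 0 < e / 4 by rewrite divr_gt0.
have [v [mv vh] uve] := uv _ e4; have [h Hh vhe] := vh _ e4; exists h => //.
have mh := H_measurable Hh.
have -> : (fun x => u x - h x) = (fun x => (u x - v x) + (v x - h x)).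
  by apply/funext => x; rewrite addrA subrK.
have := sqnormD (measurable_funB mfu mv) (measurable_funB mv mh).
move=> /le_lt_trans; apply.
have -> : e%:E = (2%:E * (e / 4)%:E + 2%:E * (e / 4)%:E)%E.
  by rewrite -EFinM -EFinD; congr EFin; lra.
by apply: lteD; rewrite lte_pmul2l// ltr0n.
Qed.

Hypothesis H_lin : forall a u v, H u -> H v -> H (fun x => a * u x + v x).

Lemma l2_closure_lin a u v : l2_closure H u -> l2_closure H v ->
  l2_closure H (fun x => a * u x + v x).
Proof.
move=> [mfu uh] [mv vk]; split.
  by apply: measurable_funD => //; apply: measurable_funM => //; exact: measurable_cst.
move=> e e0; have e4 : 0 < e / 4 by rewrite divr_gt0.
have a1 : 0 < a ^+ 2 + 1 by rewrite ltr_wpDl ?sqr_ge0.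
have [h Hh he] := uh _ (divr_gt0 e4 a1); have [k Hk ke] := vk _ e4.
have mh := H_measurable Hh; have mk := H_measurable Hk.
exists (fun x => a * h x + k x); first exact: H_lin.
have -> : (fun x => a * u x + v x - (a * h x + k x)) =
          (fun x => a * (u x - h x) + (v x - k x)).
  by apply/funext => x; ring.
have muh := measurable_funB mfu mh.
have mauh : measurable_fun setT (fun x => a * (u x - h x)).
  by apply: measurable_funM => //; exact: measurable_cst.
apply: le_lt_trans (sqnormD mauh (measurable_funB mv mk)) _.
have -> : e%:E = (2%:E * (e / 4)%:E + 2%:E * (e / 4)%:E)%E.
  by rewrite -EFinM -EFinD; congr EFin; lra.
apply: lteD; rewrite lte_pmul2l ?ltr0n// sqnormZ//.
apply: (@le_lt_trans _ _ ((a ^+ 2)%:E * (e / 4 / (a ^+ 2 + 1))%:E)%E).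
  by rewrite lee_wpmul2l ?lee_fin ?sqr_ge0// ltW.
rewrite -EFinM lte_fin mulrA ltr_pdivrMr// mulrC ltr_pM2l//.
by rewrite ltrDl.
Qed.

End linear_subspace.

End l2_closure.

(** * Riesz's theorem on determinate measures *)

Section riesz.
Context {R : realType} (mu : probability (measurableTypeR R) R).
Hypothesis mu_moments : finite_moments mu.
Hypothesis mu_determinate : moment_determinate mu.
Implicit Types (p q u w : {poly R}).

Definition cauchy_kernel (x : R) : R := (1 + x ^+ 2)^-1.

Local Notation s := cauchy_kernel.

Lemma cauchy_denom_gt0 (x : R) : 0 < 1 + x ^+ 2.
Proof. by rewrite ltr_wpDr ?sqr_ge0. Qed.

Lemma cauchy_kernel_gt0 x : 0 < s x.
Proof. by rewrite invr_gt0 cauchy_denom_gt0. Qed.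

Lemma cauchy_kernel_le1 x : s x <= 1.
Proof. by rewrite invf_le1 ?cauchy_denom_gt0// lerDl sqr_ge0. Qed.

Lemma cauchy_kernelE x : (1 + x ^+ 2) * s x = 1.
Proof. by rewrite divff// gt_eqF// cauchy_denom_gt0. Qed.

Lemma continuous_cauchy_kernel : continuous s.
Proof.
move=> x; apply: (@cvgV R R^o); first by rewrite gt_eqF// cauchy_denom_gt0.
have -> : (fun z : R => 1 + z ^+ 2) = horner (1 + 'X^2).
  by apply/funext => z; rewrite !hornerE.
rewrite (_ : 1 + x ^+ 2 = (1 + 'X^2).[x]); last by rewrite !hornerE.
exact: continuous_horner.
Qed.

Lemma measurable_cauchy_kernel :
  measurable_fun [set: measurableTypeR R] (s : measurableTypeR R -> R).
Proof. exact: continuous_measurable_fun continuous_cauchy_kernel. Qed.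

Let pb_kernel : @poly_bounded R s.
Proof.
exists 1 => x; rewrite hornerE ger0_norm ?cauchy_kernel_le1//.
exact/ltW/cauchy_kernel_gt0.
Qed.

(** Determinacy forces every positive extension of the moment functional to be
    the integral on continuous functions of polynomial growth. For the extension
    that is smallest at the kernel this says that the integrals of the
    polynomial minorants come arbitrarily close to that of the kernel. *)
Lemma cauchy_kernel_minorant e : 0 < e -> exists q,
  (forall x, q.[x] <= s x) /\
  (\int[mu]_(x in setT) (s x - q.[x])%:E < e%:E)%E.
Proof.
move=> e0; have [L [Llin Lmono Lpoly Ls]] := positive_extension mu_moments pb_kernel.
have L1 : L (cst 1) = 1.
  rewrite -[RHS](poly_integral1 mu) -Lpoly; congr L; apply/funext => x.
  by rewrite hornerE.
have [nu nuP] := representing_measure Llin Lmono L1.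
have nu_mom k : nu.-integrable setT (fun x => (x ^+ k)%:E) /\
    moment nu k = moment mu k.
  have [i1 i2] := nuP _ (@continuous_horner _ 'X^k) (poly_bounded_poly 'X^k).
  have E : (fun x : R => (('X^k).[x])%:E) = (fun x => (x ^+ k)%:E).
    by apply/funext => x; rewrite hornerXn.
  split; first by rewrite -E.
  rewrite /moment -E i2 Lpoly /poly_integral /Rintegral fineK//.
  by apply: integrable_fin_num => //; exact: integrable_poly.
have nuE := mu_determinate (fun k => (nu_mom k).1) (fun k => (nu_mom k).2).
have [si sL] := nuP _ continuous_cauchy_kernel pb_kernel.
have sE : (\int[mu]_(x in setT) (s x)%:E = (L s)%:E)%E.
  rewrite -sL; apply: eq_measure_integral => A mA _. exact: (esym (nuE A mA)).
have smu : mu.-integrable setT (EFin \o (s : measurableTypeR R -> R)).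
  apply/integrableP; split.
    by apply/measurable_EFinP; exact: measurable_cauchy_kernel.
  under eq_integral do rewrite gee0_abs ?lee_fin ?ltW ?cauchy_kernel_gt0//=.
  by rewrite sE ltry.
have pbN : @poly_bounded R (- (s : R -> R^o)).
  by apply: poly_bounded_le pb_kernel _ => x; rewrite normrN.
have [q qs qe] := upper_integral_approx mu_moments pbN e0.
exists (- q); split.
  by move=> x; have qsx : - s x <= q.[x] := qs x; rewrite hornerN; lra.
have qi := integrable_poly mu_moments (- q).
under eq_integral do rewrite EFinB.
rewrite integralB_EFin// sE.
rewrite -[X in (_ - X)%E]fineK; last by apply: integrable_fin_num.
have := poly_integralN mu_moments q; rewrite /poly_integral /Rintegral => ->.
rewrite -EFinB lte_fin; move: qe; rewrite /poly_integral /Rintegral; lra.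
Qed.

Let W : {poly R} := 'X^2 + 1.
Let sizeW : size W = 3.
Proof. by rewrite /W size_polyDl ?size_polyXn// size_poly1. Qed.
Let W0 : W != 0. Proof. by rewrite -size_poly_gt0 sizeW. Qed.

(** The remainder of u modulo 1 + X^2 is ra u X + rb u; the pair encodes the
    value of u at the imaginary unit. *)
Let ra u := (u %% W)`_1.
Let rb u := (u %% W)`_0.

Let modWE u : u %% W = ra u *: 'X + (rb u)%:P.
Proof.
have sz : (size (u %% W)%R <= 2)%N by have := ltn_modpN0 u W0; rewrite sizeW ltnS.
apply/polyP => i; rewrite !coefE.
case: i => [|[|i]] /=; rewrite ?mulr0 ?mulr1 ?add0r ?addr0//.
by rewrite nth_default// (leq_trans sz).
Qed.

Let divWE u : u = (u %/ W) * W + (ra u *: 'X + (rb u)%:P).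
Proof. by rewrite -modWE -divp_eq. Qed.

Let rb_add u w : rb (u + w) = rb u + rb w.
Proof. by rewrite /rb modpD coefD. Qed.

Let rb_sqr u : rb (u ^+ 2) = rb u ^+ 2 - ra u ^+ 2.
Proof.
set a := ra u; set b := rb u; set z := u %/ W.
have uE : u = z * W + (a *: 'X + b%:P) by exact: divWE.
have -> : u ^+ 2 = (z ^+ 2 * W + 2 *: (z * (a *: 'X + b%:P)) + (a ^+ 2)%:P) * W +
    ((2 * a * b) *: 'X + (b ^+ 2 - a ^+ 2)%:P).
  rewrite {1}uE /W -!mul_polyC !polyCM !polyCB !rmorphXn/=.
  by rewrite (_ : 2%:P = 2 :> {poly R})//; ring.
rewrite /rb modp_addl_mul_small; last first.
  rewrite sizeW (leq_ltn_trans (size_polyD _ _))// gtn_max.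
  rewrite (leq_ltn_trans (size_scale_leq _ _)) ?size_polyX//=.
  by rewrite size_polyC; case: (_ != 0).
by rewrite !coefE/= mulr0 add0r.
Qed.

(** Reducing 1 - (1 + x^2) q, a sum of squares, modulo 1 + x^2 shows that the
    remainders a x + b of the squared polynomials satisfy
    sum (b^2 - a^2) = 1, hence sum (a^2 + b^2) >= 1. As the integrals of the
    u^2 s add up to less than e, one of them is less than e (a^2 + b^2). *)
Lemma minorant_witness e : 0 < e -> exists u, let c := ra u ^+ 2 + rb u ^+ 2 in
  0 < c /\ (\int[mu]_(x in setT) (u.[x] ^+ 2 * s x)%:E < (e * c)%:E)%E.
Proof.
move=> e0; have [q [qs qe]] := cauchy_kernel_minorant e0.
pose D := 1 - W * q.
have DsE x : D.[x] * s x = s x - q.[x].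
  rewrite /D /W !hornerE mulrBl mul1r mulrAC [_ ^+ 2 + 1]addrC.
  by rewrite cauchy_kernelE mul1r.
have D0 x : 0 <= D.[x].
  rewrite -(pmulr_lge0 _ (cauchy_kernel_gt0 x)) DsE subr_ge0; exact: qs.
have [us DE] := nonneg_poly_sum_of_squares D0.
have rbD : rb D = 1.
  rewrite /rb /D (_ : 1 - W * q = (- q) * W + 1); last by ring.
  by rewrite modp_addl_mul_small ?coefE// sizeW size_poly1.
have sum1 : \sum_(u <- us) (rb u ^+ 2 - ra u ^+ 2) = 1.
  rewrite -rbD DE; elim: us {DE} => [|u us IH].
    by rewrite !big_nil /rb mod0p coef0.
  by rewrite !big_cons rb_add rb_sqr IH.
apply: contrapT => /forallNP Nu.
have lower u : ((e * (ra u ^+ 2 + rb u ^+ 2))%:E <=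
    \int[mu]_(x in setT) (u.[x] ^+ 2 * s x)%:E)%E.
  have i0 : (0 <= \int[mu]_(x in setT) (u.[x] ^+ 2 * s x)%:E)%E.
    by apply: integral_ge0 => x _; rewrite lee_fin mulr_ge0 ?sqr_ge0 ?ltW ?cauchy_kernel_gt0.
  have [c0|c0] := ltP 0 (ra u ^+ 2 + rb u ^+ 2); last first.
    by apply: le_trans i0; rewrite lee_fin mulr_ge0_le0// ltW.
  by rewrite leNgt; apply/negP => lt; apply: (Nu u).
have : (e%:E <= \int[mu]_(x in setT) (D.[x] * s x)%:E)%E.
  have -> : (\int[mu]_(x in setT) (D.[x] * s x)%:E =
      \sum_(u <- us) \int[mu]_(x in setT) (u.[x] ^+ 2 * s x)%:E)%E.
    rewrite -ge0_integral_sum//.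
    - apply: eq_integral => x _; rewrite DE horner_sum mulr_suml -sumEFin.
      by apply: eq_bigr => u _; rewrite hornerE.
    - move=> u; apply/measurable_EFinP; apply: measurable_funM.
        by apply: measurable_funX; exact: measurable_poly.
      exact: measurable_cauchy_kernel.
    - by move=> u x _; rewrite lee_fin mulr_ge0 ?sqr_ge0 ?ltW ?cauchy_kernel_gt0.
  apply: (@le_trans _ _ (\sum_(u <- us) (e * (ra u ^+ 2 + rb u ^+ 2))%:E)%E); last first.
    by apply: lee_sum => u _; exact: lower.
  rewrite sumEFin lee_fin -mulr_sumr ler_peMr ?(ltW e0)// -sum1.
  by apply: ler_sum => u _; have := sqr_ge0 (ra u); lra.
rewrite leNgt => /negP; apply; under eq_integral do rewrite DsE.
exact: qe.
Qed.

Definition poly_functions : set (measurableTypeR R -> R) := [set horner p | p in setT].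

Let polyH_measurable h : poly_functions h -> measurable_fun setT h.
Proof. by move=> [p _ <-]; exact: measurable_poly. Qed.

Let polyH_lin a h k : poly_functions h -> poly_functions k ->
  poly_functions (fun x => a * h x + k x).
Proof.
by move=> [p _ <-] [q _ <-]; exists (a *: p + q) => //; apply/funext => x; rewrite !hornerE.
Qed.

Let close_from_witness (g : measurableTypeR R -> R) :
  measurable_fun setT g ->
  (forall u, let c := ra u ^+ 2 + rb u ^+ 2 in 0 < c -> exists r : {poly R},
     forall x, (g x - r.[x]) ^+ 2 <= c^-1 * (u.[x] ^+ 2 * s x)) ->
  l2_closure mu poly_functions g.
Proof.
move=> mg H; split => // e e0; have [u [c0 uc]] := minorant_witness e0.
have [r rP] := H u c0; exists (horner r); first by exists r.
set c := ra u ^+ 2 + rb u ^+ 2 in c0 uc rP *.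
have mus : measurable_fun [set: measurableTypeR R] (fun x => (u.[x] ^+ 2 * s x)%:E).
  apply/measurable_EFinP; apply: measurable_funM.
    by apply: measurable_funX; exact: measurable_poly.
  exact: measurable_cauchy_kernel.
have us0 x : 0 <= u.[x] ^+ 2 * s x.
  by rewrite mulr_ge0 ?sqr_ge0 ?ltW ?cauchy_kernel_gt0.
apply: (@le_lt_trans _ _ (\int[mu]_(x in setT) ((c^-1)%:E * (u.[x] ^+ 2 * s x)%:E))%E).
  apply: ge0_le_integral => //.
  - by move=> x _; rewrite lee_fin sqr_ge0.
  - apply: measurable_sq; apply: measurable_funB => //; exact: measurable_poly.
  - by apply: emeasurable_funM => //; exact: measurable_cst.
  - by move=> x _; rewrite -EFinM lee_fin.
rewrite ge0_integralZl_EFin ?invr_ge0 ?(ltW c0)//; last first.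
  by move=> x _; rewrite lee_fin.
rewrite -(@lte_pmul2l _ c%:E) ?lte_fin// muleA -EFinM divff ?gt_eqF// mul1e.
by rewrite -EFinM mulrC.
Qed.

Let kernel_closure : l2_closure mu poly_functions s.
Proof.
apply: close_from_witness; first exact: measurable_cauchy_kernel.
move=> u c c0; set a := ra u in c c0 *; set b := rb u in c c0 *.
set z := u %/ W.
(* Division by 1 + x^2 gives u s = z + (a x + b) s and
   u x s = z x + a + (b x - a) s; eliminating x s leaves c s plus a
   polynomial. *)
exists (c^-1 *: (a *: (z * 'X) + (a ^+ 2)%:P - b *: z)) => x.
have uE : u.[x] = z.[x] * (1 + x ^+ 2) + (a * x + b).
  rewrite {1}(divWE u) -/a -/b -/z /W.
  by rewrite !(hornerD, hornerN, hornerZ, hornerM, hornerX, hornerXn, hornerC) [x ^+ 2 + 1]addrC.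
have sE := cauchy_kernelE x; set t := s x in sE *.
have -> : t - (c^-1 *: (a *: (z * 'X) + (a ^+ 2)%:P - b *: z)).[x] =
    c^-1 * (b * (u.[x] * t) - a * (u.[x] * x * t)).
  rewrite !(hornerD, hornerN, hornerZ, hornerM, hornerX, hornerXn, hornerC).
  apply: (@mulfI _ c); first by rewrite gt_eqF.
  rewrite mulrBr !mulrA divff ?gt_eqF// !mul1r uE.
  have -> : b * (z.[x] * (1 + x ^+ 2) + (a * x + b)) * t -
    a * (z.[x] * (1 + x ^+ 2) + (a * x + b)) * x * t =
    (b * z.[x] - a * z.[x] * x) * ((1 + x ^+ 2) * t) - a ^+ 2 * ((1 + x ^+ 2) * t)
    + c * t by rewrite /c; ring.
  by rewrite sE; ring.
rewrite exprMn expr2 -mulrA ler_pM2l ?invr_gt0// mulrC ler_pdivrMr//.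
have -> : u.[x] ^+ 2 * t * c = u.[x] ^+ 2 * t * ((1 + x ^+ 2) * t) * c by rewrite sE mulr1.
have := sqr_ge0 (a * (u.[x] * t) + b * (u.[x] * x * t)); rewrite /c; nra.
Qed.

Let x_kernel_closure : l2_closure mu poly_functions (fun x => x * s x).
Proof.
apply: close_from_witness.
  by apply: measurable_funM; [exact: measurable_id|exact: measurable_cauchy_kernel].
move=> u c c0; set a := ra u in c c0 *; set b := rb u in c c0 *.
set z := u %/ W.
(* This time s is eliminated and c x s remains. *)
exists (- c^-1 *: (a *: z + b *: (z * 'X) + (a * b)%:P)) => x.
have uE : u.[x] = z.[x] * (1 + x ^+ 2) + (a * x + b).
  rewrite {1}(divWE u) -/a -/b -/z /W.
  by rewrite !(hornerD, hornerN, hornerZ, hornerM, hornerX, hornerXn, hornerC) [x ^+ 2 + 1]addrC.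
have sE := cauchy_kernelE x; set t := s x in sE *.
have -> : x * t - (- c^-1 *: (a *: z + b *: (z * 'X) + (a * b)%:P)).[x] =
    c^-1 * (a * (u.[x] * t) + b * (u.[x] * x * t)).
  rewrite !(hornerD, hornerN, hornerZ, hornerM, hornerX, hornerXn, hornerC).
  apply: (@mulfI _ c); first by rewrite gt_eqF.
  rewrite mulrBr !mulrA mulrN divff ?gt_eqF// !mul1r uE.
  have -> : a * (z.[x] * (1 + x ^+ 2) + (a * x + b)) * t +
    b * (z.[x] * (1 + x ^+ 2) + (a * x + b)) * x * t =
    (a * z.[x] + b * z.[x] * x) * ((1 + x ^+ 2) * t) + a * b * ((1 + x ^+ 2) * t)
    + c * x * t by rewrite /c; ring.
  by rewrite sE; ring.
rewrite exprMn expr2 -mulrA ler_pM2l ?invr_gt0// mulrC ler_pdivrMr//.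
have -> : u.[x] ^+ 2 * t * c = u.[x] ^+ 2 * t * ((1 + x ^+ 2) * t) * c by rewrite sE mulr1.
have := sqr_ge0 (b * (u.[x] * t) - a * (u.[x] * x * t)); rewrite /c; nra.
Qed.

(** Modulo 1 + x^2 every polynomial is linear, which leaves the functions s
    and x s. *)
Theorem poly_cauchy_kernel_closure p :
  l2_closure mu poly_functions (fun x => p.[x] * s x).
Proof.
have -> : (fun x => p.[x] * s x) =
    (fun x => ra p * (x * s x) + (rb p * s x + (p %/ W).[x])).
  apply/funext => x; have sE := cauchy_kernelE x.
  rewrite {1}(divWE p) {2}/W !(hornerD, hornerN, hornerZ, hornerM, hornerX, hornerXn, hornerC).
  have -> : ((p %/ W).[x] * (x ^+ 2 + 1) + (ra p * x + rb p)) * s x =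
    (p %/ W).[x] * ((1 + x ^+ 2) * s x) + (ra p * x + rb p) * s x by ring.
  by rewrite sE; ring.
apply: l2_closure_lin => //; apply: l2_closure_lin => //.
by apply: sub_l2_closure => //; exists (p %/ W).
Qed.

End riesz.

(** * Multipliers of the closure *)

Section multipliers.
Import HBNNSimple.
Context d {T : measurableType d} {R : realType} (mu : probability T R).
Implicit Types (u v h phi : T -> R).

Lemma sqnorm_dominated (u_ : nat -> T -> R) g (e : R) :
  (forall n, measurable_fun setT (u_ n)) -> measurable_fun setT g ->
  (sqnorm mu g < +oo)%E -> (forall n x, `|u_ n x| <= `|g x|) ->
  (forall x, u_ n x @[n --> \oo] --> 0) -> 0 < e ->
  exists n, (sqnorm mu (u_ n) < e%:E)%E.
Proof.
move=> mfu mg gfin ug u0 e0.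
have ig : mu.-integrable setT (fun x => (g x ^+ 2)%:E).
  apply/integrableP; split; first exact: measurable_sq.
  by under eq_integral do rewrite gee0_abs ?lee_fin ?sqr_ge0//.
have : sqnorm mu (u_ n) @[n --> \oo] --> (\int[mu]_(x in setT) (cst 0 x))%E.
  apply: (@dominated_cvg _ _ _ mu setT measurableT _ (cst 0%E) _ _ _ _ ig) => //.
  - by move=> n; exact: measurable_sq.
  - move=> x _; apply: cvg_EFin; first by near=> n.
    rewrite -[X in _ --> X](mulr0 (0 : R)).
    by under eq_fun do rewrite expr2; apply: cvgM; exact: u0.
  - move=> n x _; rewrite gee0_abs ?lee_fin ?sqr_ge0//.
    rewrite -[u_ n x ^+ 2]real_normK ?num_real// -[g x ^+ 2]real_normK ?num_real//.
    by rewrite ler_pXn2r ?nnegrE.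
rewrite integral0 => /fine_cvgP[fin] /cvgrPdist_lt/(_ _ e0) lt.
near \oo => n; exists n.
have nf : sqnorm mu (u_ n) \is a fin_num by near: n.
have : `|0 - fine (sqnorm mu (u_ n))| < e by near: n.
by rewrite sub0r normrN ger0_norm ?fine_ge0 ?sqnorm_ge0// -lte_fin fineK.
Unshelve. all: by end_near. Qed.

Variable H : set (T -> R).
Hypothesis H_measurable : forall h, H h -> measurable_fun setT h.
Hypothesis H_lin : forall a u v, H u -> H v -> H (fun x => a * u x + v x).
Hypothesis H_fin : forall h, H h -> (sqnorm mu h < +oo)%E.
Hypothesis H1 : H (cst 1).

Local Notation cl := (l2_closure mu H).

(** Multipliers take the place of tensor products: they form an algebra closed
    under bounded pointwise limits, in which indicators are built one coordinate
    at a time. *)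
Definition multiplier : set (T -> R) := [set phi : T -> R |
  [/\ measurable_fun setT phi, exists C, forall x, `|phi x| <= C &
      forall h, H h -> cl (fun x => phi x * h x)]].

(** Boundedness of phi carries the defining property from H to its closure. *)
Lemma multiplier_closure phi u : multiplier phi -> cl u -> cl (fun x => phi x * u x).
Proof.
move=> [mphi [C phiC] phiH] [mfu uh]; apply: l2_closure_approx => //.
  exact: measurable_funM.
move=> e e0; have C1 : 0 < C ^+ 2 + 1 by rewrite ltr_wpDl ?sqr_ge0.
have [h Hh he] := uh _ (divr_gt0 e0 C1); have mh := H_measurable Hh.
exists (fun x => phi x * h x); first exact: phiH.
have muh := measurable_funB mfu mh.
apply: (@le_lt_trans _ _ (sqnorm mu (fun x => C * (u x - h x))%R)).
  apply: le_sqnorm.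
  - by apply: measurable_funB; exact: measurable_funM.
  - by apply: measurable_funM => //; exact: measurable_cst.
  - move=> x; rewrite -mulrBr !normrM ler_wpM2r// (le_trans (phiC x))//.
    exact: ler_norm.
rewrite sqnormZ//.
apply: (@le_lt_trans _ _ ((C ^+ 2)%:E * (e / (C ^+ 2 + 1))%:E)%E).
  by rewrite lee_wpmul2l ?lee_fin ?sqr_ge0// ltW.
rewrite -EFinM lte_fin mulrA ltr_pdivrMr// mulrC ltr_pM2l//.
by rewrite ltrDl.
Qed.

Lemma multiplier_cst c : multiplier (cst c).
Proof.
split; [exact: measurable_cst|by exists `|c| => x|].
move=> h Hh; have H0 : H (fun x => -1 * h x + h x) by exact: H_lin.
have := H_lin c Hh H0; have -> : (fun x => c * h x + (-1 * h x + h x)) =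
    (fun x => cst c x * h x) by apply/funext => x; rewrite /cst; ring.
exact: sub_l2_closure.
Qed.

Lemma multiplierM phi psi : multiplier phi -> multiplier psi ->
  multiplier (fun x => phi x * psi x).
Proof.
move=> Mphi Mpsi; have [mphi [C phiC] _] := Mphi; have [mpsi [D psiD] psiH] := Mpsi.
split; first exact: measurable_funM.
  by exists (C * D) => x; rewrite normrM ler_pM.
move=> h Hh; under eq_fun do rewrite -mulrA.
by apply: multiplier_closure => //; exact: psiH.
Qed.

Lemma multiplier_lin a phi psi : multiplier phi -> multiplier psi ->
  multiplier (fun x => a * phi x + psi x).
Proof.
move=> [mphi [C phiC] phiH] [mpsi [D psiD] psiH].
split; first by apply: measurable_funD => //; apply: measurable_funM => //;
  exact: measurable_cst.
  exists (`|a| * C + D) => x; rewrite (le_trans (ler_normD _ _))// lerD//.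
  by rewrite normrM ler_wpM2l.
move=> h Hh; have -> : (fun x => (a * phi x + psi x) * h x) =
    (fun x => a * (phi x * h x) + psi x * h x) by apply/funext => x; ring.
by apply: l2_closure_lin => //; [exact: phiH|exact: psiH].
Qed.

Lemma multiplierZ a phi : multiplier phi -> multiplier (fun x => a * phi x).
Proof.
move=> Mphi; have := multiplier_lin a Mphi (multiplier_cst 0).
by under eq_fun do rewrite addr0.
Qed.

Lemma multiplierD phi psi : multiplier phi -> multiplier psi ->
  multiplier (fun x => phi x + psi x).
Proof.
move=> Mphi Mpsi; have := multiplier_lin 1 Mphi Mpsi.
by under eq_fun do rewrite mul1r.
Qed.

Lemma multiplierB phi psi : multiplier phi -> multiplier psi ->
  multiplier (fun x => phi x - psi x).
Proof.
move=> Mphi Mpsi; have := multiplier_lin (-1) Mpsi Mphi.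
by under eq_fun do rewrite mulN1r addrC.
Qed.

Lemma multiplierX n phi : multiplier phi -> multiplier (fun x => phi x ^+ n).
Proof.
move=> Mphi; elim: n => [|n IH].
  by under eq_fun do rewrite expr0; exact: (multiplier_cst 1).
by under eq_fun do rewrite exprS; exact: multiplierM.
Qed.

Lemma multiplier_sum I (r : seq I) (phi : I -> T -> R) :
  (forall i, multiplier (phi i)) -> multiplier (fun x => \sum_(i <- r) phi i x).
Proof.
move=> Mphi; elim: r => [|i r IH].
  by under eq_fun do rewrite big_nil; exact: (multiplier_cst 0).
by under eq_fun do rewrite big_cons; exact: multiplierD.
Qed.

Lemma multiplier_lim (phi_ : nat -> T -> R) phi C :
  (forall n, multiplier (phi_ n)) -> (forall n x, `|phi_ n x| <= C) ->
  (forall x, phi_ n x @[n --> \oo] --> phi x) -> multiplier phi.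
Proof.
move=> Mphi phiC phi_cvg.
have mphi_ n : measurable_fun setT (phi_ n) by have [] := Mphi n.
have mphi : measurable_fun setT phi.
  exact: (measurable_fun_cvg mphi_ (fun x _ => phi_cvg x)).
have phiC' x : `|phi x| <= C.
  have cn : `|phi_ n x| @[n --> \oo] --> `|phi x| by exact: cvg_norm.
  apply: (@closed_cvg _ R^o \oo _ (fun n => `|phi_ n x|) (fun z => z <= C)) => //.
  by near=> n.
split => //; first by exists C.
move=> h Hh; have mh := H_measurable Hh; apply: l2_closure_approx => //.
  exact: measurable_funM.
move=> e e0.
have [| | | | | |n ne] := @sqnorm_dominated (fun n x => phi x * h x - phi_ n x * h x)
    (fun x => (C + C) * h x) e.
- by move=> n; apply: measurable_funB; exact: measurable_funM.
- by apply: measurable_funM => //; exact: measurable_cst.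
- by rewrite sqnormZ// lte_mul_pinfty ?H_fin// lee_fin sqr_ge0.
- move=> n x; rewrite -mulrBl !normrM ler_wpM2r// (le_trans (ler_normB _ _))//.
  by rewrite (le_trans (lerD (phiC' x) (phiC n x)))// ler_norm.
- move=> x; rewrite -[X in _ --> X](subrr (phi x * h x)).
  apply: cvgB; first exact: cvg_cst.
  by apply: cvgMl; exact: phi_cvg.
- by [].
by exists (fun x => phi_ n x * h x) => //; have [_ _] := Mphi n; exact.
Unshelve. all: by end_near. Qed.

(** The iteration p |-> p + (w^2 - p^2) / 2 started at 0 increases to the
    absolute value of w when w takes values in [-1, 1]. *)
Fixpoint abs_approx (n : nat) (t : R) : R :=
  if n is m.+1 then abs_approx m t + (t ^+ 2 - abs_approx m t ^+ 2) / 2 else 0.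

Lemma abs_approx_bounds n (t : R) : `|t| <= 1 ->
  0 <= abs_approx n t <= `|t| /\ `|t| - abs_approx n t <= `|t| * (1 - `|t| / 2) ^+ n.
Proof.
move=> t1; have t0 := normr_ge0 t.
elim: n => [|n [/andP[p0 pt] IH]] /=; first by rewrite expr0; split; lra.
set p := abs_approx n t in p0 pt IH *; rewrite -[t ^+ 2]real_normK ?num_real//.
set s := `|t| in t0 t1 pt IH *; split.
  by apply/andP; split; nra.
have -> : s - (p + (s ^+ 2 - p ^+ 2) / 2) = (s - p) * (1 - (s + p) / 2) by field.
rewrite exprSr mulrA.
apply: (@le_trans _ _ ((s - p) * (1 - s / 2))); first by apply: ler_wpM2l; lra.
by apply: ler_wpM2r => //; lra.
Qed.

Lemma abs_approx_cvg (t : R) : `|t| <= 1 -> abs_approx n t @[n --> \oo] --> `|t|.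
Proof.
move=> t1.
have lo : `|t| - `|t| * (1 - `|t| / 2) ^+ n @[n --> \oo] --> `|t|.
  rewrite -[X in _ --> X]subr0; apply: cvgB; first exact: cvg_cst.
  have [->|tn0] := eqVneq t 0.
    by under eq_fun do rewrite normr0 mul0r; exact: cvg_cst.
  rewrite -[X in _ --> X](mulr0 `|t|); apply: cvgMr; apply: cvg_expr.
  have tp : 0 < `|t| by rewrite normr_gt0.
  by rewrite ger0_norm; lra.
apply: (squeeze_cvgr _ lo (cvg_cst `|t|)).
near=> n; have [/andP[_ h1] h2] := abs_approx_bounds n t1.
by rewrite h1 andbT lerBlDr -lerBlDl.
Unshelve. all: by end_near. Qed.

Lemma multiplier_abs phi : multiplier phi -> (forall x, `|phi x| <= 1) ->
  multiplier (fun x => `|phi x|).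
Proof.
move=> Mphi phi1; apply: (@multiplier_lim (fun n x => abs_approx n (phi x)) _ 1).
- elim=> [|n IH] /=; first exact: (multiplier_cst 0).
  apply: multiplierD => //; under eq_fun do rewrite mulrC.
  by apply: multiplierZ; apply: multiplierB; exact: multiplierX.
- move=> n x; have [/andP[h0 h1] _] := abs_approx_bounds n (phi1 x).
  by rewrite ger0_norm// (le_trans h1).
- by move=> x; exact: abs_approx_cvg.
Qed.

(** For w with values in [-1, 1] and positive part w+, the powers of 1 - w+
    decrease to the indicator of the set where w <= 0. *)
Lemma multiplier_indic_gt0 phi : multiplier phi ->
  multiplier (\1_[set x | 0 < phi x]).
Proof.
move=> Mphi; have [mphi [C phiC] _] := Mphi.
pose c := `|C| + 1; have c0 : 0 < c by rewrite ltr_wpDl.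
pose w x := c^-1 * phi x.
have w1 x : `|w x| <= 1.
  rewrite normrM ger0_norm ?invr_ge0 ?(ltW c0)// mulrC ler_pdivrMr// mul1r.
  by rewrite (le_trans (phiC x))// (le_trans (ler_norm C))// lerDl.
have Mw : multiplier w by exact: multiplierZ.
pose wp x := 2^-1 * (w x + `|w x|).
have Mwp : multiplier wp.
  by apply: multiplierZ; apply: multiplierD => //; exact: multiplier_abs.
have wp01 x : 0 <= 1 - wp x <= 1.
  by have := w1 x; rewrite /wp; case: (ger0P (w x)) => *; lra.
apply: (@multiplier_lim (fun n x => 1 - (1 - wp x) ^+ n) _ 1).
- move=> n; apply: multiplierB; first exact: (multiplier_cst 1).
  by apply: multiplierX; apply: multiplierB => //; exact: (multiplier_cst 1).
- move=> n x; have /andP[h0 h1] := wp01 x.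
  have := exprn_ge0 n h0; have := exprn_ile1 n h0 h1.
  by rewrite ler_norml; lra.
- move=> x; rewrite indicE; have [px|px] := ltP 0 (phi x).
    rewrite mem_set//= -[X in _ --> X]subr0; apply: cvgB; first exact: cvg_cst.
    apply: cvg_expr; have /andP[h0 _] := wp01 x; rewrite ger0_norm//.
    have : 0 < w x by rewrite mulr_gt0// invr_gt0.
    by move=> wx; rewrite /wp ger0_norm; lra.
  rewrite memNset/=; last by apply/negP; rewrite -leNgt.
  have wx : w x <= 0 by rewrite /w mulr_ge0_le0// invr_ge0 ltW.
  have -> : wp x = 0 by rewrite /wp ler0_norm//; lra.
  by under eq_fun do rewrite subr0 expr1n subrr; exact: cvg_cst.
Qed.

Definition multiplier_sets : set (set T) := [set A | multiplier (\1_A : T -> R)].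

Lemma multiplier_setC A : multiplier_sets A -> multiplier_sets (~` A).
Proof.
move=> MA; rewrite /multiplier_sets/=.
have -> : \1_(~` A) = (fun x => cst 1 x - \1_A x) :> (T -> R).
  apply/funext => x; rewrite !indicE in_setC.
  by case: (x \in A); rewrite /= ?subrr ?subr0.
by apply: multiplierB => //; exact: multiplier_cst.
Qed.

Lemma multiplier_setI A B : multiplier_sets A -> multiplier_sets B ->
  multiplier_sets (A `&` B).
Proof.
move=> MA MB; rewrite /multiplier_sets/= indicI.
exact: multiplierM.
Qed.

Lemma multiplier_bigcup (A : nat -> set T) : (forall n, multiplier_sets (A n)) ->
  multiplier_sets (\bigcup_n A n).
Proof.
move=> MA; pose B n := \bigcup_(i in [set i | (i < n)%N]) A i.
have MB n : multiplier_sets (B n).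
  elim: n => [|n IH].
    rewrite /B (_ : [set i | (i < 0)%N] = set0) ?bigcup_set0.
      by rewrite /multiplier_sets/= indic0; exact: (multiplier_cst 0).
    by rewrite -subset0 => i.
  have -> : B n.+1 = ~` (~` B n `&` ~` A n).
    rewrite setCI !setCK; apply/seteqP; split => x.
      move=> [i /= + Aix]; rewrite ltnS leq_eqVlt => /predU1P[<-|lt]; [by right|].
      by left; exists i.
    by move=> [[i /= lt Aix]|Anx]; [exists i => //=; exact: ltnW|exists n => /=].
  by apply: multiplier_setC; apply: multiplier_setI; exact: multiplier_setC.
apply: (@multiplier_lim (fun n => \1_(B n)) _ 1) => //.
  by move=> n x; rewrite indicE ger0_norm// lern1 leq_b1.
move=> x; apply: cvg_near_cst; rewrite !indicE.
have [[n _ Anx]|nA] := pselect ((\bigcup_n A n) x).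
  near=> m; have nm : (n < m)%N by near: m; exact: nbhs_infty_gt.
  have Bm : B m x by rewrite /B; exists n.
  by rewrite indicE (mem_set Bm) (mem_set (ex_intro2 _ _ n Logic.I Anx : (\bigcup_n A n) x)).
near=> m; have Bm : ~ B m x by move=> [i _ Aix]; apply: nA; exists i.
by rewrite indicE !memNset.
Unshelve. all: by end_near. Qed.

Lemma multiplier_sigma_algebra : sigma_algebra setT multiplier_sets.
Proof.
split.
- by rewrite /multiplier_sets/= indic0; exact: (multiplier_cst 0).
- by move=> A MA; rewrite setTD; exact: multiplier_setC.
- by move=> A MA; exact: multiplier_bigcup.
Qed.

Hypothesis multiplier_measurable : forall A : set T, measurable A -> multiplier_sets A.

Let closure_ge0 u : measurable_fun setT u -> (sqnorm mu u < +oo)%E ->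
  (forall x, 0 <= u x) -> cl u.
Proof.
move=> mfu ufin u0; apply: l2_closure_approx => // e e0.
have meu : measurable_fun setT (EFin \o u) by exact/measurable_EFinP.
pose g := nnsfun_approx measurableT meu.
have u0' x : [set: T] x -> (0 <= (EFin \o u) x)%E by move=> _; rewrite lee_fin.
have gu x : g n x @[n --> \oo] --> u x.
  by have /fine_cvgP[] := cvg_nnsfun_approx measurableT meu u0' (I : [set: T] x).
have gle n x : g n x <= u x.
  have h k m : (k <= m)%N -> g k x <= g m x.
    by move=> km; have /lefP := nd_nnsfun_approx measurableT meu km; exact.
  have lim := cvg_lim (@Rhausdorff R) (gu x).
  rewrite -lim; apply: nondecreasing_cvgn_le; first exact: h.
  by apply/cvg_ex; exists (u x); exact: gu.
have [| | | | | |n ne] := @sqnorm_dominated (fun n x => u x - g n x) u e.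
- by move=> n; apply: measurable_funB.
- by [].
- by [].
- move=> n x; rewrite !ger0_norm ?subr_ge0//.
  by rewrite gerBl; exact: fun_ge0.
- move=> x; rewrite -[X in _ --> X](subrr (u x)); apply: cvgB; first exact: cvg_cst.
  exact: gu.
- by [].
exists (g n) => //.
have Mg : multiplier (g n).
  have -> : (g n : T -> R) = (fun x =>
      \sum_(y <- fset_set (range (g n))) y * \1_(g n @^-1` [set y]) x).
    apply/funext => x; rewrite fimfunE fsbig_finite//; exact: fimfunP.
  by apply: multiplier_sum => y; apply: multiplierZ; exact: multiplier_measurable.
have [_ _ /(_ _ H1)] := Mg; by under eq_fun do rewrite mulr1.
Qed.

(** Simple functions are multipliers and 1 belongs to H, so simple functions lie
    in the closure; by dominated convergence they exhaust L^2. *)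
Theorem l2_closure_full u : measurable_fun setT u -> (sqnorm mu u < +oo)%E -> cl u.
Proof.
move=> mfu ufin.
have part v : measurable_fun setT v -> (forall x, 0 <= v x) ->
    (forall x, `|v x| <= `|u x|) -> cl v.
  by move=> mv v0 vu; apply: closure_ge0 => //; apply: le_lt_trans ufin; exact: le_sqnorm.
have -> : u = (fun x => -1 * (2^-1 * (`|u x| - u x)) + 2^-1 * (`|u x| + u x)).
  by apply/funext => x; field.
apply: l2_closure_lin => //; apply: part.
- by apply: measurable_funM => //; apply: measurable_funB => //; exact: measurableT_comp.
- by move=> x; rewrite mulr_ge0// subr_ge0 ler_norm.
- by move=> x; case: (ger0P (u x)) => ux; rewrite ger0_norm; lra.
- by apply: measurable_funM => //; apply: measurable_funD => //; exact: measurableT_comp.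
- by move=> x; rewrite mulr_ge0//; have := ler_norm (- u x); rewrite normrN; lra.
- by move=> x; case: (ger0P (u x)) => ux; rewrite ger0_norm; lra.
Qed.

End multipliers.

(** * Expectations of products of independent variables *)

Section weighted_law.
Context d {T : measurableType d} {R : realType} (P : probability T R).
Variables (Z : T -> measurableTypeR R) (m : probability (measurableTypeR R) R).
Variables (w : T -> R) (c : R).
Hypothesis mZ : measurable_fun setT Z.
Hypothesis mw : measurable_fun setT w.
Hypothesis w0 : forall x, 0 <= w x.
Hypothesis wZ : forall A, measurable A ->
  (\int[P]_(x in setT) (\1_A (Z x) * w x)%:E = m A * c%:E)%E.

Let good : set (measurableTypeR R -> R) := [set g : measurableTypeR R -> R |
  [/\ measurable_fun setT g, forall t, 0 <= g t &
   (\int[P]_(x in setT) (g (Z x) * w x)%:E = (\int[m]_(t in setT) (g t)%:E) * c%:E)%E]].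

Let measurable_gw (g : measurableTypeR R -> R) : measurable_fun setT g ->
  measurable_fun setT (fun x => (g (Z x) * w x)%:E).
Proof.
move=> mg; apply/measurable_EFinP; apply: measurable_funM => //.
exact: measurableT_comp.
Qed.

Let good_indic A : measurable A -> good (\1_A).
Proof.
move=> mA; split => //; rewrite wZ//.
by rewrite integral_indic// setIT.
Qed.

Let good_lin a g h : 0 <= a -> good g -> good h -> good (fun t => a * g t + h t).
Proof.
move=> a0 [mg g0 gE] [mh h0 hE].
have mag : measurable_fun setT (fun t => a * g t).
  by apply: measurable_funM => //; exact: measurable_cst.
split; first exact: measurable_funD.
  by move=> t; rewrite addr_ge0// mulr_ge0.
have lin d' (U : measurableType d') (nu : probability U R) (u v : U -> R) :
    measurable_fun setT (EFin \o u) -> measurable_fun setT (EFin \o v) ->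
    (forall x, 0 <= u x) -> (forall x, 0 <= v x) ->
    (\int[nu]_(x in setT) (a * u x + v x)%:E =
     a%:E * \int[nu]_(x in setT) (u x)%:E + \int[nu]_(x in setT) (v x)%:E)%E.
  move=> mfu mv u0 v0; under eq_integral do rewrite EFinD EFinM.
  rewrite ge0_integralD//.
  - rewrite ge0_integralZl_EFin//.
    by move=> x _; rewrite lee_fin.
  - by move=> x _; rewrite mule_ge0// lee_fin.
  - by apply: emeasurable_funM => //; exact: measurable_cst.
  - by move=> x _; rewrite lee_fin.
transitivity (a%:E * \int[P]_(x in setT) (g (Z x) * w x)%:E +
              \int[P]_(x in setT) (h (Z x) * w x)%:E)%E.
  rewrite -lin; [|exact: measurable_gw|exact: measurable_gw| |].
  - by apply: eq_integral => x _; rewrite mulrDl mulrA.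
  - by move=> x; rewrite mulr_ge0.
  - by move=> x; rewrite mulr_ge0.
rewrite gE hE lin//; [|exact/measurable_EFinP|exact/measurable_EFinP].
have ig : (0 <= \int[m]_(t in setT) (g t)%:E)%E.
  by apply: integral_ge0 => t _; rewrite lee_fin.
have ih : (0 <= \int[m]_(t in setT) (h t)%:E)%E.
  by apply: integral_ge0 => t _; rewrite lee_fin.
move: ig ih; move: (\int[m]_(t in setT) _)%E (\int[m]_(t in setT) (h t)%:E)%E => x y x0 y0.
by rewrite [RHS]ge0_muleDl ?mule_ge0 ?lee_fin// muleA.
Qed.

Let good_lim (s : nat -> measurableTypeR R -> R) (g : measurableTypeR R -> R) :
  measurable_fun setT g ->
  (forall n, good (s n)) -> (forall n k t, (n <= k)%N -> s n t <= s k t) ->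
  (forall t, s n t @[n --> \oo] --> g t) -> good g.
Proof.
move=> mg sgood snd sg.
have g0 t : 0 <= g t.
  apply: (@closed_cvg _ R^o \oo _ (fun n => s n t) (fun z => 0 <= z)) => //.
  by near=> n; have [_ + _] := sgood n; exact.
split => //.
have limE d' (U : measurableType d') (nu : probability U R) (u_ : nat -> U -> R) (u : U -> R) :
    (forall n, measurable_fun setT (EFin \o u_ n)) -> (forall n x, 0 <= u_ n x) ->
    (forall n k x, (n <= k)%N -> u_ n x <= u_ k x) ->
    (forall x, u_ n x @[n --> \oo] --> u x) ->
    (\int[nu]_(x in setT) (u_ n x)%:E @[n --> \oo] --> \int[nu]_(x in setT) (u x)%:E)%E.
  move=> mfu u0 und uu.
  have -> : (fun x => (u x)%:E) = (fun x => limn (fun n => (u_ n x)%:E)).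
    apply/funext => x; apply/esym/cvg_lim => //.
    by apply: cvg_EFin; [near=> n|exact: uu].
  apply: (@cvg_monotone_convergence _ _ _ nu setT measurableT (fun n x => (u_ n x)%:E)).
  - by [].
  - by move=> n x _; rewrite lee_fin.
  - by move=> x _ n k nk; rewrite lee_fin und.
have s0 n t : 0 <= s n t by have [_ + _] := sgood n; exact.
have L1 : (\int[P]_(x in setT) (s n (Z x) * w x)%:E @[n --> \oo] -->
           \int[P]_(x in setT) (g (Z x) * w x)%:E)%E.
  apply: limE.
  - by move=> n; apply: measurable_gw; have [] := sgood n.
  - by move=> n x; rewrite mulr_ge0.
  - by move=> n k x nk; rewrite ler_wpM2r// snd.
  - by move=> x; apply: cvgMl; exact: sg.
have L2 : ((\int[m]_(t in setT) (s n t)%:E) * c%:E @[n --> \oo] -->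
           (\int[m]_(t in setT) (g t)%:E) * c%:E)%E.
  apply: cvgeMr => //; apply: limE => //.
  by move=> n; apply/measurable_EFinP; have [] := sgood n.
apply: (cvg_unique _ L1); first exact: ereal_hausdorff.
apply: cvg_trans L2; apply: near_eq_cvg; near=> n.
by have [_ _ ->] := sgood n.
Unshelve. all: by end_near. Qed.

Import HBNNSimple.

(** From indicators the identity propagates by linearity and monotone limits. *)
Lemma integral_weighted_law (g : measurableTypeR R -> R) :
  measurable_fun setT g -> (forall t, 0 <= g t) ->
  (\int[P]_(x in setT) (g (Z x) * w x)%:E = (\int[m]_(t in setT) (g t)%:E) * c%:E)%E.
Proof.
move=> mg g0.
have meg : measurable_fun setT (EFin \o g) by exact/measurable_EFinP.
have g0' t : [set: measurableTypeR R] t -> (0 <= (EFin \o g) t)%E.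
  by move=> _; rewrite lee_fin.
pose s := nnsfun_approx measurableT meg.
suff [] : good g by [].
apply: (good_lim mg (s := s)).
- move=> n; have y0 y : y \in enum_fset (fset_set (range (s n))) -> 0 <= y.
    rewrite -[_ \in _]/(y \in fset_set (range (s n))) in_fset_set ?inE; last exact: fimfunP.
    by move=> [t _ <-]; exact: fun_ge0.
  have -> : (s n : _ -> _) = (fun t =>
      \sum_(y <- fset_set (range (s n))) y * \1_(s n @^-1` [set y]) t).
    by apply/funext => t; rewrite fimfunE fsbig_finite//; exact: fimfunP.
  elim: (enum_fset _) y0 => [_|y r IH y0].
    under eq_fun do rewrite big_nil.
    by have := good_indic measurable0; rewrite indic0.
  under eq_fun do rewrite big_cons.
  apply: good_lin.
  + by apply: y0; rewrite mem_head.
  + exact: good_indic.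
  + by apply: IH => z zr; apply: y0; rewrite in_cons zr orbT.
- by move=> n k t nk; have /lefP := nd_nnsfun_approx measurableT meg nk; exact.
- by move=> t; have /fine_cvgP[] := cvg_nnsfun_approx measurableT meg g0' (I : [set: _] t).
Qed.

End weighted_law.

Section independent_products.
Context d {T : measurableType d} {R : realType} (P : probability T R).
Variables (Z : nat -> T -> R) (m : nat -> probability (measurableTypeR R) R).
Hypothesis mZ : forall i, measurable_fun setT (Z i : T -> measurableTypeR R).
Hypothesis Z_indep : mutually_independent P posnat Z.
Hypothesis Z_law : forall i, posnat i -> forall A : set (measurableTypeR R),
  measurable A -> pushforward P (Z i) A = m i A.
Implicit Types (g : nat -> measurableTypeR R -> R) (r : seq nat).

Let fin_m i (A : set (measurableTypeR R)) : measurable A -> m i A \is a fin_num.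
Proof. by move=> mA; exact: fin_num_measure. Qed.

Lemma independent_indicators r (A : nat -> set (measurableTypeR R)) :
  uniq r -> {in r, forall i, posnat i} -> (forall i, measurable (A i)) ->
  (\int[P]_(x in setT) (\prod_(i <- r) \1_(A i) (Z i x))%:E =
   (\prod_(i <- r) fine (m i (A i)))%:E)%E.
Proof.
move=> ur rpos mA; pose J := [fset i in r]%fset.
have JE : perm_eq (enum_fset J) r.
  by apply: uniq_perm => // i; rewrite -[_ \in _]/(i \in J) in_fset.
have JI : [set` J] `<=` posnat by move=> i /=; rewrite in_fset => /rpos.
pose B : set T := \bigcap_(i in [set` J]) (Z i @^-1` A i).
have mB : measurable B.
  apply: fin_bigcap_measurable => // i _; rewrite -[X in measurable X]setTI.
  exact: mZ.
transitivity (P B).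
  rewrite -[P B]/(P (B)) -(setIT B) -integral_indic//.
  apply: eq_integral => x _; congr EFin.
  rewrite indicE; have [Bx|nBx] := boolP (x \in B).
    rewrite big_seq big1// => i ir; rewrite indicE mem_set//.
    by move: Bx; rewrite inE => /(_ i); apply; rewrite /= in_fset.
  have [i ir /= nA] : exists2 i, i \in r & ~ A i (Z i x).
    apply: contrapT => h; move/negP: nBx; apply; rewrite inE => i /=.
    by rewrite in_fset => ir; apply: contrapT => nA; apply: h; exists i.
  by rewrite (big_rem i)//= indicE memNset// mul0r.
rewrite Z_indep// (perm_big _ JE) -prodEFin big_seq [RHS]big_seq.
by apply: eq_bigr => i /rpos ip; rewrite fineK ?fin_m// -Z_law.
Qed.

Lemma measurable_prod_comp r g : {in r, forall i, measurable_fun setT (g i)} ->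
  measurable_fun setT (fun x => \prod_(i <- r) g i (Z i x)).
Proof.
elim: r => [|i r IH] mg; first by under eq_fun do rewrite big_nil; exact: measurable_cst.
under eq_fun do rewrite big_cons; apply: measurable_funM.
  by apply: measurableT_comp; [apply: mg; rewrite mem_head|exact: mZ].
by apply: IH => j jr; apply: mg; rewrite in_cons jr orbT.
Qed.

Let integrable_measurable i (f : measurableTypeR R -> R) :
  (m i).-integrable setT (EFin \o f) -> measurable_fun setT f.
Proof. by move=> /integrableP[/measurable_EFinP]. Qed.

(** One factor at a time is upgraded from an indicator to a nonnegative
    function, all the others being the weight. *)
Let mixed_products r1 r2 (A : nat -> set (measurableTypeR R)) g :
  uniq (r1 ++ r2) -> {in r1 ++ r2, forall i, posnat i} -> (forall i, measurable (A i)) ->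
  {in r2, forall i, (m i).-integrable setT (EFin \o g i)} -> 
  {in r2, forall i t, 0 <= g i t} ->
  (\int[P]_(x in setT) ((\prod_(i <- r1) \1_(A i) (Z i x)) * \prod_(i <- r2) g i (Z i x))%:E =
   ((\prod_(i <- r1) fine (m i (A i))) * \prod_(i <- r2) Rintegral (m i) setT (g i))%:E)%E.
Proof.
elim: r2 r1 A => [|j r2 IH] r1 A.
  rewrite cats0 => u1 p1 mA _ _.
  under eq_integral do rewrite big_nil mulr1.
  by rewrite big_nil mulr1; exact: independent_indicators.
move=> ur rpos mA gi g0.
have gj := gi j (mem_head _ _); have gj0 := g0 j (mem_head _ _).
have jr : j \notin r1 ++ r2 by move: ur; rewrite -cat_rcons cat_uniq rcons_uniq mem_cat negb_or
  => /and3P[/andP[-> _] /hasPn h _]; apply/negP => /h; rewrite mem_rcons mem_head.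
have p_in : {subset r1 ++ r2 <= r1 ++ j :: r2}.
  by move=> i; rewrite !mem_cat in_cons => /orP[->//|->]; rewrite !orbT.
have u' : uniq ((j :: r1) ++ r2).
  by move: ur; rewrite (perm_uniq (_ : perm_eq _ ((j :: r1) ++ r2)))// perm_catC/=
    perm_cons perm_catC.
have p' : {in (j :: r1) ++ r2, forall i, posnat i}.
  move=> i; rewrite /= in_cons => /predU1P[->|/p_in]; last exact: rpos.
  by apply: rpos; rewrite mem_cat mem_head orbT.
have gi' : {in r2, forall i, (m i).-integrable setT (EFin \o g i)}.
  by move=> i ir; apply: gi; rewrite in_cons ir orbT.
have g0' : {in r2, forall i t, 0 <= g i t}.
  by move=> i ir; apply: g0; rewrite in_cons ir orbT.
pose w x := (\prod_(i <- r1) \1_(A i) (Z i x)) * \prod_(i <- r2) g i (Z i x).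
pose c := (\prod_(i <- r1) fine (m i (A i))) * \prod_(i <- r2) Rintegral (m i) setT (g i).
have w0 x : 0 <= w x.
  rewrite mulr_ge0//; first by apply: prodr_ge0 => i _; rewrite indicE.
  by rewrite big_seq; apply: prodr_ge0 => i ir; exact: g0'.
have mw : measurable_fun setT w.
  apply: measurable_funM.
    by apply: (@measurable_prod_comp r1 (fun i => \1_(A i))) => i _.
  by apply: (@measurable_prod_comp r2 g) => i ir; apply: integrable_measurable; exact: gi'.
have wZ (A' : set (measurableTypeR R)) : measurable A' ->
    (\int[P]_(x in setT) (\1_A' (Z j x) * w x)%:E = m j A' * c%:E)%E.
  move=> mA'; pose A2 i := if i == j then A' else A i.
  have A2E i : i \in r1 -> A2 i = A i.
    by move=> ir; rewrite /A2; case: eqP => // ij; move: jr; rewrite -ij mem_cat ir.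
  have mA2 i : measurable (A2 i) by rewrite /A2; case: eqP.
  have := IH (j :: r1) A2 u' p' mA2 gi' g0'.
  rewrite !big_cons {2}/A2 eqxx -(fineK (fin_m j mA')) -EFinM mulrA /c.
  rewrite (eq_big_seq (fun i => fine (m i (A i)))); last by move=> i ir /=; rewrite A2E.
  move=> <-; apply: eq_integral => x _; rewrite /w big_cons {1}/A2 eqxx mulrA.
  by congr (_ * _ * _)%:E; apply: eq_big_seq => i ir; rewrite A2E.
have := integral_weighted_law (mZ j) mw w0 wZ (integrable_measurable gj) gj0.
rewrite -(fineK (integrable_fin_num measurableT gj)) -EFinM => E.
rewrite big_cons mulrCA -/(Rintegral _ _ _) -E.
by apply: eq_integral => x _; rewrite big_cons mulrCA.
Qed.

(** A signed factor is the difference of g + |g| and |g|, both nonnegative. *)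
Let signed_products r1 r2 g :
  uniq (r1 ++ r2) -> {in r1 ++ r2, forall i, posnat i} ->
  {in r1 ++ r2, forall i, (m i).-integrable setT (EFin \o g i)} ->
  {in r1, forall i t, 0 <= g i t} ->
  let f x := (\prod_(i <- r1) g i (Z i x)) * \prod_(i <- r2) g i (Z i x) in
  P.-integrable setT (EFin \o f) /\
  Rintegral P setT f =
    (\prod_(i <- r1) Rintegral (m i) setT (g i)) * \prod_(i <- r2) Rintegral (m i) setT (g i).
Proof.
elim: r2 r1 g => [|j r2 IH] r1 g.
  rewrite cats0 => u1 p1 gi g0 f.
  have f0 x : 0 <= f x.
    rewrite /f big_nil mulr1 big_seq; apply: prodr_ge0 => i ir; exact: g0.
  have mf : measurable_fun setT f.
    apply: measurable_funM; last by apply: (@measurable_prod_comp [::] g).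
    by apply: (@measurable_prod_comp r1 g) => i ir; apply: integrable_measurable; exact: gi.
  have := @mixed_products [::] r1 (fun=> setT) g u1 p1 (fun=> measurableT) gi g0.
  under eq_integral do rewrite big_nil mul1r; rewrite big_nil mul1r => E.
  have fE : (\int[P]_(x in setT) (f x)%:E =
      (\prod_(i <- r1) Rintegral (m i) setT (g i))%:E)%E.
    by rewrite -E; apply: eq_integral => x _; rewrite /f big_nil mulr1.
  split; last by rewrite /Rintegral fE big_nil mulr1.
  apply/integrableP; split; first exact/measurable_EFinP.
  under eq_integral do rewrite gee0_abs ?lee_fin//=.
  by rewrite fE ltry.
move=> ur rpos gi g0 f.
have jr : j \notin r1 ++ r2 by move: ur; rewrite -cat_rcons cat_uniq rcons_uniq mem_cat negb_or
  => /and3P[/andP[-> _] /hasPn h _]; apply/negP => /h; rewrite mem_rcons mem_head.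
have p_in : {subset r1 ++ r2 <= r1 ++ j :: r2}.
  by move=> i; rewrite !mem_cat in_cons => /orP[->//|->]; rewrite !orbT.
have u' : uniq ((j :: r1) ++ r2).
  by move: ur; rewrite (perm_uniq (_ : perm_eq _ ((j :: r1) ++ r2)))// perm_catC/=
    perm_cons perm_catC.
have jin : j \in r1 ++ j :: r2 by rewrite mem_cat mem_head orbT.
have p' : {in (j :: r1) ++ r2, forall i, posnat i}.
  by move=> i; rewrite /= in_cons => /predU1P[->|/p_in]; exact: rpos.
pose part h i := if i == j then h else g i.
have IHpart (h : measurableTypeR R -> R) :
    (m j).-integrable setT (EFin \o h) -> (forall t, 0 <= h t) ->
    let f x := h (Z j x) * ((\prod_(i <- r1) g i (Z i x)) * \prod_(i <- r2) g i (Z i x)) in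
    P.-integrable setT (EFin \o f) /\
    Rintegral P setT f = Rintegral (m j) setT h *
      ((\prod_(i <- r1) Rintegral (m i) setT (g i)) * \prod_(i <- r2) Rintegral (m i) setT (g i)).
  move=> hi h0; have partE i : i \in r1 ++ r2 -> part h i = g i.
    by move=> ir; rewrite /part; case: eqP => // ij; move: jr; rewrite -ij ir.
  have [||] := IH (j :: r1) (part h) u' p'.
  - move=> i; rewrite /= in_cons => /predU1P[->|ir]; first by rewrite /part eqxx.
    by rewrite partE//; apply: gi; exact: p_in.
  - move=> i; rewrite in_cons => /predU1P[->|ir]; first by rewrite /part eqxx.
    by rewrite partE ?mem_cat ?ir//; exact: g0.
  have in1 i : i \in r1 -> part h i = g i by move=> ir; rewrite partE// mem_cat ir.
  have in2 i : i \in r2 -> part h i = g i by move=> ir; rewrite partE// mem_cat ir orbT.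
  have -> : (fun x => (\prod_(i <- j :: r1) part h i (Z i x)) * \prod_(i <- r2) part h i (Z i x)) =
    (fun x => h (Z j x) * ((\prod_(i <- r1) g i (Z i x)) * \prod_(i <- r2) g i (Z i x))).
    apply/funext => x; rewrite big_cons {1}/part eqxx mulrA; congr (_ * _ * _).
      by apply: eq_big_seq => i /in1 ->.
    by apply: eq_big_seq => i /in2 ->.
  move=> fi E; split => //; rewrite E big_cons {1}/part eqxx -mulrA; congr (_ * (_ * _)).
    by apply: eq_big_seq => i /in1 ->.
  by apply: eq_big_seq => i /in2 ->.
have gji := gi j jin; have mgj := integrable_measurable gji.
have absi : (m j).-integrable setT (EFin \o (fun t => `|g j t|)) by exact: integrable_norm gji.
have sumi : (m j).-integrable setT (EFin \o (fun t => g j t + `|g j t|)).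
  by apply: (integrableD measurableT gji absi).
have [|i1 E1] := IHpart _ sumi.
  by move=> t; have := ler_norm (- g j t); rewrite normrN; lra.
have [|i2 E2] := IHpart _ absi; first by [].
have fE : f = (fun x => 
   (g j (Z j x) + `|g j (Z j x)|) * (\prod_(i <- r1) g i (Z i x) * \prod_(i <- r2) g i (Z i x)) -
   `|g j (Z j x)| * (\prod_(i <- r1) g i (Z i x) * \prod_(i <- r2) g i (Z i x))).
  by apply/funext => x; rewrite /f big_cons; ring.
split; first by rewrite fE; apply: (integrableB measurableT i1 i2).
rewrite fE RintegralB// E1 E2 RintegralD// big_cons; ring.
Qed.

Lemma independent_products r g : uniq r -> {in r, forall i, posnat i} ->
  {in r, forall i, (m i).-integrable setT (EFin \o g i)} ->
  P.-integrable setT (EFin \o (fun x => \prod_(i <- r) g i (Z i x))) /\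
  Rintegral P setT (fun x => \prod_(i <- r) g i (Z i x)) =
    \prod_(i <- r) Rintegral (m i) setT (g i).
Proof.
move=> ur rpos gi; have [//|] := @signed_products [::] r g ur rpos gi.
under eq_fun do rewrite big_nil mul1r.
by rewrite big_nil mul1r.
Qed.

End independent_products.

(** * Orthonormal expansions *)

Section dot_product.
Context {R : realType} {V : lmodType R} (dot : {dot V for idfun}).

Lemma dotC u v : dot u v = dot v u.
Proof. by rewrite (hermC dot) /= mul1r. Qed.

Lemma dot_linl a u v w : dot (a *: u + v) w = a * dot u w + dot v w.
Proof. by rewrite linearPl. Qed.

Lemma dot_ge0 u : 0 <= dot u u.
Proof.
have [->|u0] := eqVneq u 0; last exact/ltW/neq0_dnorm_gt0.
by have := dot_linl (-1) 0 0 0; rewrite scaleN1r addNr mulN1r addNr => ->.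
Qed.

End dot_product.

Section orthonormal_expansion.
Context {R : realType} {V : lmodType R} {I : choiceType}.
Variables (S : set V) (ip : V -> V -> R) (D : set I) (e : I -> V).
Hypothesis S_lin : forall a u v, S u -> S v -> S (a *: u + v).
Hypothesis ipC : forall u v, S u -> S v -> ip u v = ip v u.
Hypothesis ip_lin : forall a u v w, S u -> S v -> S w ->
  ip (a *: u + v) w = a * ip u w + ip v w.
Hypothesis S_e : forall i, D i -> S (e i).
Hypothesis e_orthonormal : forall i j, D i -> D j -> ip (e i) (e j) = (i == j)%:R.
Implicit Types (r : seq I) (c : I -> R).

Let S0 v : S v -> S 0.
Proof. by move=> Sv; have := S_lin (-1) Sv Sv; rewrite scaleN1r addNr. Qed.

Let ip0 v w : S v -> S w -> ip 0 w = 0.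
Proof.
by move=> Sv Sw; have := ip_lin (-1) Sv Sv Sw; rewrite scaleN1r addNr mulN1r addNr.
Qed.

Lemma expansion_in_space r c v : S v -> {in r, forall i, D i} ->
  S (\sum_(i <- r) c i *: e i).
Proof.
move=> Sv; elim: r => [_|i r IH rD]; first by rewrite big_nil; exact: S0 Sv.
rewrite big_cons; apply: S_lin; first by apply: S_e; apply: rD; rewrite mem_head.
by apply: IH => j jr; apply: rD; rewrite in_cons jr orbT.
Qed.

Lemma ip_expansion r c v w : S v -> S w -> {in r, forall i, D i} ->
  ip (\sum_(i <- r) c i *: e i) w = \sum_(i <- r) c i * ip (e i) w.
Proof.
move=> Sv Sw; elim: r => [_|i r IH rD]; first by rewrite !big_nil (ip0 Sv).
have rD' : {in r, forall i, D i} by move=> j jr; apply: rD; rewrite in_cons jr orbT.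
rewrite !big_cons ip_lin ?IH//; first by apply: S_e; apply: rD; rewrite mem_head.
exact: expansion_in_space Sv _.
Qed.

(** Pythagoras: the distance to a linear combination is governed by the
    deviation of its coefficients from the Fourier coefficients. *)
Lemma ip_residual r c v : S v -> uniq r -> {in r, forall i, D i} ->
  let w := v - \sum_(i <- r) c i *: e i in
  ip w w = ip v v - \sum_(i <- r) ip v (e i) ^+ 2
           + \sum_(i <- r) (c i - ip v (e i)) ^+ 2.
Proof.
move=> Sv ur rD; set u := \sum_(i <- r) _; have Su : S u by exact: expansion_in_space Sv _.
rewrite /=; have wE : v - u = -1 *: u + v by rewrite scaleN1r addrC.
have Sw : S (v - u) by rewrite wE; exact: S_lin.
have uE w : S w -> ip u w = \sum_(i <- r) c i * ip (e i) w.
  by move=> ?; exact: (ip_expansion _ Sv).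
have uv : ip u v = \sum_(i <- r) c i * ip v (e i).
  rewrite uE// big_seq [RHS]big_seq; apply: eq_bigr => i ir.
  by rewrite (ipC _ Sv)//; exact/S_e/rD.
have uu : ip u u = \sum_(i <- r) c i ^+ 2.
  rewrite uE// big_seq [RHS]big_seq; apply: eq_bigr => i ir.
  have Se := S_e (rD _ ir); rewrite ipC// uE// (big_rem i)//= e_orthonormal ?eqxx; try exact: rD.
  rewrite mulr1 big_seq big1 ?addr0 ?expr2// => j; rewrite mem_rem_uniq// inE => /andP[ji jr].
  by rewrite e_orthonormal ?(negbTE ji) ?mulr0//; exact: rD.
have -> : ip (v - u) (v - u) = ip v v - 2 * ip u v + ip u u.
  rewrite {1}wE ip_lin// (ipC Su Sw) (ipC Sv Sw) {1 2}wE !ip_lin//.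
  by rewrite (ipC Sv Su); ring.
rewrite uv uu -addrA -[RHS]addrA; congr (_ + _).
rewrite mulr_sumr -!sumrN -!big_split/=; apply: eq_bigr => i _; ring.
Qed.

(** The distance is smallest for the Fourier coefficients, and it decreases as
    more of them are used. *)
Lemma best_approximation r r' c v : S v -> uniq r -> uniq r' -> {subset r <= r'} ->
  {in r', forall i, D i} ->
  let w := v - \sum_(i <- r') ip v (e i) *: e i in
  let w' := v - \sum_(i <- r) c i *: e i in
  ip w w <= ip w' w'.
Proof.
move=> Sv ur ur' rr' rD'.
have rD : {in r, forall i, D i} by move=> i /rr'/rD'.
rewrite /= !ip_residual//.
rewrite [X in _ + X <= _]big1 ?addr0; last by move=> i _; rewrite subrr expr0n.
apply: (@le_trans _ _ (ip v v - \sum_(i <- r) ip v (e i) ^+ 2)); last first.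
  by rewrite lerDl; apply: sumr_ge0 => i _; exact: sqr_ge0.
rewrite lerB// [leRHS](perm_big (r ++ [seq i <- r' | i \notin r])).
  by rewrite big_cat/= lerDl; apply: sumr_ge0 => i _; exact: sqr_ge0.
apply: uniq_perm => //.
  rewrite cat_uniq ur filter_uniq// andbT; apply/hasPn => i.
  by rewrite mem_filter => /andP[].
move=> i; rewrite mem_cat mem_filter; case ir: (i \in r) => //=.
by rewrite rr'.
Qed.

Lemma bessel r v : (forall v, S v -> 0 <= ip v v) -> S v -> uniq r ->
  {in r, forall i, D i} -> \sum_(i <- r) ip v (e i) ^+ 2 <= ip v v.
Proof.
move=> ip_ge0 Sv ur rD; have := ip_residual (fun i => ip v (e i)) Sv ur rD.
have z : \sum_(i <- r) (ip v (e i) - ip v (e i)) ^+ 2 = 0.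
  by apply: big1 => i _; rewrite subrr expr0n.
rewrite /= z addr0 -subr_ge0 => <-; apply: ip_ge0; rewrite addrC -scaleN1r.
by apply: S_lin => //; exact: expansion_in_space Sv _.
Qed.

Lemma finite_subset_exhaustion (L : nat -> {fset I}) (J : seq I) :
  (forall N, L N `<=` L N.+1)%fset -> \bigcup_N [set` L N] = D ->
  {in J, forall i, D i} -> exists N0, forall N, (N0 <= N)%N -> {subset J <= L N}.
Proof.
move=> Lmono LD; have mono N M : (N <= M)%N -> {subset L N <= L M}.
  move=> /subnK <-; elim: (M - N)%N => // k IH i /IH.
  by rewrite addSn; move/fsubsetP: (Lmono (k + N)%N); exact.
elim: J => [_|i J IH JD]; first by exists 0%N.
have [|N1 h1] := IH; first by move=> j jJ; apply: JD; rewrite in_cons jJ orbT.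
have : D i by apply: JD; rewrite mem_head.
rewrite -LD => -[N2 _ /= iN2]; exists (maxn N1 N2) => N; rewrite geq_max => /andP[l1 l2] j.
by rewrite in_cons => /predU1P[->|/(h1 _ l1)//]; exact: mono iN2.
Qed.

Lemma exhaustion_approx (L : nat -> {fset I}) v (eps : R) :
  complete_orthonormal_basis S ip D e ->
  (forall N, L N `<=` L N.+1)%fset -> \bigcup_N [set` L N] = D ->
  S v -> 0 < eps -> exists N0, forall N, (N0 <= N)%N ->
    let w := v - \sum_(i <- L N) ip v (e i) *: e i in ip w w < eps.
Proof.
move=> [_ _ dense] Lmono LD Sv eps0.
have s0 : 0 < Num.sqrt eps by rewrite sqrtr_gt0.
have [J [c [JD /= wlt]]] := dense v Sv _ s0.
have [|N0 hN0] := @finite_subset_exhaustion L J Lmono LD; first by move=> i; exact: JD.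
exists N0 => N N0N /=; rewrite sqr_sqrtr ?(ltW eps0)// in wlt.
apply: le_lt_trans wlt; apply: best_approximation => //.
- exact: hN0.
- by move=> i iL; rewrite -LD; exists N.
Qed.

End orthonormal_expansion.

Section sequence_basis.
Context {R : realType} {V : lmodType R} (dot : {dot V for idfun}) (e : nat -> V).
Hypothesis e_basis : complete_orthonormal_basis setT dot posnat e.

Let orth i j : posnat i -> posnat j -> dot (e i) (e j) = (i == j)%:R.
Proof. by have [_ + _] := e_basis; exact. Qed.

Let T_lin a u v : [set: V] u -> [set: V] v -> [set: V] (a *: u + v).
Proof. by []. Qed.

Let T_dotC u v : [set: V] u -> [set: V] v -> dot u v = dot v u.
Proof. by move=> _ _; exact: dotC. Qed.

Let T_dot_lin a u v w : [set: V] u -> [set: V] v -> [set: V] w ->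
  dot (a *: u + v) w = a * dot u w + dot v w.
Proof. by move=> _ _ _; exact: dot_linl. Qed.

Let T_e i : posnat i -> [set: V] (e i).
Proof. by []. Qed.

Let T_ge0 v : [set: V] v -> 0 <= dot v v.
Proof. by move=> _; exact: dot_ge0. Qed.

Let iota_pos N : {in index_iota 1 N, forall i, posnat i}.
Proof. by move=> i; rewrite mem_index_iota => /andP[]. Qed.

Lemma sequence_basis_approx v (eps : R) : 0 < eps -> exists N0, forall N, (N0 <= N)%N ->
  let w := v - \sum_(1 <= i < N) dot v (e i) *: e i in dot w w < eps.
Proof.
move=> eps0; pose L N := [fset i in index_iota 1 N]%fset.
have LE N : perm_eq (enum_fset (L N)) (index_iota 1 N).
  apply: uniq_perm => //; first exact: iota_uniq.
  by move=> i; rewrite -[_ \in _]/(i \in L N) in_fset.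
have Lmono N : (L N `<=` L N.+1)%fset.
  apply/fsubsetP => i; rewrite !in_fset !mem_index_iota => /andP[-> /=].
  by move=> /ltnW.
have LD : \bigcup_N [set` L N] = posnat.
  apply/seteqP; split => i.
    by move=> [N _ /=]; rewrite in_fset mem_index_iota => /andP[].
  by move=> i0; exists i.+1 => //=; rewrite in_fset mem_index_iota ltnSn andbT.
have [N0 h] := exhaustion_approx T_lin T_dotC T_dot_lin T_e orth e_basis Lmono LD
  (I : [set: V] v) eps0.
exists N0 => N N0N; have /= := h N N0N; rewrite !(perm_big _ (LE N)).
exact.
Qed.

(** Polarization of the convergence of the sums of squares. *)
Lemma parseval_cvg u v :
  \sum_(1 <= i < N) (dot u (e i) * dot v (e i)) @[N --> \oo] --> dot u v.
Proof.
have sq v' : \sum_(1 <= i < N) (dot v' (e i) ^+ 2) @[N --> \oo] --> dot v' v'.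
  apply/cvgrPdist_lt => eps eps0; have [N0 h] := sequence_basis_approx v' eps0.
  exists N0 => // N /= N0N; have := h N N0N.
  rewrite /= (ip_residual T_lin T_dotC T_dot_lin T_e orth)//; last exact: iota_uniq.
  have z : \sum_(1 <= i < N) (dot v' (e i) - dot v' (e i)) ^+ 2 = 0.
    by apply: big1 => i _; rewrite subrr expr0n.
  rewrite z addr0 => lt; rewrite ger0_norm// subr_ge0.
  apply: (bessel T_lin T_dotC T_dot_lin T_e orth) => //; exact: iota_uniq.
have dD x y w : dot (x + y) w = dot x w + dot y w.
  by have := dot_linl dot 1 x y w; rewrite scale1r mul1r.
have dB x y w : dot (x - y) w = dot x w - dot y w.
  by have := dot_linl dot (-1) y x w; rewrite scaleN1r mulN1r addrC => ->; rewrite addrC.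
have -> : dot u v = 4^-1 * (dot (u + v) (u + v) - dot (u - v) (u - v)).
  rewrite (dB u v) (dD u v) !(dotC _ _ (u + v)) !(dotC _ _ (u - v)) !dB !dD (dotC dot v u).
  by field.
have -> : (fun N => \sum_(1 <= i < N) (dot u (e i) * dot v (e i))) =
  (fun N => 4^-1 * (\sum_(1 <= i < N) (dot (u + v) (e i) ^+ 2) -
                    \sum_(1 <= i < N) (dot (u - v) (e i) ^+ 2))).
  apply/funext => N; rewrite -sumrB mulr_sumr; apply: eq_bigr => i _.
  by rewrite dB dD; field.
by apply: cvgMr; apply: cvgB; exact: sq.
Qed.

Lemma parseval_le v c : dot v v <= c <->
  forall N, \sum_(1 <= i < N) (dot v (e i) ^+ 2) <= c.
Proof.
split=> [vc N|vc].
  apply: le_trans vc; apply: (bessel T_lin T_dotC T_dot_lin T_e orth) => //.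
  exact: iota_uniq.
have cv := @parseval_cvg v v.
apply: (@closed_cvg _ R^o \oo _ (fun N => \sum_(1 <= i < N) (dot v (e i) * dot v (e i)))
  (fun z => z <= c)) => //.
by near=> N; under eq_bigr do rewrite -expr2; exact: vc.
Unshelve. all: by end_near. Qed.

End sequence_basis.

(** * Borel sets of a separable Hilbert space *)

Section borel_coordinates.
Context {R : realType} {X : completeNormedModType R} (dotX : {dot X for idfun}).
Hypothesis hilbertX : induces_norm dotX.
Hypothesis sepX : separable X.
Variable xi : nat -> X.
Hypothesis xi_basis : complete_orthonormal_basis setT dotX posnat xi.

(** Polarization reduces this to the continuity of the norm. *)
Lemma continuous_dot (v : X) : continuous (fun f => dotX v f : R^o).
Proof.
have dD x y w : dotX (x + y) w = dotX x w + dotX y w.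
  by have := dot_linl dotX 1 x y w; rewrite scale1r mul1r.
have dB x y w : dotX (x - y) w = dotX x w - dotX y w.
  by have := dot_linl dotX (-1) y x w; rewrite scaleN1r mulN1r addrC => ->; rewrite addrC.
have E f : dotX v f = 4^-1 * (`|v + f| ^+ 2 - `|v - f| ^+ 2).
  rewrite !hilbertX (dB v f) (dD v f) !(dotC _ _ (v + f)) !(dotC _ _ (v - f)) !dB !dD.
  by rewrite (dotC dotX f v); field.
have c2 (g : X -> X) : continuous g -> continuous (fun f => `|g f| ^+ 2 : R^o).
  move=> cg f; have cn : `|g x| @[x --> f] --> `|g f| by apply: cvg_norm; exact: cg.
  have c2 : `|g x| ^+ 2 @[x --> f] --> `|g f| ^+ 2.
    by rewrite expr2; under eq_fun do rewrite expr2; exact: cvgM.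
  exact: c2.
have -> : (fun f => dotX v f : R^o) = (fun f => 4^-1 * (`|v + f| ^+ 2 - `|v - f| ^+ 2)).
  by apply/funext => f; exact: E.
move=> f; apply: cvgMr; apply: cvgB.
  by apply: (c2 (fun f => v + f)) => g; apply: cvgD; [exact: cvg_cst|exact: cvg_id].
by apply: (c2 (fun f => v - f)) => g; apply: cvgB; [exact: cvg_cst|exact: cvg_id].
Qed.

Definition coordinate_halfspaces : set (set X) :=
  [set A | exists2 j, posnat j & exists a : R, A = [set f | a < coordinate dotX xi j f]].

Lemma open_coordinate_halfspace j (a : R) : open [set f | a < coordinate dotX xi j f].
Proof.
have := @open_comp X R^o (coordinate dotX xi j) [set z | a < z].
by apply; [move=> f _; exact: continuous_dot|exact: open_gt].
Qed.

Let G := coordinate_halfspaces.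
Let T := g_sigma_algebraType G.

Let coordinate_measurableG j : posnat j ->
  measurable_fun setT (coordinate dotX xi j : T -> R).
Proof.
move=> j0; apply: (measurability _ (RGenOInfty.measurableE R)) => //.
move=> /= _ [_ [a ->] <-]; rewrite setTI.
apply: sub_sigma_algebra; exists j => //; exists a.
by apply/seteqP; split => f /=; rewrite in_itv/= andbT.
Qed.

Let coordinateB j f g :
  dotX (f - g) (xi j) = coordinate dotX xi j f - coordinate dotX xi j g.
Proof.
rewrite /coordinate; have := dot_linl dotX (-1) g f (xi j).
rewrite scaleN1r mulN1r addrC => ->.
by rewrite (dotC dotX f) (dotC dotX g) addrC.
Qed.

Let cball (g : X) (k : nat) : set X := [set f | `|f - g| <= k.+1%:R^-1].

(** By Parseval's identity a closed ball is cut out by countably many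
    conditions on finitely many coordinates each. *)
Let measurable_cball g k : (measurable (cball g k : set T)).
Proof.
have -> : cball g k = \bigcap_N [set f |
    \sum_(1 <= j < N) (coordinate dotX xi j f - coordinate dotX xi j g) ^+ 2 <=
    (k.+1%:R^-1) ^+ 2].
  have normE f : `|f - g| ^+ 2 = dotX (f - g) (f - g) by exact: hilbertX.
  have sumE f N : \sum_(1 <= j < N) dotX (f - g) (xi j) ^+ 2 =
      \sum_(1 <= j < N) (coordinate dotX xi j f - coordinate dotX xi j g) ^+ 2.
    by apply: eq_bigr => j _; rewrite coordinateB.
  apply/seteqP; split => f.
    rewrite /cball/= => h N _ /=; rewrite -sumE; move: N; apply/(parseval_le xi_basis).
    by rewrite -normE ler_pXn2r ?nnegrE.
  move=> h; rewrite /cball/= -(@ler_pXn2r _ 2)// ?nnegrE// normE.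
  by apply/(parseval_le xi_basis) => N; rewrite sumE; exact: h N I.
apply: bigcapT_measurable => N.
have mS : measurable_fun setT (fun f : T =>
    \sum_(1 <= j < N) (coordinate dotX xi j f - coordinate dotX xi j g) ^+ 2).
  under eq_fun do rewrite big_nat_cond -big_filter.
  set r := [seq i <- index_iota 1 N | _].
  have : all (fun j => (0 < j)%N) r.
    by apply/allP => j; rewrite mem_filter => /andP[/andP[/andP[]]].
  elim: r => [_|j r IH /=]; first by under eq_fun do rewrite big_nil; exact: measurable_cst.
  move=> /andP[j0 rpos]; under eq_fun do rewrite big_cons.
  apply: measurable_funD; last exact: IH.
  by apply: measurable_funX; apply: measurable_funB => //; exact: coordinate_measurableG.
have := mS measurableT _ (measurable_itv `]-oo, (k.+1%:R^-1) ^+ 2]).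
rewrite setTI; congr (measurable _); apply/seteqP; split => f /=; by rewrite in_itv.
Qed.

(** By separability an open set is a countable union of closed balls. *)
Lemma open_coordinate_measurable : @open X `<=` <<s G >>.
Proof.
have [D /countable_injP[num num_inj] Ddense] := sepX.
pose s n := xget 0 [set g | D g /\ num g = n].
have sE g : D g -> s (num g) = g.
  move=> Dg; rewrite /s; case: xgetP => [h _ [Dh hg]|/(_ g) []//].
  by apply: num_inj; rewrite ?inE.
move=> U oU.
pose E n k := if `[< cball (s n) k `<=` U >] then cball (s n) k else set0.
have -> : U = \bigcup_n \bigcup_k E n k.
  apply/seteqP; split => f; last first.
    by move=> [n _ [k _]]; rewrite /E; case: asboolP => // + fb; exact.
  move=> Uf; have /nbhs_ballP[e /= e0 eU] : nbhs f U by exact: open_nbhs_nbhs.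
  have [k ke] : exists k, k.+1%:R^-1 < e / 2 :> R.
    have e20 : 0 < e / 2 by rewrite divr_gt0.
    have [k _ /(_ k (leqnn k)) /= h] := near_infty_natSinv_lt (PosNum e20).
    by exists k.
  have k0 : 0 < k.+1%:R^-1 :> R by rewrite invr_gt0.
  have [g [fg Dg]] : ball f (k.+1%:R^-1) `&` D !=set0.
    by apply: Ddense; [exists f; exact: ballxx|exact: ball_open].
  exists (num g) => //; exists k => //; rewrite /E sE//.
  have gU : cball g k `<=` U.
    move=> h; rewrite /cball/= => hg; apply: eU; move: fg; rewrite -!ball_normE/= => fg.
    rewrite (_ : f - h = (f - g) + (g - h)); last by rewrite addrA subrK.
    rewrite (le_lt_trans (ler_normD _ _))//; rewrite distrC in hg.
    by move: (k.+1%:R^-1) ke fg hg => z *; lra.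
  by rewrite asboolT// /cball/=; move: fg; rewrite -ball_normE/= distrC => /ltW.
have mE n k : measurable (E n k : set T).
  by rewrite /E; case: ifP => _; [exact: measurable_cball|exact: measurable0].
apply: (@bigcupT_measurable _ T) => n; apply: (@bigcupT_measurable _ T) => k.
exact: mE.
Qed.

Lemma borel_coordinate_measurable : @measurable _ (borel X) `<=` <<s G >>.
Proof.
apply: smallest_sub; first exact: smallest_sigma_algebra.
exact: open_coordinate_measurable.
Qed.

Lemma measurable_coordinate j :
  measurable_fun setT (coordinate dotX xi j : borel X -> measurableTypeR R).
Proof.
apply: (measurability _ (RGenOInfty.measurableE R)) => //.
move=> /= _ [_ [a ->] <-]; rewrite setTI.
apply: sub_sigma_algebra.
have := open_coordinate_halfspace j a.
congr open; apply/seteqP; split => f /=; by rewrite in_itv/= andbT.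
Qed.

(** The way to see that sums of Borel maps are Borel: addition is continuous on
    the product space, whose Borel sets need an argument of their own. *)
Lemma measurable_fun_coordinates d (U : measurableType d) (A : U -> X) :
  (forall j, posnat j -> measurable_fun setT (fun u => coordinate dotX xi j (A u))) ->
  measurable_fun setT (A : U -> borel X).
Proof.
move=> mA _ B /borel_coordinate_measurable mB; rewrite setTI.
pose Sg : set (set X) := [set B | measurable (A @^-1` B)].
suff /(_ B mB) : <<s G >> `<=` Sg by [].
apply: smallest_sub.
  split; rewrite /Sg/=.
  - by rewrite preimage_set0.
  - by move=> C mC; rewrite setTD preimage_setC; exact: measurableC.
  - by move=> C mC; rewrite preimage_bigcup; exact: bigcupT_measurable.
move=> _ [j j0 [a ->]]; rewrite /Sg/=.
have := mA j j0 measurableT _ (measurable_itv `]a, +oo[).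
rewrite setTI; congr (measurable _); apply/seteqP; split => f /=; by rewrite in_itv/= andbT.
Qed.

Lemma measurable_dot d (U : measurableType d) (A B : U -> X) :
  measurable_fun setT (A : U -> borel X) -> measurable_fun setT (B : U -> borel X) ->
  measurable_fun setT (fun u => dotX (A u) (B u)).
Proof.
move=> mA mB.
have mc (C : U -> X) j : measurable_fun setT (C : U -> borel X) ->
    measurable_fun setT (fun u => dotX (C u) (xi j)).
  move=> mC; under eq_fun do rewrite dotC.
  exact: (measurableT_comp (measurable_coordinate j) mC).
apply: (@measurable_fun_cvg _ _ _ _
  (fun N u => \sum_(1 <= j < N) dotX (A u) (xi j) * dotX (B u) (xi j))).
  move=> N; apply: measurable_sum => j; apply: measurable_funM; exact: mc.
by move=> u _; exact: parseval_cvg.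
Qed.

End borel_coordinates.

(** * Approximation by linear combinations *)

Section span_closure.
Context {R : realType} {V : lmodType R} {I : choiceType}.
Variables (S : set V) (ip : V -> V -> R) (D : set I) (e : I -> V).
Hypothesis S_lin : forall a u v, S u -> S v -> S (a *: u + v).
Hypothesis ipC : forall u v, S u -> S v -> ip u v = ip v u.
Hypothesis ip_lin : forall a u v w, S u -> S v -> S w ->
  ip (a *: u + v) w = a * ip u w + ip v w.
Hypothesis ip_ge0 : forall v, S v -> 0 <= ip v v.
Hypothesis S_e : forall i, D i -> S (e i).

(** Linear combinations are lists of weighted indices, possibly with
    repetitions, so that sums of combinations are concatenations. *)
Definition combination (s : seq (R * I)) : V := \sum_(z <- s) z.1 *: e z.2.

Definition span : set V :=
  [set v | exists2 s, {in s, forall z, D z.2} & v = combination s].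

(** Grouping repeated indices turns a list of weighted indices into a finite set
    with coefficients. *)
Lemma combination_collect s : {in s, forall z, D z.2} ->
  exists (J : {fset I}) (c : I -> R), [set` J] `<=` D /\
    combination s = \sum_(i <- J) c i *: e i.
Proof.
move=> sD; suff [r [c [ur rD sE]]] : exists r (c : I -> R),
    [/\ uniq r, {in r, forall i, D i} & combination s = \sum_(i <- r) c i *: e i].
  exists [fset i in r]%fset, c; split; first by move=> i /=; rewrite in_fset => /rD.
  rewrite sE; apply: perm_big; apply: uniq_perm => // i.
  by rewrite -[_ \in enum_fset _]/(i \in [fset i in r]%fset) in_fset.
elim: s sD => [_|[x i] s IH sD].
  by exists [::], (fun=> 0); split => //; rewrite /combination !big_nil.
have [|r [c [ur rD sE]]] := IH; first by move=> z zs; apply: sD; rewrite in_cons zs orbT.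
have Di : D i by apply: (sD (x, i)); rewrite mem_head.
rewrite /combination big_cons -/(combination s) sE /=.
have [ir|ir] := boolP (i \in r).
  exists r, (fun j => if j == i then x + c j else c j); split => //.
  rewrite !(big_rem i ir)/= eqxx addrA scalerDl; congr (_ + _).
  apply: eq_big_seq => j; rewrite mem_rem_uniq// inE => /andP[ji _].
  by rewrite (negbTE ji).
exists (i :: r), (fun j => if j == i then x else c j); split => /=.
- by rewrite ir.
- by move=> j; rewrite in_cons => /predU1P[->//|]; exact: rD.
- rewrite big_cons eqxx; congr (_ + _); apply: eq_big_seq => j jr.
  by case: eqP => // ji; move: ir; rewrite -ji jr.
Qed.

Let S_span v w : S v -> span w -> S w.
Proof.
move=> Sv [s sD ->]; elim: s sD => [_|z s IH sD].
  have := S_lin (-1) Sv Sv; rewrite scaleN1r addNr.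
  by rewrite /combination big_nil.
rewrite /combination big_cons; apply: S_lin.
  by apply/S_e/sD; rewrite mem_head.
by apply: IH => y ys; apply: sD; rewrite in_cons ys orbT.
Qed.

Let SB u v : S u -> S v -> S (u - v).
Proof. by move=> Su Sv; rewrite addrC -scaleN1r; exact: S_lin. Qed.

Let SD u v : S u -> S v -> S (u + v).
Proof. by move=> Su Sv; rewrite -[u]scale1r; exact: S_lin. Qed.

Lemma ip_add_le u v : S u -> S v -> ip (u + v) (u + v) <= 2 * ip u u + 2 * ip v v.
Proof.
move=> Su Sv; have Sp := SD Su Sv; have Sm := SB Su Sv.
have := ip_ge0 Sm.
have mE : u - v = -1 *: v + u by rewrite scaleN1r addrC.
have pE : u + v = 1 *: u + v by rewrite scale1r.
rewrite {1}mE ip_lin// (ipC Sv Sm) (ipC Su Sm) mE !ip_lin//.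
rewrite {1}pE ip_lin// (ipC Sv Sp) (ipC Su Sp) pE !ip_lin//.
by rewrite (ipC Sv Su); lra.
Qed.

Definition approximable : set V := [set v | S v /\
  forall eps : R, 0 < eps -> exists2 w, span w & ip (v - w) (v - w) < eps].

Lemma approximableD u v : approximable u -> approximable v -> approximable (u + v).
Proof.
move=> [Su uP] [Sv vP]; split; first exact: SD.
move=> eps eps0; have e4 : 0 < eps / 4 by rewrite divr_gt0.
have [w [s sD wE] uw] := uP _ e4; have [w' [s' s'D w'E] vw] := vP _ e4.
exists (w + w').
  exists (s ++ s'); last by rewrite wE w'E /combination big_cat.
  by move=> z; rewrite mem_cat => /orP[/sD|/s'D].
have Sw : S w by apply: (S_span Su); exists s.
have Sw' : S w' by apply: (S_span Su); exists s'.
rewrite opprD addrACA; apply: le_lt_trans (ip_add_le (SB Su Sw) (SB Sv Sw')) _.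
by lra.
Qed.

Lemma approximable0 v : S v -> approximable 0.
Proof.
move=> Sv; have S0 : S 0 by have := SB Sv Sv; rewrite subrr.
split => // eps eps0; exists 0; first by exists [::] => //; rewrite /combination big_nil.
have := ip_lin (-1) Sv Sv S0; rewrite scaleN1r addNr subrr => ->.
by rewrite mulN1r addNr.
Qed.

Lemma approximable_limit v : S v ->
  (forall eps : R, 0 < eps -> exists2 w, approximable w & ip (v - w) (v - w) < eps) ->
  approximable v.
Proof.
move=> Sv vP; split => // eps eps0; have e4 : 0 < eps / 4 by rewrite divr_gt0.
have [w [Sw wP] vw] := vP _ e4; have [w' sw' ww'] := wP _ e4; exists w' => //.
have Sw' := S_span Sv sw'.
have -> : v - w' = (v - w) + (w - w') by rewrite addrA subrK.
by apply: le_lt_trans (ip_add_le (SB Sv Sw) (SB Sw Sw')) _; lra.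
Qed.

End span_closure.

(** * Square-integrable maps into a Hilbert space *)

Section bochner_space.
Context {R : realType} {X Y : completeNormedModType R} (dotY : {dot Y for idfun}).
Hypothesis hilbertY : induces_norm dotY.
Hypothesis sepY : separable Y.
Variable psi : nat -> Y.
Hypothesis psi_basis : complete_orthonormal_basis setT dotY posnat psi.
Variable rho : probability (borel X) R.
Implicit Types A B : X -> Y.

Local Notation S := (@bochner_L2 R X Y rho).
Local Notation ip := (bochner_L2_inner rho dotY).

Let mdot A B : measurable_fun setT (A : borel X -> borel Y) ->
  measurable_fun setT (B : borel X -> borel Y) ->
  measurable_fun setT (fun f : borel X => dotY (A f) (B f)).
Proof. exact: (measurable_dot hilbertY psi_basis). Qed.

Let msq A : measurable_fun setT (A : borel X -> borel Y) ->
  measurable_fun setT (fun f : borel X => (`|A f| ^+ 2)%:E).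
Proof.
move=> mA; under eq_fun do rewrite hilbertY.
by apply/measurable_EFinP; exact: mdot.
Qed.

Let mlin a A B : measurable_fun setT (A : borel X -> borel Y) ->
  measurable_fun setT (B : borel X -> borel Y) ->
  measurable_fun setT (a *: A + B : borel X -> borel Y).
Proof.
move=> mA mB; apply: (measurable_fun_coordinates hilbertY sepY psi_basis) => j j0.
have mc C : measurable_fun setT (C : borel X -> borel Y) ->
    measurable_fun setT (fun f : borel X => coordinate dotY psi j (C f)).
  by move=> mC; exact: (measurableT_comp (measurable_coordinate hilbertY psi j) mC).
have -> : (fun u : borel X => coordinate dotY psi j ((a *: A + B) u)) =
    (fun u => a * coordinate dotY psi j (A u) + coordinate dotY psi j (B u)).
  apply/funext => u; rewrite /coordinate.
  change (dotY (psi j) (a *: A u + B u) = a * dotY (psi j) (A u) + dotY (psi j) (B u)).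
  by rewrite dotC dot_linl !(dotC _ _ (psi j)).
apply: measurable_funD; last exact: mc.
by apply: measurable_funM; [exact: measurable_cst|exact: mc].
Qed.

Lemma bochner_L2_lin a A B : S A -> S B -> S (a *: A + B).
Proof.
move=> [mA fA] [mB fB]; split; first exact: mlin.
have le f : `|(a *: A + B) f| ^+ 2 <= 2 * a ^+ 2 * `|A f| ^+ 2 + 2 * `|B f| ^+ 2.
  change (`|a *: A f + B f| ^+ 2 <= 2 * a ^+ 2 * `|A f| ^+ 2 + 2 * `|B f| ^+ 2).
  apply: (@le_trans _ _ ((`|a| * `|A f| + `|B f|) ^+ 2)).
    by rewrite ler_pXn2r ?nnegrE ?addr_ge0 ?mulr_ge0// -normrZ ler_normD.
  rewrite -[a ^+ 2]real_normK ?num_real//.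
  by have := sqr_ge0 (`|a| * `|A f| - `|B f|); nra.
apply: (@le_lt_trans _ _ (\int[rho]_(f in setT)
    ((2 * a ^+ 2)%:E * (`|A f| ^+ 2)%:E + 2%:E * (`|B f| ^+ 2)%:E))%E).
  apply: ge0_le_integral => //.
  - apply: msq; exact: mlin.
  - by apply: emeasurable_funD; apply: emeasurable_funM;
      by [exact: measurable_cst|exact: msq].
  - by move=> f _; rewrite -!EFinM -EFinD lee_fin; exact: le.
have a0 : 0 <= 2 * a ^+ 2 by rewrite mulr_ge0// sqr_ge0.
rewrite ge0_integralD//.
- rewrite !ge0_integralZl_EFin//; try exact: msq.
  by rewrite lte_add_pinfty// lte_mul_pinfty// lee_fin.
- by move=> f _; rewrite mule_ge0// lee_fin// sqr_ge0.
- by apply: emeasurable_funM; [exact: measurable_cst|exact: msq].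
- by apply: emeasurable_funM; [exact: measurable_cst|exact: msq].
Qed.

Let sq_integrable A : S A -> rho.-integrable setT (EFin \o (fun f : borel X => `|A f| ^+ 2)).
Proof.
move=> [mA fA]; apply/integrableP; split; first exact: msq.
by under eq_integral do rewrite gee0_abs ?lee_fin ?sqr_ge0//.
Qed.

Lemma bochner_inner_integrable A B : S A -> S B ->
  rho.-integrable setT (EFin \o (fun f : borel X => dotY (A f) (B f))).
Proof.
move=> SA SB; have [mA fA] := SA; have [mB fB] := SB.
apply: (@le_integrable _ _ _ rho setT measurableT _
    (EFin \o (fun f : borel X => `|A f| ^+ 2 + `|B f| ^+ 2))).
- by apply/measurable_EFinP; exact: mdot.
- move=> f _ /=; rewrite lee_fin [leRHS]ger0_norm ?addr_ge0 ?sqr_ge0// !hilbertY.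
  have p := dot_ge0 dotY (A f + B f); have m := dot_ge0 dotY (A f - B f).
  have dD x y w : dotY (x + y) w = dotY x w + dotY y w.
    by have := dot_linl dotY 1 x y w; rewrite scale1r mul1r.
  have dB x y w : dotY (x - y) w = dotY x w - dotY y w.
    by have := dot_linl dotY (-1) y x w; rewrite scaleN1r mulN1r addrC => ->; rewrite addrC.
  rewrite (dD (A f) (B f)) !(dotC _ _ (A f + B f)) !dD (dotC dotY (B f)) in p.
  rewrite (dB (A f) (B f)) !(dotC _ _ (A f - B f)) !dB (dotC dotY (B f) (A f)) in m.
  have := dot_ge0 dotY (A f); have := dot_ge0 dotY (B f).
  by rewrite ler_norml; lra.
- by apply: (integrableD measurableT (sq_integrable SA) (sq_integrable SB)).
Qed.

Lemma bochner_innerC A B : ip A B = ip B A.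
Proof. by rewrite /bochner_L2_inner; under eq_fun do rewrite dotC. Qed.

Lemma bochner_inner_lin a A B C : S A -> S B -> S C ->
  ip (a *: A + B) C = a * ip A C + ip B C.
Proof.
move=> SA SB SC; rewrite /bochner_L2_inner.
have iA := bochner_inner_integrable SA SC; have iB := bochner_inner_integrable SB SC.
rewrite -RintegralZl// -RintegralD//.
  by congr Rintegral; apply/funext => f; rewrite -dot_linl.
by apply: (integrableZl measurableT a iA).
Qed.

Lemma bochner_inner_ge0 A : 0 <= ip A A.
Proof. by apply: Rintegral_ge0 => f _; exact: dot_ge0. Qed.

Lemma bochner_normE A : S A ->
  (\int[rho]_(f in setT) (`|A f| ^+ 2)%:E = (ip A A)%:E)%E.
Proof.
move=> SA; rewrite /bochner_L2_inner /Rintegral fineK; last first.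
  exact: (integrable_fin_num measurableT (bochner_inner_integrable SA SA)).
by apply: eq_integral => f _; rewrite hilbertY.
Qed.

Lemma measurable_normY : measurable_fun setT (fun y : borel Y => `|y| : measurableTypeR R).
Proof.
apply: (measurability _ (RGenOInfty.measurableE R)) => //.
move=> /= _ [_ [a ->] <-]; rewrite setTI; apply: sub_sigma_algebra.
have := @open_comp Y R^o (fun y => `|y|) [set z | a < z] _ (@open_gt R a).
have cn y : {for y, continuous (fun y : Y => `|y| : R^o)} by exact: norm_continuous.
move=> /(_ (fun y _ => cn y)).
congr open; apply/seteqP; split => f /=; by rewrite in_itv/= andbT.
Qed.

Lemma measurable_scale (u : borel X -> R) (y : Y) : measurable_fun setT u ->
  measurable_fun setT (fun f => u f *: y : borel Y).
Proof.
move=> mfu; apply: (measurable_fun_coordinates hilbertY sepY psi_basis) => j j0.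
rewrite /coordinate; under eq_fun do rewrite linearZr_LR/=.
by apply: measurable_funM => //; exact: measurable_cst.
Qed.

Lemma scale_basis_norm k (c : R) : posnat k -> `|c *: psi k| ^+ 2 = c ^+ 2.
Proof.
move=> k0; have [_ /(_ k k k0 k0) + _] := psi_basis; rewrite eqxx => psi1.
by rewrite normrZ exprMn hilbertY psi1 mulr1 real_normK ?num_real.
Qed.

Lemma bochner_L2_scale (u : X -> R) k : posnat k ->
  measurable_fun setT (u : borel X -> R) -> (sqnorm rho u < +oo)%E ->
  S (fun f => u f *: psi k).
Proof.
move=> k0 mfu ufin; split; first exact: measurable_scale.
by under eq_integral do rewrite scale_basis_norm//.
Qed.

Lemma bochner_norm_scale (u : X -> R) k : posnat k ->
  measurable_fun setT (u : borel X -> R) -> (sqnorm rho u < +oo)%E ->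
  ((ip (fun f => u f *: psi k) (fun f => u f *: psi k))%:E = sqnorm rho u)%E.
Proof.
move=> k0 mfu ufin; rewrite -bochner_normE; last exact: bochner_L2_scale.
by under eq_integral do rewrite scale_basis_norm//.
Qed.

Lemma bochner_coordinate A k : S A -> posnat k ->
  measurable_fun setT (fun f : borel X => dotY (A f) (psi k)) /\
  (sqnorm rho (fun f => dotY (A f) (psi k)) < +oo)%E.
Proof.
move=> [mA fA] k0.
have mc : measurable_fun setT (fun f : borel X => dotY (A f) (psi k)).
  under eq_fun do rewrite dotC.
  exact: (measurableT_comp (measurable_coordinate hilbertY psi k) mA).
split => //; apply: le_lt_trans fA.
apply: (@le_sqnorm _ _ _ rho _ (fun f => `|A f|)) => //.
  exact: (measurableT_comp measurable_normY mA).
move=> f; rewrite normr_id -(@ler_pXn2r _ 2)// ?nnegrE// real_normK ?num_real// hilbertY.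
have := @bessel _ _ _ setT dotY posnat psi; move=> /(_ _ _ _ _ _ [:: k] (A f)).
rewrite big_seq1; apply => //.
- by move=> u v _ _; exact: dotC.
- by move=> a u v w _ _ _; exact: dot_linl.
- by have [_ + _] := psi_basis; exact.
- by move=> u _; exact: dot_ge0.
- by move=> i; rewrite inE => /eqP ->.
Qed.

(** The truncations of a square-integrable map to finitely many coordinates
    of Y converge in mean square, by dominated convergence. *)
Lemma truncation_approx A (eps : R) : S A -> 0 < eps -> exists n,
  let B : X -> Y := fun f => \sum_(1 <= k < n) dotY (A f) (psi k) *: psi k in
  (sqnorm rho (fun f => `|A f - B f|)%R < eps%:E)%E.
Proof.
move=> [mA fA] eps0.
have orth i j : posnat i -> posnat j -> dotY (psi i) (psi j) = (i == j)%:R.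
  by have [_ + _] := psi_basis; exact.
pose B n : X -> Y := fun f => \sum_(1 <= k < n) dotY (A f) (psi k) *: psi k.
have mc j : measurable_fun setT (fun f : borel X => dotY (A f) (psi j)).
  under eq_fun do rewrite dotC.
  exact: (measurableT_comp (measurable_coordinate hilbertY psi j) mA).
have mAB n : measurable_fun setT (fun f : borel X => A f - B n f : borel Y).
  elim: n => [|n IH].
    by under eq_fun do rewrite /B big_geq// subr0.
  have [->|n0] := eqVneq n 0%N.
    by under eq_fun do rewrite /B big_geq// subr0.
  have := mlin (-1) (measurable_scale (psi n) (mc n)) IH.
  congr (measurable_fun _ _); apply/funext => f.
  change (-1 *: (dotY (A f) (psi n) *: psi n) + (A f - B n f) = A f - B n.+1 f).
  by rewrite scaleN1r /B big_nat_recr ?lt0n//= opprD addrCA [- (_ *: _) + _]addrC.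
have nE n f : `|A f - B n f| ^+ 2 =
    dotY (A f) (A f) - \sum_(1 <= k < n) dotY (A f) (psi k) ^+ 2.
  rewrite hilbertY (@ip_residual _ _ _ setT dotY posnat psi) //.
  - rewrite [X in _ + X]big1 ?addr0// => i _; by rewrite subrr expr0n.
  - by move=> u v _ _; exact: dotC.
  - by move=> a u v w _ _ _; exact: dot_linl.
  - exact: iota_uniq.
  - by move=> i; rewrite mem_index_iota => /andP[].
apply: (@sqnorm_dominated _ _ _ rho (fun n f => `|A f - B n f|) (fun f => `|A f|)) => //.
- by move=> n; exact: (measurableT_comp measurable_normY (mAB n)).
- exact: (measurableT_comp measurable_normY mA).
- move=> n f; rewrite !normr_id -(@ler_pXn2r _ 2)// ?nnegrE// nE hilbertY.
  by rewrite gerBl; apply: sumr_ge0 => k _; exact: sqr_ge0.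
- move=> f; apply/cvgrPdist_lt => e e0.
  have e20 : 0 < e ^+ 2 by rewrite exprn_gt0.
  have [N0 h] := sequence_basis_approx psi_basis (A f) e20.
  exists N0 => // n /= /h; rewrite /= -hilbertY sub0r normrN normr_id.
  by rewrite ltr_pXn2r// ?nnegrE// ltW.
Qed.

End bochner_space.

(** * Products of orthonormal polynomials *)

(** A bounded nondecreasing sequence of naturals is constant from the index on
    at which it reaches its maximum. *)
Lemma multi_indexP (a : nat -> nat) : multi_index a <->
  (0 < a 0)%N /\ exists N, forall j, (N <= j)%N -> a j = 0%N.
Proof.
split => [[a0 [M aM]]|[a0 [N aN]]]; split => //.
  pose P k := `[< exists N, (0 < N)%N /\ k = (\sum_(1 <= j < N) a j)%N >].
  have exP : exists k, P k.
    by exists 0%N; apply/asboolP; exists 1%N; rewrite big_geq.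
  have ubP k : P k -> (k <= M)%N by move=> /asboolP[N [_ ->]].
  case: (ex_maxnP exP ubP) => k /asboolP[N [N0 ->]] kmax.
  exists N => j Nj; have /kmax : P (\sum_(1 <= i < j.+1) a i)%N.
    by apply/asboolP; exists j.+1.
  rewrite big_nat_recr/=; last exact: leq_trans N0 Nj.
  by rewrite (big_cat_nat N0 Nj)/= -addnA -[leqRHS]addn0 leq_add2l leqn0 addn_eq0 => /andP[_ /eqP].
exists (\sum_(1 <= j < N) a j)%N => n.
have [nN|Nn] := leqP n N.
  have [n0|n0] := leqP 1 n; last by rewrite big_geq// ltnW.
  by rewrite (big_cat_nat n0 nN)/= leq_addr.
have [N0|N0] := leqP 1 N.
  have z : (\sum_(N <= i < n) a i = 0)%N.
    by rewrite big_nat_cond big1// => i; rewrite andbT => /andP[/aN].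
  by rewrite (big_cat_nat N0 (ltnW Nn))/= z addn0.
by rewrite big_nat_cond big1// => i /andP[/andP[i1 _] _]; apply: aN; lia.
Qed.

Section product_polynomials.
Context {R : realType} {X : completeNormedModType R} (dotX : {dot X for idfun}).
Hypothesis hilbertX : induces_norm dotX.
Hypothesis sepX : separable X.
Variable xi : nat -> X.
Hypothesis xi_basis : complete_orthonormal_basis setT dotX posnat xi.
Variable rho : probability (borel X) R.
Variable rho_ : nat -> probability (measurableTypeR R) R.
Hypothesis rho_product : product_measure_on dotX xi rho rho_.
Hypothesis rho_moments : forall j, posnat j -> finite_moments (rho_ j).
Hypothesis rho_determinate : forall j, posnat j -> moment_determinate (rho_ j).
Variable p : nat -> nat -> {poly R}.
Hypothesis p_orthonormal : forall j, posnat j -> orthonormal_polynomials (rho_ j) (p j).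
Implicit Types (a b : nat -> nat).

Local Notation crd := (coordinate dotX xi).

Definition scalar_product_polynomial a (f : X) : R :=
  \big[*%R/1]_(j \in posnat) (p j (a j)).[crd j f].

Local Notation Phi := scalar_product_polynomial.

Lemma orthonormal_poly0 j : posnat j -> p j 0 = 1.
Proof.
move=> j0; have [sz lc orth] := p_orthonormal j0.
have /size_poly1P[c c0 pE] : size (p j 0%N) == 1%N by rewrite sz.
have := orth 0%N 0%N; rewrite eqxx pE.
under eq_integral do rewrite hornerC.
have -> : (\int[rho_ j]_(x in setT) (c * c)%:E = (c * c)%:E)%E.
  rewrite integral_cst//; transitivity ((c * c)%:E * 1)%E; last by rewrite mule1.
  by congr (_ * _)%E; exact: probability_setT.
move=> -[] cc.
have := lc 0%N; rewrite pE lead_coefC => cp.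
by congr (_%:P); nra.
Qed.

Lemma scalar_product_polynomialE a N f : (forall j, (N <= j)%N -> a j = 0%N) ->
  Phi a f = \prod_(1 <= j < N) (p j (a j)).[crd j f].
Proof.
move=> aN; rewrite /Phi (_ : \prod_(1 <= j < N) _ =
    \big[*%R/1]_(j \in [set` index_iota 1 N]) (p j (a j)).[crd j f]); last first.
  by rewrite fsbig_seq// iota_uniq.
apply/esym/fsbig_widen => [j /=|j [/= j0 jN]].
  by rewrite mem_index_iota => /andP[].
rewrite aN ?orthonormal_poly0 ?hornerC//.
by move: jN; rewrite mem_index_iota => /negP; rewrite negb_and -!leqNgt leqNgt j0.
Qed.

Let rho_indep : mutually_independent rho posnat crd := rho_product.1.
Let rho_law := rho_product.2.

Let mcrd j : measurable_fun setT (crd j : borel X -> measurableTypeR R).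
Proof. exact: measurable_coordinate. Qed.

Let iota_pos N : {in index_iota 1 N, forall i, posnat i}.
Proof. by move=> i; rewrite mem_index_iota => /andP[]. Qed.

Let products (N : nat) (g : nat -> measurableTypeR R -> R) :
  {in index_iota 1 N, forall i, (rho_ i).-integrable setT (EFin \o g i)} ->
  rho.-integrable setT (EFin \o (fun f : borel X => \prod_(1 <= i < N) g i (crd i f))) /\
  Rintegral rho setT (fun f : borel X => \prod_(1 <= i < N) g i (crd i f)) =
    \prod_(1 <= i < N) Rintegral (rho_ i) setT (g i).
Proof.
move=> gi; apply: (independent_products mcrd rho_indep rho_law) => //.
exact: iota_uniq.
Qed.

Let poly2_integrable i (q r : {poly R}) : posnat i ->
  (rho_ i).-integrable setT (EFin \o (fun t => q.[t] * r.[t])).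
Proof.
move=> i0; have := integrable_poly (rho_moments i0) (q * r).
by congr (_.-integrable _ _); apply/funext => t /=; rewrite hornerM.
Qed.

Let orth_Rintegral i n k : posnat i ->
  Rintegral (rho_ i) setT (fun t => (p i n).[t] * (p i k).[t]) = (n == k)%:R.
Proof. by move=> i0; have [_ _ /(_ n k)] := p_orthonormal i0; rewrite /Rintegral => ->. Qed.

Lemma scalar_orthonormal a b : multi_index a -> multi_index b ->
  rho.-integrable setT (EFin \o (fun f : borel X => Phi a f * Phi b f)) /\
  Rintegral rho setT (fun f : borel X => Phi a f * Phi b f) =
    `[< forall j, (0 < j)%N -> a j = b j >]%:R.
Proof.
move=> /multi_indexP[_ [N aN]] /multi_indexP[_ [M bM]].
pose K := maxn 1 (maxn N M).
have aK j : (K <= j)%N -> a j = 0%N by move=> Kj; apply: aN; lia.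
have bK j : (K <= j)%N -> b j = 0%N by move=> Kj; apply: bM; lia.
have [|fi fE] := @products K (fun i t => (p i (a i)).[t] * (p i (b i)).[t]).
  by move=> i /iota_pos i0; exact: poly2_integrable.
have E : (fun f : borel X => Phi a f * Phi b f) =
    (fun f => \prod_(1 <= i < K) ((p i (a i)).[crd i f] * (p i (b i)).[crd i f])).
  apply/funext => f; rewrite (scalar_product_polynomialE f aK) (scalar_product_polynomialE f bK).
  by rewrite big_split.
rewrite E; split => //; rewrite fE big_seq.
under eq_bigr => i /iota_pos i0 do rewrite (orth_Rintegral _ _ i0).
rewrite -big_seq; case: asboolP => ab.
  rewrite big_seq big1// => i /iota_pos i0; by rewrite ab// eqxx.
have [i [i0 /eqP abi]] : exists i, (0 < i)%N /\ a i <> b i.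
  apply: contrapT => h; apply: ab => j j0; apply: contrapT => n; apply: h.
  by exists j.
have iK : (i < K)%N by rewrite ltnNge; apply/negP => Ki; move: abi; rewrite aK// bK// eqxx.
have iin : i \in index_iota 1 K by rewrite mem_index_iota i0.
by rewrite (big_rem i iin)/= (negbTE abi) mul0r.
Qed.

(** The multi-index whose scalar product polynomial is the constant 1. *)
Let e0 : nat -> nat := fun j => (j == 0)%N.

Let e0_multi : multi_index e0.
Proof. by apply/multi_indexP; split => //; exists 1%N; case. Qed.

Lemma measurable_scalar a : multi_index a -> measurable_fun setT (Phi a : borel X -> R).
Proof.
move=> /multi_indexP[_ [N aN]].
have -> : Phi a = (fun f => \prod_(1 <= i < N) (p i (a i)).[crd i f]).
  by apply/funext => f; exact: scalar_product_polynomialE.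
have mp : {in index_iota 1 N, forall i,
    measurable_fun setT (horner (p i (a i)) : measurableTypeR R -> R)}.
  by move=> i _; exact: measurable_poly.
exact: (measurable_prod_comp mcrd mp).
Qed.

Lemma scalar_sqnorm a : multi_index a -> (sqnorm rho (Phi a) = 1)%E.
Proof.
move=> ma; have [ai aE] := scalar_orthonormal ma ma.
rewrite /sqnorm; under eq_integral do rewrite expr2.
rewrite -[LHS]fineK; last exact: (integrable_fin_num measurableT ai).
by rewrite -/(Rintegral _ _ _) aE asboolT.
Qed.

Definition scalar_combinations : set (X -> R) := [set h : X -> R |
  exists2 s : seq (R * (nat -> nat)), {in s, forall z, multi_index z.2} &
    h = fun f => \sum_(z <- s) z.1 * Phi z.2 f].

Local Notation H := scalar_combinations.
Local Notation cl := (l2_closure rho (H : set (borel X -> R))).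

Let H_ind (Q : (X -> R) -> Prop) : Q (cst 0) ->
  (forall c a h, multi_index a -> H h -> Q h -> Q (fun f => c * Phi a f + h f)) ->
  forall h, H h -> Q h.
Proof.
move=> Q0 QS h [s sm ->]; elim: s sm => [_|z s IH sm].
  by under eq_fun do rewrite big_nil.
under eq_fun do rewrite big_cons.
have sm' : {in s, forall z, multi_index z.2}.
  by move=> y ys; apply: sm; rewrite in_cons ys orbT.
by apply: QS; [apply: sm; rewrite mem_head|exists s|exact: IH].
Qed.

Let H_scalar a : multi_index a -> H (Phi a).
Proof.
move=> ma; exists [:: (1, a)]; first by move=> z; rewrite inE => /eqP ->.
by apply/funext => f; rewrite big_seq1 mul1r.
Qed.

Let H_lin c h k : H h -> H k -> H (fun f => c * h f + k f).
Proof.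
move=> [s sm ->] [r rm ->]; exists ([seq (c * z.1, z.2) | z <- s] ++ r).
  move=> z; rewrite mem_cat => /orP[/mapP[y ys ->]/=|]; [exact: sm|exact: rm].
apply/funext => f; rewrite big_cat/= big_map mulr_sumr.
by congr (_ + _); apply: eq_bigr => z _; rewrite mulrA.
Qed.

Lemma measurable_scalar_combination h : H h -> measurable_fun setT (h : borel X -> R).
Proof.
move: h; apply: H_ind; first exact: measurable_cst.
move=> c a h ma _ mh; apply: measurable_funD => //; apply: measurable_funM => //.
exact: measurable_scalar.
Qed.

Let H_measurable := measurable_scalar_combination.

Let H_fin h : H h -> (sqnorm rho h < +oo)%E.
Proof.
move: h; apply: H_ind.
  rewrite /sqnorm integral0_eq ?ltry// => f _; by rewrite /cst expr0n.
move=> c a h ma Hh hfin; have ms := measurable_scalar ma.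
have mcs : measurable_fun setT (fun f : borel X => c * Phi a f).
  by apply: measurable_funM => //; exact: measurable_cst.
apply: le_lt_trans (sqnormD rho mcs (H_measurable Hh)) _.
rewrite sqnormZ// scalar_sqnorm// mule1.
apply: lte_add_pinfty; first by rewrite -EFinM ltry.
by apply: lte_mul_pinfty => //; rewrite lee_fin.
Qed.

Let H1 : H (cst 1).
Proof.
have := H_scalar e0_multi; congr H; apply/funext => f.
by rewrite (@scalar_product_polynomialE _ 1%N) ?big_geq//; case.
Qed.

Let upd a j k : nat -> nat := fun i => if i == j then k else a i.

Let upd_multi a j k : posnat j -> multi_index a -> multi_index (upd a j k).
Proof.
move=> j0 /multi_indexP[a0 [N aN]]; apply/multi_indexP; split.
  by rewrite /upd; case: eqP => // j0'; move: j0; rewrite -j0'.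
exists (maxn N j.+1) => i iN; rewrite /upd; case: eqP => [ij|_]; last by apply: aN; lia.
by lia.
Qed.

Section one_coordinate.
Variables (a : nat -> nat) (j : nat).
Hypotheses (ma : multi_index a) (j0 : posnat j).

Let rest (N : nat) (f : X) := \prod_(i <- rem j (index_iota 1 N)) (p i (a i)).[crd i f].

Let factor N k f : (j < N)%N -> (forall i, (N <= i)%N -> a i = 0%N) ->
  Phi (upd a j k) f = (p j k).[crd j f] * rest N f.
Proof.
move=> jN aN; rewrite (@scalar_product_polynomialE _ N); last first.
  by move=> i Ni; rewrite /upd; case: eqP => [ij|_]; [lia|exact: aN].
have jin : j \in index_iota 1 N by rewrite mem_index_iota jN andbT.
rewrite (big_rem j jin)/= {1}/upd eqxx; congr (_ * _).
apply: eq_big_seq => i; rewrite mem_rem_uniq ?iota_uniq// inE => /andP[ij _].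
by rewrite /upd (negbTE ij).
Qed.

Let sqnorm_factor N (h : measurableTypeR R -> R) : (j < N)%N ->
  (rho_ j).-integrable setT (EFin \o (fun t => h t ^+ 2)) ->
  (sqnorm rho (fun f : borel X => h (crd j f) * rest N f)%R = sqnorm (rho_ j) h)%E.
Proof.
move=> jN hi.
pose g i (t : measurableTypeR R) := if i == j then h t ^+ 2 else (p i (a i)).[t] * (p i (a i)).[t].
have jin : j \in index_iota 1 N by rewrite mem_index_iota jN andbT.
have [|gi gE] := @products N g.
  move=> i /iota_pos i0; rewrite /g; case: (eqVneq i j) => [->//|_].
  exact: poly2_integrable.
have E f : (h (crd j f) * rest N f) ^+ 2 = \prod_(1 <= i < N) g i (crd i f).
  rewrite (big_rem j jin)/= {1}/g eqxx exprMn; congr (_ * _).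
  rewrite expr2 -big_split/=; apply: eq_big_seq => i.
  by rewrite mem_rem_uniq ?iota_uniq// inE => /andP[ij _]; rewrite /g (negbTE ij).
rewrite /sqnorm; under eq_integral do rewrite E.
rewrite -[LHS]fineK; last exact: (integrable_fin_num measurableT gi).
rewrite -/(Rintegral _ _ _) gE (big_rem j jin)/= {1}/g eqxx.
rewrite [X in _ * X]big_seq [X in _ * X]big1 ?mulr1.
  by rewrite /Rintegral fineK//; exact: (integrable_fin_num measurableT hi).
move=> i ir; have i0 : posnat i by apply: (@iota_pos N); exact: (mem_rem ir).
move: ir; rewrite mem_rem_uniq ?iota_uniq// inE => /andP[ij _].
by rewrite /g (negbTE ij) orth_Rintegral// eqxx.
Qed.

(** Subtracting a multiple of the orthonormal polynomial of the same degree
    lowers the degree. *)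
Let poly_span (q : {poly R}) : exists n (c : nat -> R), q = \sum_(k < n) c k *: p j k.
Proof.
have [sz lc _] := p_orthonormal j0.
have [n] := ubnP (size q); elim: n q => // n IH q; rewrite ltnS => sq.
have [q0|q0] := eqVneq q 0; first by exists 0%N, (fun=> 0); rewrite big_ord0.
pose m := (size q).-1; have mE : size q = m.+1 by rewrite prednK// size_poly_gt0.
pose c0 := lead_coef q / lead_coef (p j m).
have lm : lead_coef (p j m) != 0 by rewrite gt_eqF.
have [|n' [c qE]] := IH (q - c0 *: p j m).
  apply: leq_trans sq; rewrite mE ltnS; apply/leq_sizeP => i mi.
  rewrite coefB coefZ; have [->|im] := eqVneq i m.
    have -> : (p j m)`_m = lead_coef (p j m) by rewrite lead_coefE sz.
    have -> : q`_m = lead_coef q by rewrite lead_coefE.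
    by rewrite /c0 divfK// subrr.
  have lt : (m < i)%N by rewrite ltn_neqAle eq_sym im.
  by rewrite !nth_default ?sz ?mE// mulr0 subrr.
exists (maxn n' m.+1), (fun k => (if (k < n')%N then c k else 0) + (if k == m then c0 else 0)).
have -> : q = \sum_(k < n') c k *: p j k + c0 *: p j m by rewrite -qE subrK.
under [RHS]eq_bigr do rewrite scalerDl.
rewrite big_split/=; congr (_ + _).
  rewrite (big_ord_widen_cond _ xpredT (fun k => c k *: p j k) (leq_maxl n' m.+1)).
  rewrite big_mkcond/=; apply: eq_bigr => k _.
  by case: ifP => //; rewrite scale0r.
have mlt : (m < maxn n' m.+1)%N by lia.
rewrite (bigD1 (Ordinal mlt))//= eqxx big1 ?addr0// => k km.
by case: eqP => [kE|_]; [move/eqP: km => []; exact: val_inj|rewrite scale0r].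
Qed.

(** Riesz's theorem in the j-th coordinate; by independence the other factors,
    which have norm 1, do not affect the error. *)
Lemma kernel_times_scalar (q : {poly R}) :
  cl (fun f => q.[crd j f] * cauchy_kernel (crd j f) * Phi a f).
Proof.
have [_ [N0 aN0]] := (multi_indexP a).1 ma.
pose N := maxn N0 j.+1; have jN : (j < N)%N by lia.
have aN i : (N <= i)%N -> a i = 0%N by move=> Ni; apply: aN0; lia.
have aE f : Phi a f = (p j (a j)).[crd j f] * rest N f.
  rewrite -(factor _ _ jN aN); congr (Phi _ f); apply/funext => i.
  by rewrite /upd; case: eqP => // ->.
have mk : measurable_fun setT (fun t : measurableTypeR R => q.[t] * cauchy_kernel t).
  by apply: measurable_funM; [exact: measurable_poly|exact: measurable_cauchy_kernel].
have m1 : measurable_fun setT (fun f : borel X => q.[crd j f] * cauchy_kernel (crd j f) * Phi a f).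
  by apply: measurable_funM; [exact: (measurableT_comp mk (mcrd j))|exact: measurable_scalar].
split => // eps eps0.
have [mqs /(_ _ eps0)[_ [r _ <-] rlt]] :=
  poly_cauchy_kernel_closure (rho_moments j0) (rho_determinate j0) (q * p j (a j)).
exists (fun f => r.[crd j f] * rest N f).
  have [n [c ->]] := poly_span r.
  have -> : (fun f => (\sum_(k < n) c k *: p j k).[crd j f] * rest N f) =
      (fun f => \sum_(z <- [seq (c k, upd a j k) | k <- index_iota 0 n]) z.1 * Phi z.2 f).
    apply/funext => f; rewrite big_map/= horner_sum mulr_suml big_mkord.
    by apply: eq_bigr => k _; rewrite hornerZ -mulrA (factor _ _ jN aN).
  exists [seq (c k, upd a j k) | k <- index_iota 0 n] => // z /mapP[k _ ->] /=.
  exact: upd_multi.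
pose h t := (q * p j (a j)).[t] * cauchy_kernel t - r.[t].
have hE : (fun f : borel X => q.[crd j f] * cauchy_kernel (crd j f) * Phi a f -
      r.[crd j f] * rest N f) = (fun f => h (crd j f) * rest N f).
  by apply/funext => f; rewrite aE /h hornerM; ring.
rewrite hE sqnorm_factor//.
apply/integrableP; split.
  by apply: measurable_sq; apply: measurable_funB => //; exact: measurable_poly.
under eq_integral do rewrite gee0_abs ?lee_fin ?sqr_ge0//.
by apply: lt_trans rlt _; rewrite ltry.
Qed.

End one_coordinate.

(** The multiplier (x_j - c) / (1 + x_j^2) has the sign of x_j - c. *)
Lemma halfspace_multiplier A : coordinate_halfspaces dotX xi A ->
  multiplier_sets rho (H : set (borel X -> R)) A.
Proof.
move=> [j j0 [c ->]].
pose w (f : borel X) : R := ('X - c%:P).[crd j f] * cauchy_kernel (crd j f).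
have Mw : multiplier rho (H : set (borel X -> R)) w.
  split.
  - have mk : measurable_fun setT (fun t : measurableTypeR R => ('X - c%:P).[t] * cauchy_kernel t).
      by apply: measurable_funM; [exact: measurable_poly|exact: measurable_cauchy_kernel].
    exact: (measurableT_comp mk (mcrd j)).
  - exists (1 + `|c|) => f; rewrite /w; set t := crd j f.
    rewrite hornerXsubC normrM (@ger0_norm _ (cauchy_kernel t)) ?(ltW (cauchy_kernel_gt0 _))//.
    have k0 := cauchy_kernel_gt0 t; have kE := cauchy_kernelE t; have k1 := cauchy_kernel_le1 t.
    apply: (@le_trans _ _ ((`|t| + `|c|) * cauchy_kernel t)).
      by rewrite ler_wpM2r ?(ltW k0)// ler_normB.
    rewrite mulrDl lerD//; last by rewrite ler_piMr.
    apply: (@le_trans _ _ ((1 + t ^+ 2) * cauchy_kernel t)); last by rewrite kE.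
    rewrite ler_wpM2r ?(ltW k0)// -[t ^+ 2]real_normK ?num_real//.
    by have := sqr_ge0 (`|t| - 1 / 2); rewrite sqrrB; nra.
  - apply: H_ind.
      have := multiplier_cst rho H_measurable H_lin 0.
      move=> [_ _ /(_ _ H1)]; congr (cl _); apply/funext => f.
      by rewrite /cst mul0r mulr0.
    move=> b a h ma _ clh.
    have := @l2_closure_lin _ _ _ rho (H : set (borel X -> R)) H_measurable H_lin b _ _
      (kernel_times_scalar ma j0 ('X - c%:P)) clh.
    by congr (cl _); apply/funext => f; rewrite /w; ring.
have := @multiplier_indic_gt0 _ _ _ rho (H : set (borel X -> R)) H_measurable H_lin H_fin w Mw.
rewrite /multiplier_sets/=; congr (multiplier _ _ (\1_ _)).
apply/seteqP; split => f /=;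
  by rewrite /w hornerXsubC pmulr_lgt0 ?cauchy_kernel_gt0// subr_gt0.
Qed.

(** The sets with a multiplier indicator form a sigma-algebra containing the
    half-spaces, hence all Borel sets. *)
Theorem scalar_density (u : X -> R) : measurable_fun setT (u : borel X -> R) ->
  (sqnorm rho u < +oo)%E -> cl u.
Proof.
move=> mfu ufin; apply: (@l2_closure_full _ _ _ rho (H : set (borel X -> R))
  H_measurable H_lin H1) => // A mA.
have := borel_coordinate_measurable hilbertX sepX xi_basis mA.
apply: smallest_sub; last exact: halfspace_multiplier.
exact: (@multiplier_sigma_algebra _ _ _ rho (H : set (borel X -> R))
  H_measurable H_lin H_fin).
Qed.

End product_polynomials.

(** * The basis of product polynomials *)

Section product_polynomial_basis.
Context {R : realType} {X Y : completeNormedModType R}.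
Variables (dotX : {dot X for idfun}) (dotY : {dot Y for idfun}).
Hypotheses (hilbertX : induces_norm dotX) (hilbertY : induces_norm dotY).
Hypotheses (sepX : separable X) (sepY : separable Y).
Variables (xi : nat -> X) (psi : nat -> Y).
Hypothesis xi_basis : complete_orthonormal_basis setT dotX posnat xi.
Hypothesis psi_basis : complete_orthonormal_basis setT dotY posnat psi.
Variable rho : probability (borel X) R.
Variable rho_ : nat -> probability (measurableTypeR R) R.
Hypothesis rho_product : product_measure_on dotX xi rho rho_.
Hypothesis rho_moments : forall j, posnat j -> finite_moments (rho_ j).
Hypothesis rho_determinate : forall j, posnat j -> moment_determinate (rho_ j).
Variable p : nat -> nat -> {poly R}.
Hypothesis p_orthonormal : forall j, posnat j -> orthonormal_polynomials (rho_ j) (p j).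

Local Notation S := (@bochner_L2 R X Y rho).
Local Notation ip := (bochner_L2_inner rho dotY).
Local Notation P := (product_polynomial dotX xi psi p).
Local Notation Phi := (scalar_product_polynomial dotX xi p).

Let S_lin := @bochner_L2_lin _ X _ _ hilbertY sepY _ psi_basis rho.
Let ip_lin := @bochner_inner_lin _ X _ _ hilbertY _ psi_basis rho.
Let ipC A B : S A -> S B -> ip A B = ip B A.
Proof. by move=> _ _; exact: bochner_innerC. Qed.
Let ip_ge0 A : S A -> 0 <= ip A A.
Proof. by move=> _; exact: bochner_inner_ge0. Qed.

Let Pa a f : P a f = Phi a f *: psi (a 0%N).
Proof. by []. Qed.

Let S_P a : multi_index a -> S (P a).
Proof.
move=> ma; have [a0 _] := ma.
apply: (@bochner_L2_scale _ _ _ _ hilbertY sepY _ psi_basis rho (Phi a) _ a0).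
  exact: (measurable_scalar hilbertX xi p_orthonormal ma).
by rewrite (scalar_sqnorm hilbertX rho_product rho_moments p_orthonormal)// ltry.
Qed.

Let psi_orth i j : posnat i -> posnat j -> dotY (psi i) (psi j) = (i == j)%:R.
Proof. by have [_ + _] := psi_basis; exact. Qed.

Let P_orth a b : multi_index a -> multi_index b -> ip (P a) (P b) = (a == b)%:R.
Proof.
move=> ma mb; have [a0 _] := ma; have [b0 _] := mb.
have [oi oE] := scalar_orthonormal hilbertX rho_product rho_moments p_orthonormal ma mb.
have -> : ip (P a) (P b) = Rintegral rho setT
    (fun f : borel X => (Phi a f * Phi b f) * (a 0%N == b 0%N)%:R).
  congr Rintegral; apply/funext => f.
  by rewrite !Pa linearZr_LR/= dotC linearZr_LR/= dotC psi_orth//; ring.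
rewrite RintegralZr// oE; case: asboolP => [ab|nab].
  have [ab0|ab0] := eqVneq (a 0%N) (b 0%N); last first.
    by rewrite mulr0; case: eqP => // E; move: ab0; rewrite E eqxx.
  by rewrite mulr1; case: eqP => // -[]; apply/funext => -[//|j]; exact: ab.
by rewrite mul0r; case: eqP => // E; case: nab => j _; rewrite E.
Qed.

Let upd0 (k : nat) (a : nat -> nat) : nat -> nat := fun i => if i is 0 then k else a i.

Let upd0_multi k a : posnat k -> multi_index a -> multi_index (upd0 k a).
Proof.
move=> k0 /multi_indexP[_ [N aN]]; apply/multi_indexP; split => //.
by exists N.+1 => -[//|j] Nj; apply: aN; exact: ltnW.
Qed.

Let upd0_Phi k a f : Phi (upd0 k a) f = Phi a f.
Proof. by apply: eq_fsbigr => -[|j] //; rewrite inE. Qed.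

Local Notation approx := (approximable S ip multi_index P).

Let approx_scalar (u : X -> R) k : posnat k -> measurable_fun setT (u : borel X -> R) ->
  (sqnorm rho u < +oo)%E -> approx (fun f => u f *: psi k).
Proof.
move=> k0 mfu ufin; split; first exact: (bochner_L2_scale hilbertY sepY psi_basis).
move=> eps eps0.
have [_ /(_ eps eps0)[h [s sm hE] uh]] := scalar_density hilbertX sepX xi_basis rho_product
  rho_moments rho_determinate p_orthonormal mfu ufin.
pose s' := [seq (z.1, upd0 k z.2) | z <- s].
exists (fun f => h f *: psi k).
  exists s'; first by move=> z /mapP[y ys ->] /=; apply: upd0_multi => //; exact: sm.
  apply/funext => f; rewrite /combination big_map/= fct_sumE hE scaler_suml.
  apply: eq_bigr => z _.
  change ((z.1 * Phi z.2 f) *: psi k = z.1 *: P (upd0 k z.2) f).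
  by rewrite Pa upd0_Phi scalerA.
have mh : measurable_fun setT (h : borel X -> R).
  have Hh : scalar_combinations dotX xi p h by exists s.
  exact: (measurable_scalar_combination hilbertX p_orthonormal Hh).
have muh : measurable_fun setT (fun f : borel X => u f - h f) by exact: measurable_funB.
have E : (fun f => u f *: psi k) - (fun f => h f *: psi k) = (fun f => (u f - h f) *: psi k).
  apply/funext => f; change (u f *: psi k - h f *: psi k = (u f - h f) *: psi k).
  by rewrite scalerBl.
rewrite E -lte_fin (bochner_norm_scale hilbertY sepY psi_basis k0 muh)//.
by apply: lt_trans uh _; rewrite ltry.
Qed.

(** Truncation to finitely many coordinates of Y leaves scalar functions, each
    of which is approximated by scalar product polynomials. *)
Lemma product_polynomial_basis : complete_orthonormal_basis S ip multi_index P.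
Proof.
split; [exact: S_P|exact: P_orth|].
move=> v Sv eps eps0; have e20 : 0 < eps ^+ 2 by rewrite exprn_gt0.
suff [_ /(_ _ e20)[w [s sm ->] lt]] : approx v.
  have [J [c [JD E]]] := combination_collect P sm.
  by exists J, c; split => //; rewrite /= -E.
apply: (approximable_limit S_lin ipC ip_lin ip_ge0 S_P) => // e e0.
have [n ne] := truncation_approx hilbertY sepY psi_basis Sv e0.
pose B : X -> Y := fun f => \sum_(1 <= k < n) dotY (v f) (psi k) *: psi k.
have aB : approx B.
  have -> : B = \sum_(1 <= k < n) (fun f => dotY (v f) (psi k) *: psi k).
    by apply/funext => f; rewrite fct_sumE.
  rewrite big_seq; elim/big_ind: _ => [|u u1 au au1|k].
  - exact: (@approximable0 _ _ _ S ip multi_index P S_lin ip_lin v Sv).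
  - exact: (@approximableD _ _ _ S ip multi_index P S_lin ipC ip_lin ip_ge0 S_P u u1 au au1).
  - rewrite mem_index_iota => /andP[k0 _]; have [mk fk] := bochner_coordinate hilbertY psi_basis Sv k0.
    exact: approx_scalar.
exists B => //; have [SB _] := aB.
have SvB : S (v - B) by rewrite addrC -scaleN1r; exact: S_lin.
rewrite -lte_fin -(bochner_normE hilbertY psi_basis SvB).
exact: le_lt_trans ne.
Qed.

(** Fourier partial sums are best approximations, so density of the span forces
    them to converge. *)
Lemma product_polynomial_expansion (K : X -> Y) (L : nat -> {fset (nat -> nat)}) :
  S K -> exhaustion L ->
  (\int[rho]_(f in setT) (`|K f - \sum_(a <- L N) ip K (P a) *: P a f| ^+ 2)%:E)%E
    @[N --> \oo] --> 0%E.
Proof.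
move=> SK [Lmono LD].
pose w N : X -> Y := K - \sum_(a <- L N) ip K (P a) *: P a.
have Sw N : S (w N).
  rewrite /w addrC -scaleN1r; apply: S_lin => //.
  apply: (expansion_in_space S_lin S_P _ SK) => a aL.
  by rewrite -LD; exists N.
have wE N : (\int[rho]_(f in setT) (`|K f - \sum_(a <- L N) ip K (P a) *: P a f| ^+ 2)%:E
    = (ip (w N) (w N))%:E)%E.
  rewrite -(bochner_normE hilbertY psi_basis (Sw N)); apply: eq_integral => f _.
  congr (`| _ | ^+ 2)%:E; change (K f - \sum_(a <- L N) ip K (P a) *: P a f =
    K f - (\sum_(a <- L N) ip K (P a) *: P a) f).
  by rewrite fct_sumE.
under eq_fun do rewrite wE.
apply: cvg_EFin; first by near=> N.
apply/cvgrPdist_lt => e e0.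
have [N0 h] := exhaustion_approx S_lin ipC ip_lin S_P P_orth product_polynomial_basis
  Lmono LD SK e0.
exists N0 => // N /= /h lt; rewrite sub0r normrN ger0_norm//.
exact: ip_ge0.
Unshelve. all: by end_near. Qed.

End product_polynomial_basis.

Theorem theorem4p2 (R : realType) (X Y : completeNormedModType R)
    (dotX : {dot X for idfun}) (dotY : {dot Y for idfun})
    (hilbertX : induces_norm dotX) (hilbertY : induces_norm dotY)
    (sepX : separable X) (sepY : separable Y)
    (xi : nat -> X) (psi : nat -> Y)
    (xi_basis : complete_orthonormal_basis setT dotX posnat xi)
    (psi_basis : complete_orthonormal_basis setT dotY posnat psi)
    (rho : probability (borel X) R)
    (rho_ : nat -> probability (measurableTypeR R) R)
    (rho_product : product_measure_on dotX xi rho rho_)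
    (rho_moments : forall j, posnat j -> finite_moments (rho_ j))
    (rho_increase : forall j, posnat j ->
       infinite_set [set x | point_of_increase
                               (distribution_function (rho_ j)) x])
    (rho_determinate : forall j, posnat j -> moment_determinate (rho_ j))
    (p : nat -> nat -> {poly R})
    (p_orthonormal : forall j, posnat j ->
       orthonormal_polynomials (rho_ j) (p j)) :
  let P := product_polynomial dotX xi psi p in
  complete_orthonormal_basis (bochner_L2 rho)
    (bochner_L2_inner rho dotY) multi_index P /\
  forall K : X -> Y, bochner_L2 rho K ->
  forall L : nat -> {fset (nat -> nat)}, exhaustion L ->
  let c := fun a => bochner_L2_inner rho dotY K (P a) in
  (\int[rho]_(f in setT)
      (`|K f - \sum_(a <- L N) c a *: P a f| ^+ 2)%:E)%E
    @[N --> \oo] --> 0%E.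
Proof.
split; first exact: (product_polynomial_basis hilbertX hilbertY sepX sepY xi_basis
  psi_basis rho_product).
move=> K SK L exL; exact: (product_polynomial_expansion hilbertX hilbertY sepX sepY
  xi_basis psi_basis rho_product).
Qed.
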